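(* Let $\mathcal{J}=\{j_\ell\}_{\ell\ge0}$ and $\mathcal{N}=\{n_\ell\}_{\ell\ge0}$ be parameter sequences. For each $i\ge1$, the heat kernel on the corresponding $F_i$ is the function $p_t^{F_i}(x,y)$, $(t,x,y)\in(0,\infty)\times F_i\times F_i$, given by $$p_t^{F_i}(x,y)=\begin{cases} p_t^{F_{i-1}}(\phi_i(x),\phi_i(y)) & \text{if } x,y \text{ are in different bundles},\\ p_t^{F_{i-1}}(\phi_i(x),\phi_i(y))-N_{i-1}J_i\big(p^{F_0}_{J_i^2t}(J_i\theta_x,J_i\theta_y)-p^{F_0}_{J_i^2t}(J_i\theta_x,-J_i\theta_y)\big) & \text{if } x,y \text{ are in different cells of the same bundle},\\ p_t^{F_{i-1}}(\phi_i(x),\phi_i(y))+N_{i-1}(n_i-1)J_i\big(p^{F_0}_{J_i^2t}(J_i\theta_x,J_i\theta_y)-p^{F_0}_{J_i^2t}(J_i\theta_x,-J_i\theta_y)\big) & \text{if } x,y \text{ are in the same cell}. \end{cases}$$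
   Context: Parameters. $j_\ell,n_\ell$ are integers with $j_0=n_0=1$ and $j_\ell,n_\ell\ge2$ for $\ell\ge1$. Set $J_0=N_0=1$, $J_i=\prod_{\ell=1}^ij_\ell$, $N_i=\prod_{\ell=1}^in_\ell$, $[n_i]=\{1,\dots,n_i\}$, $L_i=\pi/J_i$ for $i\ge1$. Spaces. Let $\vartheta_0=\{0,\pi\}$ and, for $i\ge1$, $\vartheta_i=\{\pi k/J_i: 0<k<2J_i,\ j_i\nmid k\}$; thus $\bigcup_{\ell=0}^i\vartheta_\ell=\{\pi k/J_i:0\le k<2J_i\}$. Let $F_0=\mathbb{R}/2\pi\mathbb{Z}$ be the circle (points identified with angles in $[0,2\pi)$), $B_0=\vartheta_0$, $B_1=B_0\cup\vartheta_1$, and inductively for $i\ge1$: $F_i=(F_{i-1}\times[n_i])/\!\sim$ with the quotient topology, where $(x,w)\sim(x',w')$ iff $x=x'$ and ($w=w'$ or $x\in B_i$), and for $i\ge2$, $B_i=B_{i-1}\cup(\vartheta_i\times[n_1]\times\dots\times[n_{i-1}])\subseteq F_{i-1}$ (the set of points of $F_{i-1}$ whose angle lies in $\bigcup_{\ell\le i}\vartheta_\ell$). $[\eta w_1\dots w_i]$ denotes the point of $F_i$ represented by $\eta\in F_0$, $w_\ell\in[n_\ell]$. Let $\phi_i:F_i\to F_{i-1}$ be the map induced by $(x,w)\mapsto x$. Cells. For $i\ge1$ let $\mathcal{A}_i=\big(\bigcup_{\ell=0}^i\vartheta_\ell\big)\times[n_1]\times\dots\times[n_i]$. For $\alpha=(\eta,w_1,\dots,w_i)\in\mathcal{A}_i$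 let $\varphi_\alpha:[0,L_i]\to F_i$, $\varphi_\alpha(\theta)=[(\eta+\theta)w_1\dots w_i]$; its image $I_\alpha$ is an $i$-cell. Two $i$-cells $I_\alpha,I_\beta$ are in the same bundle if $\alpha,\beta$ agree in all but possibly their last entry. For $x\in F_i$, $(\theta_x,\alpha_x)\in[0,L_i)\times\mathcal{A}_i$ is a pair with $\varphi_{\alpha_x}(\theta_x)=x$; if not unique, $\alpha_x$ is chosen smallest in lexicographic order. For $x,y\in F_i$: ''same cell'' means $\alpha_x=\alpha_y$; ''different cells of the same bundle'' means $\alpha_x\ne\alpha_y$ but $I_{\alpha_x},I_{\alpha_y}$ are in the same bundle; ''different bundles'' means they are not in the same bundle. Measures. $\int_{F_i}f\,d\mu_i=\sum_{\alpha\in\mathcal{A}_i}\frac1{N_i}\int_0^{L_i}f(\varphi_\alpha(\theta))\,d\theta$ for $i\ge1$. Kernel on the circle. $p_t^{F_0}(\theta_1,\theta_2)=\frac1{2\pi}+\frac1\pi\sum_{k=1}^\infty e^{-k^2t}\cos(k(\theta_2-\theta_1))$. Heat kernel on $F_i$, $i\ge1$. Writing $f_\alpha=f\circ\varphi_\alpha$, consider on $L^2(F_i,\mu_i)$ the Dirichlet form $\mathcal{E}^{F_i}(f,g)=\sum_{\alpha\in\mathcal{A}_i}\frac1{N_i}\int_0^{L_i}f_\alpha'(\theta)g_\alpha'(\theta)\,d\theta$ with domain $\mathcal{F}^{F_i}=\{f\in C(F_i): f_\alpha\in H^1([0,L_i])\ \forall\alpha\in\mathcal{A}_i\}$. Let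 $A$ be the nonnegative self-adjoint operator with $\mathcal{E}^{F_i}(f,g)=\langle Af,g\rangle_{L^2(F_i,\mu_i)}$. The heat kernel on $F_i$ is the integral kernel of $e^{-tA}$ with respect to $\mu_i$, i.e. $e^{-tA}f(x)=\int_{F_i}p_t^{F_i}(x,y)f(y)\,\mu_i(dy)$. *)

(* Defs.v *)
From HB Require Import structures.
From mathcomp Require Import all_boot all_order all_algebra.
From mathcomp Require Import all_classical all_reals all_analysis.

Set Implicit Arguments.
Unset Strict Implicit.
Unset Printing Implicit Defensive.

Import Order.TTheory GRing.Theory Num.Theory.
Import numFieldNormedType.Exports.

Local Open Scope classical_set_scope.
Local Open Scope ring_scope.
Local Open Scope quotient_scope.

Record diamond_params := DiamondParams {
  jpar : nat -> nat;
  npar : nat -> nat;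
  jpar0 : jpar 0 = 1%N;
  npar0 : npar 0 = 1%N;
  jpar_ge2 : forall l, (1 <= l)%N -> (2 <= jpar l)%N;
  npar_ge2 : forall l, (1 <= l)%N -> (2 <= npar l)%N }.

Definition Jprod (P : diamond_params) (i : nat) : nat :=
  (\prod_(1 <= l < i.+1) jpar P l)%N.

Definition Nprod (P : diamond_params) (i : nat) : nat :=
  (\prod_(1 <= l < i.+1) npar P l)%N.

Lemma npar_gt0 (P : diamond_params) l : (0 < npar P l)%N.
Proof.
by case: l => [|l]; [rewrite npar0 | exact: (leq_trans _ (npar_ge2 P _))].
Qed.

Lemma Jprod_gt0 (P : diamond_params) i : (0 < Jprod P i)%N.
Proof.
rewrite /Jprod big_nat prodn_cond_gt0// => l /andP[l1 _].
exact: (leq_trans _ (jpar_ge2 P l1)).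
Qed.

Lemma double_Jprod_gt0 (P : diamond_params) i : (0 < 2 * Jprod P i)%N.
Proof. by rewrite muln_gt0 Jprod_gt0. Qed.

Section circle.
Variable R : realType.

Definition circle_rel (x y : R) : bool := (x - y) / (2 * pi) \is a Num.int.

Lemma circle_rel_refl : reflexive circle_rel.
Proof. by move=> x; rewrite /circle_rel subrr mul0r. Qed.

Lemma circle_rel_sym : symmetric circle_rel.
Proof. by move=> x y; rewrite /circle_rel -opprB mulNr rpredN. Qed.

Lemma circle_rel_trans : transitive circle_rel.
Proof.
move=> y x z; rewrite /circle_rel => xy yz.
by rewrite -(subrKA y) mulrDl rpredD.
Qed.

Definition circle_equiv :=
  EquivRel circle_rel circle_rel_refl circle_rel_sym circle_rel_trans.

Definition circle : topologicalType :=
  quotient_topology {eq_quot circle_equiv}.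

Definition to_circle (eta : R) : circle := \pi_{eq_quot circle_equiv} eta.

End circle.

Section glue.
Variables (X : topologicalType) (B : set X) (m : nat).

Definition glue_rel : rel (X * discrete_topology 'I_m) :=
  fun u v => (u.1 == v.1) && ((u.2 == v.2) || `[< B u.1 >]).

Lemma glue_rel_refl : reflexive glue_rel.
Proof. by move=> u; rewrite /glue_rel !eqxx. Qed.

Lemma glue_rel_sym : symmetric glue_rel.
Proof.
move=> u v; rewrite /glue_rel eq_sym (eq_sym u.2).
by case: (eqVneq v.1 u.1) => [->|].
Qed.

Lemma glue_rel_trans : transitive glue_rel.
Proof.
move=> v u w; rewrite /glue_rel => /andP[/eqP-> /orP[/eqP->//|->]].
by move=> /andP[/eqP-> _]; rewrite eqxx orbT.
Qed.

Definition glue_equiv :=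
  EquivRel glue_rel glue_rel_refl glue_rel_sym glue_rel_trans.

Definition glue : topologicalType := quotient_topology {eq_quot glue_equiv}.

Definition to_glue (x : X) (w : 'I_m) : glue := \pi_{eq_quot glue_equiv} (x, w).

(* Equivalent pairs have equal first components, so the representative chosen
   by [repr] is irrelevant and this is the map induced by (x, w) |-> x. *)
Definition glue_fst (z : glue) : X :=
  (repr (z : {eq_quot glue_equiv}) : X * discrete_topology 'I_m).1.

Lemma glue_fstE x w : glue_fst (to_glue x w) = x.
Proof.
rewrite /glue_fst /to_glue.
by case: piP => -[y v] /eqmodP /andP[/eqP].
Qed.

End glue.

Section spaces.
Variables (R : realType) (P : diamond_params).

Definition vartheta (l : nat) : set R :=
  if l is 0 then [set 0; pi] else
  [set eta | exists k : nat,
     [/\ (0 < k < 2 * Jprod P l)%N, ~~ (jpar P l %| k)%N &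
         eta = pi * k%:R / (Jprod P l)%:R]].

Definition vartheta_upto (i : nat) : set R :=
  [set eta | exists2 l, (l <= i)%N & vartheta l eta].

(* The space [F_i] together with its angle map to the circle, which singles out
   the gluing set [B_{i+1}]: the points of [F_i] whose angle lies in
   [vartheta_0], ..., [vartheta_{i+1}]. *)
Fixpoint space_angle (i : nat) : {X : topologicalType & X -> circle R} :=
  if i is i'.+1 then
    let Xa := space_angle i' in
    let B := [set x : projT1 Xa |
                exists2 eta, vartheta_upto i'.+1 eta &
                             projT2 Xa x = to_circle eta] in
    existT (fun X : topologicalType => X -> circle R)
      (glue B (npar P i'.+1)) (fun z => projT2 Xa (glue_fst z))
  else existT (fun X : topologicalType => X -> circle R) (circle R) id.

Definition diamond (i : nat) : topologicalType := projT1 (space_angle i).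

Definition diamond_proj (i : nat) : diamond i.+1 -> diamond i :=
  fun z => glue_fst z.

(* [word i] is [n_1] x ... x [n_i], and letters are numbered from 0. *)
Fixpoint word (i : nat) : finType :=
  if i is i'.+1 then (word i' * 'I_(npar P i'.+1))%type else unit.

(* [(k, w) : cell_index i] stands for (pi k / J_i, w_1, ..., w_i); the angles
   in vartheta_0 U ... U vartheta_i are exactly the pi k / J_i, 0 <= k < 2 J_i *)
Definition cell_index (i : nat) : finType :=
  ('I_(2 * Jprod P i) * word i)%type.

Fixpoint diamond_point (i : nat) (eta : R) : word i -> diamond i :=
  match i return word i -> diamond i with
  | 0 => fun=> to_circle eta
  | i'.+1 => fun w => to_glue _ (diamond_point eta w.1) w.2
  end.

Definition cell_length (i : nat) : R := pi / (Jprod P i)%:R.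

Definition cell_map (i : nat) (a : cell_index i) (theta : R) : diamond i :=
  diamond_point (pi * (a.1 : nat)%:R / (Jprod P i)%:R + theta) a.2.

Definition same_bundle (i : nat) : rel (cell_index i) :=
  match i return rel (cell_index i) with
  | 0 => fun=> xpredT
  | i'.+1 => fun a b => (a.1 == b.1) && (a.2.1 == b.2.1)
  end.

Fixpoint word_seq (i : nat) : word i -> seq nat :=
  match i return word i -> seq nat with
  | 0 => fun=> [::]
  | i'.+1 => fun w => rcons (word_seq w.1) w.2
  end.

Definition cell_lexle (i : nat) (a b : cell_index i) : bool :=
  (((a.1 : nat) :: word_seq a.2 : seqlexi nat) <=
   ((b.1 : nat) :: word_seq b.2 : seqlexi nat))%O.

Fixpoint word0 (i : nat) : word i :=
  match i return word i with
  | 0 => tt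
  | i'.+1 => (word0 i', Ordinal (npar_gt0 P i'.+1))
  end.

Definition cell0 (i : nat) : cell_index i :=
  (Ordinal (double_Jprod_gt0 P i), word0 i).

Definition represents (i : nat) (x : diamond i) (z : R * cell_index i) : Prop :=
  0 <= z.1 < cell_length i /\ cell_map z.2 z.1 = x.

Definition coord (i : nat) (x : diamond i) : R * cell_index i :=
  xget (0, cell0 i) [set z | represents x z /\
    forall z', represents x z' -> cell_lexle z.2 z'.2].

Definition theta_ (i : nat) (x : diamond i) : R := (coord x).1.
Definition alpha_ (i : nat) (x : diamond i) : cell_index i := (coord x).2.

End spaces.

Section kernels.
Variables (R : realType) (P : diamond_params).

Definition circle_kernel (t th1 th2 : R) : R :=
  1 / (2 * pi) +
  1 / pi * limn (series (fun k : nat =>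
    expR (- (k.+1%:R ^+ 2) * t) * cos (k.+1%:R * (th2 - th1)))).

(* [circle_kernel] is 2pi-periodic in both angles, so any representatives do. *)
Fixpoint diamond_kernel (i : nat) (t : R) :
    diamond R P i -> diamond R P i -> R :=
  match i return diamond R P i -> diamond R P i -> R with
  | 0 => fun x y =>
      circle_kernel t (repr (x : {eq_quot circle_equiv R}))
                      (repr (y : {eq_quot circle_equiv R}))
  | i'.+1 => fun x y =>
      let J : R := (Jprod P i'.+1)%:R in
      let N : R := (Nprod P i')%:R in
      let base := diamond_kernel t (diamond_proj x) (diamond_proj y) in
      let D := circle_kernel (J ^+ 2 * t) (J * theta_ x) (J * theta_ y)
             - circle_kernel (J ^+ 2 * t) (J * theta_ x) (- (J * theta_ y)) in
      if ~~ same_bundle (alpha_ x) (alpha_ y) then base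
      else if alpha_ x != alpha_ y then base - N * J * D
      else base + N * ((npar P i'.+1)%:R - 1) * J * D
  end.

End kernels.

Section interval.
Variables (R : realType) (L : R).
Local Notation lambda := (@lebesgue_measure R).

Definition itv_L2 (u : R -> R) : Prop :=
  measurable_fun `[0, L] u /\
  lambda.-integrable `[0, L] (fun s => (u s ^+ 2)%:E).

(* u is absolutely continuous on [0, L] with derivative g in L^2 *)
Definition itv_deriv (u g : R -> R) : Prop :=
  itv_L2 g /\
  forall s, 0 <= s <= L -> u s = u 0 + \int[lambda]_(r in `[0, s]) g r.

Definition itv_H1 (u : R -> R) : Prop := exists g, itv_deriv u g.

(* The derivative, which is unique up to a Lebesgue null set, of u in H^1 *)
Definition itv_weak_deriv (u : R -> R) : R -> R :=
  xget (cst 0) [set g | itv_deriv u g].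

End interval.

Section heat.
Variables (R : realType) (P : diamond_params) (i : nat).
Local Notation lambda := (@lebesgue_measure R).
Local Notation F := (diamond R P i).
Local Notation L := (cell_length R P i).

Definition mu_integral (f : F -> R) : R :=
  \sum_(a : cell_index P i) (Nprod P i)%:R^-1 *
     \int[lambda]_(s in `[0, L]) f (cell_map a s).

Definition mu_L2 (f : F -> R) : Prop :=
  forall a : cell_index P i, itv_L2 L (fun s => f (cell_map a s)).

Definition mu_ae_eq (f g : F -> R) : Prop :=
  forall a : cell_index P i,
    {ae lambda, forall s, 0 <= s <= L -> f (cell_map a s) = g (cell_map a s)}.

Definition mu_inner (f g : F -> R) : R := mu_integral (fun x => f x * g x).

Definition mu_norm2 (f : F -> R) : R := mu_inner f f.

Definition form_dom (f : F -> R) : Prop :=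
  continuous f /\
  forall a : cell_index P i, itv_H1 L (fun s => f (cell_map a s)).

Definition form (f g : F -> R) : R :=
  \sum_(a : cell_index P i) (Nprod P i)%:R^-1 *
     \int[lambda]_(s in `[0, L])
        (itv_weak_deriv L (fun r => f (cell_map a r)) s *
         itv_weak_deriv L (fun r => g (cell_map a r)) s).

(* The graph of A in L^2: [f] is a.e. equal to some [u] in the form domain,
   and [form u g] = < h, g > for all [g] in the form domain. *)
Definition operator_graph (f h : F -> R) : Prop :=
  [/\ mu_L2 f, mu_L2 h &
      exists u, [/\ mu_ae_eq u f, form_dom u &
        forall g, form_dom g -> form u g = mu_inner h g]].

(* [T t] = exp(- t A) for t > 0: T is the strongly continuous semigroup of
   linear contractions of L^2 with generator - A. *)
Record is_exp_semigroup (T : R -> (F -> R) -> (F -> R)) : Prop := {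
  expA_L2 : forall t f, 0 < t -> mu_L2 f -> mu_L2 (T t f);
  expA_linear : forall t c f g, 0 < t -> mu_L2 f -> mu_L2 g ->
    mu_ae_eq (T t (fun x => c * f x + g x))
             (fun x => c * T t f x + T t g x);
  expA_contraction : forall t f, 0 < t -> mu_L2 f ->
    mu_norm2 (T t f) <= mu_norm2 f;
  expA_semigroup : forall s t f, 0 < s -> 0 < t -> mu_L2 f ->
    mu_ae_eq (T (s + t) f) (T s (T t f));
  expA_continuous : forall f, mu_L2 f ->
    mu_norm2 (fun x => T t f x - f x) @[t --> 0^'+] --> 0;
  expA_generator : forall f h, mu_L2 f -> mu_L2 h ->
    operator_graph f h <->
    mu_norm2 (fun x => (f x - T t f x) / t - h x) @[t --> 0^'+] --> 0 }.

(* The integral kernel of exp(- t A) is only determined up to null sets;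
   continuity in (x, y) selects the pointwise defined version. *)
Definition is_heat_kernel (p : R -> F -> F -> R) : Prop :=
  (forall t, 0 < t -> continuous (fun z : F * F => p t z.1 z.2)) /\
  exists T, is_exp_semigroup T /\
    forall t f, 0 < t -> mu_L2 f ->
      mu_ae_eq (T t f) (fun x => mu_integral (fun y => p t x y * f y)).

End heat.

(* Main.v *)
(* The kernel is recognised through its spectral expansion. By induction on i,
   L^2(F_i) has a Parseval frame of eigenfunctions of A. On the circle it is the
   trigonometric system. A function on F_{i+1} is the sum of its mean over the
   fibres of phi_{i+1}, which lives on F_i, and of a deviation that vanishes at
   all the angles pi k / J_{i+1}; accordingly the frame of F_{i+1} consists of
   the frame of F_i composed with phi_{i+1} and of the functions
   sin(m J_{i+1} .), one family per (i+1)-cell, spread over the bundle of that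
   cell with weights delta - 1/n_{i+1} of zero sum. Summing
   exp(- lambda t) f(x) f(y) over the new eigenfunctions f gives
   N_i J_{i+1} (n_{i+1} delta - 1) times the difference of circle kernels, which
   is the recursion of the statement.

   Parseval's identity turns each property of the semigroup into a termwise
   limit, so the kernel of the statement is a heat kernel. Conversely, if T has
   generator - A and A f = lambda f, then the distance from T_t f to
   exp(- lambda t) f is subadditive in t and o(t), hence zero; so for any heat
   kernel p and any x, the frame coefficients of the continuous function
   p t x are prescribed, which determines it everywhere. *)

From HB Require Import structures.
From mathcomp Require Import all_boot all_order all_algebra.
From mathcomp Require Import all_classical all_reals all_analysis.
From mathcomp Require Import measurable_realfun ring lra.
Require Import Defs.

Set Implicit Arguments.
Unset Strict Implicit.
Unset Printing Implicit Defensive.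

Import Order.TTheory GRing.Theory Num.Theory.
Import numFieldNormedType.Exports.

Local Open Scope classical_set_scope.
Local Open Scope ring_scope.
Local Open Scope quotient_scope.

(** * Semi-inner products *)

(** The frame is redundant because the weights delta - 1/n of a bundle are linearly dependent; in
    exchange, the sum over the new modes has the closed form n delta - 1 directly. What is left of
    orthogonality is that modes with distinct eigenvalues are orthogonal, by symmetry of the form;
    together with the polarised Parseval identity this suffices. Functions are never identified
    modulo null sets: [mu_inner] is only a semi-inner product, and a.e. equality means distance 0.
    No spectral theorem is invoked. The domain of A is recovered from coefficients because A u = h
    is solved explicitly, by a double primitive on the circle and with Dirichlet conditions on each
    cell. Completeness of the trigonometric systems comes from moments: if f is orthogonal to all
    powers of c, approximating an indicator by polynomials makes f orthogonal to the indicator of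
    tau < c; when c and tau can be chosen so that these sets are initial segments, the primitive of
    f vanishes. Continuity of the kernel, invisible in its definition by cases, follows from the
    uniform convergence of its expansion. *)

Section semi_inner_product.
Context {R : realType} {T : Type}.
Implicit Types (f g h : T -> R).

(** Not definite, since functions are not identified when they agree a.e. Linearity is restricted to
    [S], where the integrals converge; symmetry and positivity hold for all functions under the
    default values of the integral. *)
Record semi_inner (S : (T -> R) -> Prop) (ip : (T -> R) -> (T -> R) -> R) : Prop := {
  si_lin : forall a f g, S f -> S g -> S (fun x => a * f x + g x);
  si_zero : S (fun=> 0);
  si_sym : forall f g, ip f g = ip g f;
  si_linl : forall a f g h, S f -> S g -> S h ->
    ip (fun x => a * f x + g x) h = a * ip f h + ip g h;
  si_ge0 : forall f, 0 <= ip f f }.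

Variables (S : (T -> R) -> Prop) (ip : (T -> R) -> (T -> R) -> R).
Hypothesis si : semi_inner S ip.

Lemma si_add f g : S f -> S g -> S (fun x => f x + g x).
Proof.
move=> Sf Sg; have := si_lin si 1 Sf Sg.
by congr S; apply/funext => x; rewrite mul1r.
Qed.

Lemma si_scale a f : S f -> S (fun x => a * f x).
Proof.
move=> Sf; have := si_lin si a Sf (si_zero si).
by congr S; apply/funext => x; rewrite addr0.
Qed.

Lemma si_sub f g : S f -> S g -> S (fun x => f x - g x).
Proof.
move=> Sf Sg; have := si_lin si (-1) Sg Sf.
by congr S; apply/funext => x; rewrite mulN1r addrC.
Qed.

Lemma ip_addl f g h : S f -> S g -> S h ->
  ip (fun x => f x + g x) h = ip f h + ip g h.
Proof.
move=> Sf Sg Sh; rewrite -[ip f h]mul1r -(si_linl si)//.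
by congr ip; apply/funext => x; rewrite mul1r.
Qed.

Lemma ip_subl f g h : S f -> S g -> S h ->
  ip (fun x => f x - g x) h = ip f h - ip g h.
Proof.
move=> Sf Sg Sh; rewrite addrC -mulN1r -(si_linl si)//.
by congr ip; apply/funext => x; rewrite mulN1r addrC.
Qed.

Lemma ip_zerol h : S h -> ip (fun=> 0) h = 0.
Proof.
move=> Sh; rewrite -[RHS](subrr (ip (fun=> 0) h)).
rewrite -(ip_subl (si_zero si) (si_zero si) Sh).
by congr ip; apply/funext => x; rewrite subrr.
Qed.

Lemma ip_scalel a f h : S f -> S h -> ip (fun x => a * f x) h = a * ip f h.
Proof.
move=> Sf Sh; rewrite -[RHS]addr0 -(ip_zerol Sh) -(si_linl si)//.
  by congr ip; apply/funext => x; rewrite addr0.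
exact: si_zero si.
Qed.

Lemma si_sum I (s : seq I) (c : I -> R) (phi : I -> T -> R) :
  (forall k, S (phi k)) -> S (fun x => \sum_(k <- s) c k * phi k x).
Proof.
move=> Sphi; elim: s => [|k s IH].
  by under eq_fun do rewrite big_nil; exact: si_zero si.
by under eq_fun do rewrite big_cons; exact: (si_lin si).
Qed.

Lemma ip_suml I (s : seq I) (c : I -> R) (phi : I -> T -> R) h :
  (forall k, S (phi k)) -> S h ->
  ip (fun x => \sum_(k <- s) c k * phi k x) h = \sum_(k <- s) c k * ip (phi k) h.
Proof.
move=> Sphi Sh; elim: s => [|k s IH].
  by under eq_fun do rewrite big_nil; rewrite big_nil ip_zerol.
under eq_fun do rewrite big_cons.
by rewrite big_cons (si_linl si)// ?IH//; exact: si_sum.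
Qed.

Lemma ip_addadd f g : S f -> S g ->
  ip (fun x => f x + g x) (fun x => f x + g x) = ip f f + 2 * ip f g + ip g g.
Proof.
move=> Sf Sg; rewrite ip_addl//; last exact: si_add.
rewrite !(si_sym si _ (fun x => f x + g x)) !ip_addl// (si_sym si g f); ring.
Qed.

Lemma ip_subsub f g : S f -> S g ->
  ip (fun x => f x - g x) (fun x => f x - g x) = ip f f - 2 * ip f g + ip g g.
Proof.
move=> Sf Sg; rewrite ip_subl//; last exact: si_sub.
rewrite !(si_sym si _ (fun x => f x - g x)) !ip_subl// (si_sym si g f); ring.
Qed.

Lemma ip_scalescale a f : S f ->
  ip (fun x => a * f x) (fun x => a * f x) = a ^+ 2 * ip f f.
Proof.
move=> Sf; rewrite ip_scalel//; last exact: si_scale.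
by rewrite (si_sym si) ip_scalel// mulrA.
Qed.

Lemma ip_cauchy_schwarz f g : S f -> S g -> (ip f g) ^+ 2 <= ip f f * ip g g.
Proof.
move=> Sf Sg; have key a : 0 <= a ^+ 2 * ip f f + 2 * a * ip f g + ip g g.
  have := si_ge0 si (fun x => a * f x + g x).
  rewrite ip_addadd//; last exact: si_scale.
  by rewrite ip_scalescale// ip_scalel// mulrA.
have f0 := si_ge0 si f.
have [ff0|ff0] := eqVneq (ip f f) 0.
  rewrite ff0 mul0r; have [->|fg0] := eqVneq (ip f g) 0; first by rewrite expr0n.
  (* With [ip f f = 0] the quadratic is affine in [a]; this value of [a] makes it equal to -1. *)
  have := key (- (ip g g + 1) / (2 * ip f g)).
  rewrite ff0 mulr0 add0r.
  have -> : 2 * (- (ip g g + 1) / (2 * ip f g)) * ip f g = - (ip g g + 1).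
    by field; rewrite fg0.
  lra.
have fpos : 0 < ip f f by rewrite lt_neqAle eq_sym ff0.
have := key (- ip f g / ip f f).
have -> : (- ip f g / ip f f) ^+ 2 * ip f f + 2 * (- ip f g / ip f f) * ip f g + ip g g
  = ip g g - (ip f g) ^+ 2 / ip f f by field.
by rewrite subr_ge0 ler_pdivrMr// mulrC.
Qed.

Definition seminorm f : R := Num.sqrt (ip f f).

Lemma seminorm_ge0 f : 0 <= seminorm f. Proof. exact: sqrtr_ge0. Qed.

Lemma sqr_seminorm f : seminorm f ^+ 2 = ip f f.
Proof. by rewrite sqr_sqrtr// (si_ge0 si). Qed.

Lemma ip_le_seminorm f g : S f -> S g -> `|ip f g| <= seminorm f * seminorm g.
Proof.
move=> Sf Sg; rewrite -(ler_sqr (normr_ge0 _)) ?nnegrE ?mulr_ge0 ?seminorm_ge0//.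
by rewrite real_normK ?num_real// exprMn !sqr_seminorm ip_cauchy_schwarz.
Qed.

Lemma seminorm_add f g : S f -> S g ->
  seminorm (fun x => f x + g x) <= seminorm f + seminorm g.
Proof.
move=> Sf Sg.
rewrite -ler_sqr ?nnegrE ?addr_ge0 ?seminorm_ge0// sqr_seminorm ip_addadd//.
rewrite sqrrD !sqr_seminorm lerD2r lerD2l -[leRHS]mulr_natl ler_pM2l//.
exact: le_trans (ler_norm _) (ip_le_seminorm Sf Sg).
Qed.

Lemma seminorm_scale a f : S f -> seminorm (fun x => a * f x) = `|a| * seminorm f.
Proof.
by move=> Sf; rewrite /seminorm ip_scalescale// sqrtrM ?sqr_ge0// sqrtr_sqr.
Qed.

Lemma seminorm_le f a : 0 <= a -> ip f f <= a ^+ 2 -> seminorm f <= a.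
Proof.
by move=> a0 fa; rewrite -ler_sqr ?nnegrE ?seminorm_ge0// sqr_seminorm.
Qed.

Lemma seminorm_eq0 f : seminorm f <= 0 -> ip f f = 0.
Proof.
move=> f0; have {}f0 : seminorm f = 0.
  by apply/eqP; rewrite eq_le f0 seminorm_ge0.
by rewrite -sqr_seminorm f0 expr0n.
Qed.

Lemma ip_null f g : S f -> S g -> ip f f = 0 -> ip f g = 0.
Proof.
move=> Sf Sg f0; have := ip_cauchy_schwarz Sf Sg; rewrite f0 mul0r => fg.
by apply/eqP; rewrite -sqrf_eq0 eq_le fg sqr_ge0.
Qed.

Lemma cvg_ip (u : nat -> T -> R) f g : (forall n, S (u n)) -> S f -> S g ->
  seminorm (fun x => f x - u n x) @[n --> \oo] --> 0 ->
  ip (u n) g @[n --> \oo] --> ip f g.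
Proof.
move=> Su Sf Sg u0; apply/cvgrPdist_le => e e0.
have g1 : 0 < seminorm g + 1 by rewrite ltr_wpDl ?seminorm_ge0.
have /cvgr_dist_le/(_ _ (divr_gt0 e0 g1)) := u0.
apply: filterS => n; rewrite sub0r normrN ger0_norm ?seminorm_ge0// => un.
rewrite -ip_subl//; apply: le_trans (ip_le_seminorm (si_sub Sf (Su n)) Sg) _.
apply: (@le_trans _ _ (e / (seminorm g + 1) * (seminorm g + 1))).
  by rewrite ler_pM ?seminorm_ge0// lerDl.
by rewrite divfK// gt_eqF.
Qed.

End semi_inner_product.

(** * Square integrable functions and Parseval identities *)

Section square_integrable.
Context {R : realType}.
Local Notation lambda := (@lebesgue_measure R).
Implicit Types (D : set R) (u v : R -> R).

Lemma ae_lebesgueS (P Q : set R) : (forall x, P x -> Q x) ->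
  {ae lambda, forall x, P x} -> {ae lambda, forall x, Q x}.
Proof. by move=> PQ; apply: filterS; [exact: (ae_filter_ringOfSetsType lambda)|]. Qed.

Lemma ae_lebesgueS2 (P Q S : set R) : (forall x, P x -> Q x -> S x) ->
  {ae lambda, forall x, P x} -> {ae lambda, forall x, Q x} ->
  {ae lambda, forall x, S x}.
Proof.
by move=> PQS; apply: filterS2; [exact: (ae_filter_ringOfSetsType lambda)|].
Qed.

(** On [[0, L]] this unfolds to [itv_L2], and the two are used interchangeably. *)
Definition sqint D u : Prop :=
  measurable_fun D u /\ lambda.-integrable D (fun s => (u s ^+ 2)%:E).

Definition ipL2 D u v : R := \int[lambda]_(s in D) (u s * v s).

Variable D : set R.
Hypothesis mD : measurable (D : set (measurableTypeR R)).

Lemma sqint_mul u v : sqint D u -> sqint D v ->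
  lambda.-integrable D (EFin \o (fun s => u s * v s)).
Proof.
move=> [mu iu] [mv iv].
apply: (le_integrable _ _ _ (integrableD _ iu iv)) => //.
  by apply/measurable_EFinP; exact: measurable_funM.
move=> x Dx /=; rewrite lee_fin (ger0_norm (addr_ge0 (sqr_ge0 _) (sqr_ge0 _))).
by rewrite ler_norml; apply/andP; split; nra.
Qed.

Lemma sqint_le u (b : R -> \bar R) : measurable_fun D u -> lambda.-integrable D b ->
  (forall x, D x -> ((u x ^+ 2)%:E <= b x)%E) -> sqint D u.
Proof.
move=> mu ib ub; split => //; apply: (le_integrable _ _ _ ib) => //.
  by apply/measurable_EFinP; exact: measurable_funX.
move=> x Dx; rewrite abse_EFin ger0_norm ?sqr_ge0//.
by rewrite (le_trans (ub _ Dx))// lee_abs.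
Qed.

Lemma sqint_lin a u v : sqint D u -> sqint D v -> sqint D (fun s => a * u s + v s).
Proof.
move=> [mu iu] [mv iv].
apply: (@sqint_le _ (fun s => ((2 * a ^+ 2)%:E * (u s ^+ 2)%:E + 2%:E * (v s ^+ 2)%:E)%E)).
- by apply: measurable_funD => //; exact: measurable_funM.
- by apply: integrableD => //; exact: integrableZl.
- move=> x _; rewrite -!EFinM -EFinD lee_fin -subr_ge0.
  have -> : 2 * a ^+ 2 * u x ^+ 2 + 2 * v x ^+ 2 - (a * u x + v x) ^+ 2 =
    (a * u x - v x) ^+ 2 by ring.
  exact: sqr_ge0.
Qed.

Lemma semi_inner_ipL2 : semi_inner (sqint D) (ipL2 D).
Proof.
split.
- exact: sqint_lin.
- split; first exact: measurable_cst.
  by under eq_fun do rewrite expr0n/=; exact: integrable0.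
- by move=> u v; apply: eq_Rintegral => x _; rewrite mulrC.
- move=> a f g h Sf Sg Sh; rewrite /ipL2.
  under eq_Rintegral do rewrite mulrDl -mulrA.
  rewrite RintegralD//; last exact: sqint_mul.
    by rewrite RintegralZl//; exact: sqint_mul.
  have := integrableZl mD a (sqint_mul Sf Sh).
  by apply: eq_integrable => // x _ /=; rewrite EFinM.
- by move=> f; apply: Rintegral_ge0 => x _; rewrite -expr2 sqr_ge0.
Qed.

Lemma sqint_bounded u M : (lambda D < +oo)%E -> measurable_fun D u ->
  (forall x, D x -> `|u x| <= M) -> sqint D u.
Proof.
move=> Dfin mu uM; apply: (@sqint_le _ (cst (M ^+ 2)%:E)) => //.
  apply: measurable_bounded_integrable => //.
  by exists (`|M| ^+ 2); split => // x /ltW xM y _ /=; rewrite normrX.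
by move=> x Dx; rewrite lee_fin -real_normK ?num_real// lerXn2r ?nnegrE ?uM//
  (le_trans _ (uM _ Dx)).
Qed.

Lemma sqint_integrable u : (lambda D < +oo)%E -> sqint D u ->
  lambda.-integrable D (EFin \o u).
Proof.
move=> Dfin Su; have S1 : sqint D (cst 1).
  by apply: (@sqint_bounded _ 1) => // x _; rewrite normr1.
have := sqint_mul Su S1.
by apply: eq_integrable => // x _ /=; rewrite mulr1.
Qed.

Lemma ipL2_EFin u v : sqint D u -> sqint D v ->
  (ipL2 D u v)%:E = (\int[lambda]_(s in D) (u s * v s)%:E)%E.
Proof. by move=> Su Sv; rewrite fineK// integrable_fin_num// sqint_mul. Qed.

Lemma ipL2_ae u v u' v' : sqint D u -> sqint D v -> sqint D u' -> sqint D v' ->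
  {ae lambda, forall x, D x -> u x = u' x} ->
  {ae lambda, forall x, D x -> v x = v' x} -> ipL2 D u v = ipL2 D u' v'.
Proof.
move=> Su Sv Su' Sv' uu vv; apply: EFin_inj; rewrite !ipL2_EFin//.
apply: ae_eq_integral => //.
- exact: measurable_int (sqint_mul Su Sv).
- exact: measurable_int (sqint_mul Su' Sv').
- by apply: ae_lebesgueS2 uu vv => x uu vv Dx; rewrite uu// vv.
Qed.

Lemma ipL2_eq0 u : sqint D u -> ipL2 D u u = 0 ->
  {ae lambda, forall x, D x -> u x = 0}.
Proof.
move=> Su u0; have := ipL2_EFin Su Su; rewrite u0 => /esym i0.
have /(ae_eq_integral_abs lambda mD) : measurable_fun D (fun s => (u s * u s)%:E).
  exact: measurable_int (sqint_mul Su Su).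
move=> [+ _]; have -> : (\int[lambda]_(x in D) `|(u x * u x)%:E|
    = \int[lambda]_(x in D) (u x * u x)%:E)%E.
  by apply: eq_integral => x _; rewrite abse_EFin ger0_norm// -expr2 sqr_ge0.
move=> /(_ i0); apply: ae_lebesgueS => x /[swap] Dx /(_ Dx) /= [] /eqP.
by rewrite mulf_eq0 orbb => /eqP.
Qed.

(* Riesz-Fischer. *)
Lemma sqint_cvg_complete (u : nat -> R -> R) : (forall n, sqint D (u n)) ->
  (forall e, 0 < e -> exists N, forall n m, (N <= n)%N -> (N <= m)%N ->
    ipL2 D (fun x => u n x - u m x) (fun x => u n x - u m x) <= e) ->
  exists2 g, sqint D g &
    forall e, 0 < e -> exists N, forall n, (N <= n)%N ->
    ipL2 D (fun x => g x - u n x) (fun x => g x - u n x) <= e.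
Proof.
move=> Su cu; have si := semi_inner_ipL2.
(* A rate that stays summable after multiplication by 2^k: what remains is 1 / 2^(k+1), of sum 1. *)
have cu' k : exists N, forall n m, (N <= n)%N -> (N <= m)%N ->
    ipL2 D (fun x => u n x - u m x) (fun x => u n x - u m x)
      <= (2 ^ k)%:R^-1 * (1 / (2 ^ (k + 1))%:R).
  by apply: cu; rewrite mulr_gt0// ?divr_gt0 ?invr_gt0// ltr0n expn_gt0.
pose N := fix N k := if k is k'.+1 then maxn (N k') (sval (cid (cu' k)))
                     else sval (cid (cu' 0%N)).
have NS k : (N k <= N k.+1)%N by exact: leq_maxl.
have NP k n m : (N k <= n)%N -> (N k <= m)%N ->
    ipL2 D (fun x => u n x - u m x) (fun x => u n x - u m x)
      <= (2 ^ k)%:R^-1 * (1 / (2 ^ (k + 1))%:R).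
  move=> nN mN; have := svalP (cid (cu' k)); apply.
    by apply: leq_trans nN; case: k {mN} => // k; exact: leq_maxr.
  by apply: leq_trans mN; case: k {nN} => // k; exact: leq_maxr.
pose v k := u (N k).
(* The weighted squares have a finite integral in total, so their sum [h] is finite a.e. The weight
   2^k is there to deduce from this the absolute convergence of the unsquared increments. *)
pose w k x := (2 ^ k)%:R * (v k.+1 x - v k x) ^+ 2.
have w0 k x : 0 <= w k x by rewrite mulr_ge0// sqr_ge0.
have Sd k : sqint D (fun x => v k.+1 x - v k x) by exact: (si_sub si (Su (N k.+1)) (Su (N k))).
have mw k : measurable_fun D (EFin \o w k).
  apply/measurable_EFinP; apply: measurable_funM => //.
  by apply: measurable_funX; exact: (Sd k).1.
pose h x := (\sum_(k <oo) (w k x)%:E)%E.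
have mh : measurable_fun D h.
  have mh' := @ge0_emeasurable_sum _ _ _ D (fun k x => (w k x)%:E) predT.
  apply: mh' => [k x _ _|k _]; last exact: mw.
  by rewrite lee_fin.
have ih : (\int[lambda]_(x in D) h x < +oo)%E.
  rewrite integral_nneseries//; last by move=> k x _; rewrite lee_fin.
  apply: (@le_lt_trans _ _ (\sum_(k <oo) (1 / (2 ^ (k + 1))%:R)%:E)%E).
    apply: lee_nneseries => [k _ _|k _].
      by apply: integral_ge0 => x _; rewrite lee_fin.
    under eq_integral do rewrite /w EFinM.
    rewrite integralZl//; last exact: (Sd k).2.
    under eq_integral do rewrite expr2.
    rewrite -(ipL2_EFin (Sd k) (Sd k)) -EFinM lee_fin.
    by rewrite -ler_pdivlMl ?ltr0n ?expn_gt0//; apply: NP.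
  have /cvg_lim -> // := @cvg_geometric_eseries_half R 1 0.
  exact: ltry.
have hae : {ae lambda, forall x, D x -> h x \is a fin_num}.
  apply: integrable_ae => //; apply/integrableP; split => //.
  under eq_integral => x _ do (rewrite gee0_abs; last by
    apply: nneseries_ge0 => k _ _; rewrite lee_fin).
  exact: ih.
have vcvg x : h x \is a fin_num -> cvgn (fun k => v k x).
  move=> hx.
  have cw : cvgn (series (fun k => w k x)).
    apply: nondecreasing_is_cvgn; first exact: nondecreasing_series.
    exists (fine (h x)) => _ [n _ <-]; rewrite -lee_fin fineK// -sumEFin.
    by apply: nneseries_lim_ge => k _ _; rewrite lee_fin.
  have cg : cvgn (series (fun k => 1 / (2 ^ (k + 1))%:R : R)).
    by apply/cvg_ex; eexists; exact: cvg_geometric_series_half.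
  have ct : cvgn (series (telescope (fun k => v k x))).
    apply: normed_cvg; apply: (@series_le_cvg _ _
        ((fun k => w k x) \+ (fun k => 1 / (2 ^ (k + 1))%:R))) => //.
    - by move=> k; exact: normr_ge0.
    - by move=> k; rewrite /= addr_ge0.
    - move=> k /=; rewrite /telescope/= /w.
      set a : R := (2 ^ k)%:R; have a0 : 0 < a by rewrite ltr0n expn_gt0.
      have -> : (2 ^ (k + 1))%:R = 2 * a by rewrite addn1 expnS natrM.
      (* Arithmetic-geometric mean: |d| <= 2^k d^2 + 1 / (4 2^k), where both terms on the right are
         summable. *)
      have : 0 <= (a * `|v k.+1 x - v k x| - 2^-1) ^+ 2 / a.
        by rewrite divr_ge0 ?sqr_ge0// ltW.
      have -> : (a * `|v k.+1 x - v k x| - 2^-1) ^+ 2 / a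
          = a * `|v k.+1 x - v k x| ^+ 2 - `|v k.+1 x - v k x| + (4 * a)^-1.
        by field; rewrite gt_eqF.
      rewrite real_normK ?num_real// => H.
      have : (4 * a)^-1 <= 1 / (2 * a).
        by rewrite div1r lef_pV2 ?posrE ?mulr_gt0// ler_pM2r// ler_nat.
      lra.
    - by rewrite seriesD; exact: is_cvgD.
  apply/cvg_ex; exists (v 0%N x + limn (series (telescope (fun k => v k x)))).
  rewrite [X in X @ _ --> _](_ : _ =
      (fun n => v 0%N x + series (telescope (fun k => v k x)) n)); last first.
    by apply/funext => n; rewrite -eq_sum_telescope.
  by apply: cvgD => //; exact: cvg_cst.
pose E := [set x | D x /\ h x \is a fin_num].
have mE : measurable E.
  have -> : E = D `&` (fun x => h x) @^-1` [set y | y \is a fin_num] by [].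
  apply: mh => //.
  rewrite (_ : [set y | _] = range EFin); last first.
    apply/seteqP; split => [[r|//|//] _|_ [r _ <-]//]; by exists r.
  by apply: measurable_image_EFin; exact: measurableT.
(* Set to 0 off the set of convergence, the sequence converges everywhere, and its limit is
   measurable. *)
pose v' k := v k \_ E.
have mv' k : measurable_fun D (v' k).
  apply/(measurable_restrict _ mE mD).
  by apply: measurable_funS (Su (N k)).1 => // x [].
pose g x := limn (fun k => v' k x).
have v'g x : v' ^~ x @ \oo --> g x.
  rewrite /g; have [xE|xE] := boolP (x \in E).
    have -> : v' ^~ x = v ^~ x by apply/funext => k; rewrite /v' patchE xE.
    by apply: vcvg; case/set_mem : xE.
  have -> : v' ^~ x = cst 0.
    by apply/funext => k; rewrite /v' patchE (negbTE xE).
  by apply: cvgP; exact: cvg_cst.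
have mg : measurable_fun D g.
  by apply: measurable_fun_cvg mv' _ => x _; exact: v'g.
have vg : {ae lambda, forall x, D x -> v ^~ x @ \oo --> g x}.
  apply: ae_lebesgueS hae => x hx Dx; have Ex : x \in E by apply/mem_set; split; auto.
  by have := v'g x; rewrite /v' /patch Ex.
have key k n : (N k <= n)%N ->
    (\int[lambda]_(x in D) ((g x - u n x) ^+ 2)%:E <=
      ((2 ^ k)%:R^-1 * (1 / (2 ^ (k + 1))%:R) : R)%:E)%E.
  move=> nN; pose F j x := ((v j x - u n x) ^+ 2)%:E.
  have mF j : measurable_fun D (F j).
    apply/measurable_EFinP/measurable_funX.
    by apply: measurable_funB; [exact: (Su _).1|exact: (Su _).1].
  (* Fatou along the subsequence: the integrand is the limit of [F j] a.e., and the integrals of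
     [F j] obey the Cauchy bound. *)
  apply: (@le_trans _ _ (\int[lambda]_(x in D) limn_einf (F ^~ x))%E).
    apply: ae_ge0_le_integral => //.
    - by move=> x _; rewrite lee_fin sqr_ge0.
    - by apply/measurable_EFinP/measurable_funX; apply: measurable_funB => //; exact: (Su _).1.
    - move=> x _; rewrite limn_einf_lim.
      apply: lime_ge; first exact: is_cvg_einfs.
      apply: nearW => j; apply: le_ereal_inf_tmp => _ [m _ <-].
      by rewrite lee_fin sqr_ge0.
    - rewrite /limn_einf; apply: measurableT_comp => //.
      by apply: measurable_fun_limn_esup => j; apply: measurableT_comp => //; exact: mF.
    - apply: ae_lebesgueS vg => x vx Dx.
      suff /cvg_limn_einf_sup[-> _] : F ^~ x @ \oo --> ((g x - u n x) ^+ 2)%:E by [].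
      apply: cvg_EFin; first exact: nearW.
      have vux : v j x - u n x @[j --> \oo] --> g x - u n x.
        by apply: cvgB; [exact: vx|exact: cvg_cst].
      rewrite expr2; exact: (cvgM vux vux).
  apply: le_trans (fatou lambda mD mF _) _.
    by move=> j x _; rewrite lee_fin sqr_ge0.
  rewrite limn_einf_lim; apply: lime_le; first exact: is_cvg_einfs.
  near=> j; apply: (@le_trans _ _ (\int[lambda]_(x in D) F (maxn k j) x)%E).
    by apply: ereal_inf_lbound; exists (maxn k j) => //=; exact: leq_maxr.
  rewrite /F; under eq_integral do rewrite expr2.
  rewrite -(ipL2_EFin (si_sub si (Su _) (Su _)) (si_sub si (Su _) (Su _))) lee_fin.
  apply: NP => //.
  have : (k <= maxn k j)%N by exact: leq_maxl.
  elim: (maxn k j) => [|m IH]; first by rewrite leqn0 => /eqP ->.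
  by rewrite leq_eqVlt => /predU1P[->//|/IH] /leq_trans; apply.
have Sgu : sqint D (fun x => g x - u (N 0%N) x).
  split; first by apply: measurable_funB => //; exact: (Su _).1.
  apply/integrableP; split.
    by apply/measurable_EFinP/measurable_funX; apply: measurable_funB => //; exact: (Su _).1.
  apply: le_lt_trans (ltry ((2 ^ 0)%:R^-1 * (1 / (2 ^ (0 + 1))%:R) : R)).
  apply: le_trans (key 0%N _ (leqnn _)).
  by under eq_integral do rewrite abse_EFin (ger0_norm (sqr_ge0 _)).
have Sg : sqint D g.
  have := si_add si Sgu (Su (N 0%N)).
  by congr sqint; apply/funext => x; rewrite subrK.
exists g => // e e0.
have [k ke] : exists k, (2 ^ k)%:R^-1 * (1 / (2 ^ (k + 1))%:R) <= e :> R.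
  have : (geometric 1 2^-1) n @[n --> \oo] --> (0 : R).
    by apply: cvg_geometric; rewrite gtr0_norm ?invr_gt0// invf_lt1// ltr1n.
  move=> /cvgr0Pnorm_le/(_ _ e0)[k _ /(_ _ (leqnn k))] /=.
  rewrite mul1r ger0_norm ?exprn_ge0// => ke; exists k; apply: le_trans ke.
  rewrite exprVn -natrX ler_piMr ?invr_ge0// div1r invf_le1 ?ltr0n ?expn_gt0//.
  by rewrite ler1n expn_gt0.
exists (N k) => n nN; apply: le_trans ke; rewrite -lee_fin.
have Sgn := si_sub si Sg (Su n).
rewrite ipL2_EFin//; apply: le_trans (key k n nN).
by under eq_integral do rewrite -expr2.
Unshelve. all: by end_near. Qed.

End square_integrable.

(** * Partial sums of an orthogonal family *)

Section orthogonal_family.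
Context {R : realType} {T : Type}.
Variables (S : (T -> R) -> Prop) (ip : (T -> R) -> (T -> R) -> R).
Hypothesis si : semi_inner S ip.
Variables (K : finType) (phi : nat -> K -> T -> R).
Hypothesis Sphi : forall m k, S (phi m k).

Definition partial_sum (c : nat -> K -> R) (N : nat) : T -> R :=
  fun x => \sum_(a : 'I_N * K) c a.1 a.2 * phi a.1 a.2 x.

Definition coef f m k := ip f (phi m k).

Lemma sum_pairE N (F : nat -> K -> R) :
  \sum_(a : 'I_N * K) F a.1 a.2 = series (fun m => \sum_k F m k) N.
Proof.
rewrite seriesEord /= (pair_bigA _ (fun (m : 'I_N) k => F m k)) /=.
by [].
Qed.

Lemma S_partial_sum c N : S (partial_sum c N).
Proof. by apply: (si_sum si) => a; exact: Sphi. Qed.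

Lemma ip_partial_sum c N g : S g ->
  ip (partial_sum c N) g = series (fun m => \sum_k c m k * coef g m k) N.
Proof.
move=> Sg; rewrite -(sum_pairE N (fun m k => c m k * coef g m k)).
rewrite /partial_sum (@ip_suml _ _ _ _ si _ _ (fun a : 'I_N * K => c a.1 a.2)
  (fun a => phi a.1 a.2))//.
by apply: eq_bigr => a _; rewrite /coef (si_sym si).
Qed.

Hypothesis orth : forall m k m' k', (m, k) != (m', k') -> ip (phi m k) (phi m' k') = 0.
(** Norm 1, or pairing to 0 with everything. The second case admits the null functions sin (0 x), so
    that sines can be indexed from 0 like cosines. *)
Hypothesis unit_or_null : forall f m k, S f ->
  ip f (phi m k) * ip (phi m k) (phi m k) = ip f (phi m k).

Lemma coef_partial_sum f N m k : S f ->
  coef (partial_sum (coef f) N) m k = if (m < N)%N then coef f m k else 0.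
Proof.
move=> Sf; rewrite {1}/coef ip_partial_sum// -sum_pairE.
have [mN|Nm] := ltnP m N.
  rewrite (bigD1 (Ordinal mN, k))//= {2}/coef unit_or_null//.
  rewrite [X in _ + X]big1 ?addr0// => -[a k'] neq.
  rewrite /coef /= orth ?mulr0//; apply: contra neq => /eqP[am ->].
  by apply/eqP; congr pair; exact/val_inj.
apply: big1 => -[a k'] _ /=; rewrite /coef (si_sym si (phi m k)) orth ?mulr0//.
by apply/eqP => -[am _]; move: (ltn_ord a); rewrite am ltnNge Nm.
Qed.

Lemma ip_partial_sum_partial_sum f N M : S f -> (N <= M)%N ->
  ip (partial_sum (coef f) N) (partial_sum (coef f) M) =
  series (fun m => \sum_k coef f m k ^+ 2) N.
Proof.
move=> Sf NM; rewrite ip_partial_sum; last exact: S_partial_sum.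
rewrite -!sum_pairE; apply: eq_bigr => a _.
by rewrite coef_partial_sum// (leq_trans (ltn_ord _) NM) expr2.
Qed.

Lemma ip_partial_sum_self f N : S f ->
  ip (partial_sum (coef f) N) f = series (fun m => \sum_k coef f m k ^+ 2) N.
Proof. by move=> Sf; rewrite ip_partial_sum//; under eq_fun do under eq_bigr do rewrite -expr2. Qed.

Lemma bessel f N : S f ->
  ip (fun x => f x - partial_sum (coef f) N x) (fun x => f x - partial_sum (coef f) N x) =
  ip f f - series (fun m => \sum_k coef f m k ^+ 2) N.
Proof.
move=> Sf; rewrite (ip_subsub si Sf (S_partial_sum _ _)).
rewrite (si_sym si f) ip_partial_sum_self// ip_partial_sum_partial_sum//; ring.
Qed.

Lemma bessel_diff f N M : S f -> (N <= M)%N ->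
  ip (fun x => partial_sum (coef f) M x - partial_sum (coef f) N x)
     (fun x => partial_sum (coef f) M x - partial_sum (coef f) N x) =
  series (fun m => \sum_k coef f m k ^+ 2) M - series (fun m => \sum_k coef f m k ^+ 2) N.
Proof.
move=> Sf NM; rewrite (ip_subsub si (S_partial_sum _ _) (S_partial_sum _ _)).
rewrite (si_sym si (partial_sum _ M) (partial_sum _ N)).
by rewrite !ip_partial_sum_partial_sum//; ring.
Qed.

Lemma bessel_cvg f : S f -> cvgn (series (fun m => \sum_k coef f m k ^+ 2)).
Proof.
move=> Sf; apply: nondecreasing_is_cvgn.
  by apply: nondecreasing_series => m _ _; apply: sumr_ge0 => k _; exact: sqr_ge0.
exists (ip f f) => _ [N _ <-]; rewrite -subr_ge0 -bessel//.
exact: (si_ge0 si).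
Qed.

End orthogonal_family.

Section parseval.
Context {R : realType}.
Local Notation lambda := (@lebesgue_measure R).
Variable D : set R.
Hypothesis mD : measurable (D : set (measurableTypeR R)).
Variables (K : finType) (phi : nat -> K -> R -> R).
Hypothesis Sphi : forall m k, sqint D (phi m k).
Hypothesis orth : forall m k m' k', (m, k) != (m', k') ->
  ipL2 D (phi m k) (phi m' k') = 0.
Hypothesis unit_or_null : forall f m k, sqint D f ->
  ipL2 D f (phi m k) * ipL2 D (phi m k) (phi m k) = ipL2 D f (phi m k).
Hypothesis complete : forall f, sqint D f -> (forall m k, ipL2 D f (phi m k) = 0) ->
  {ae lambda, forall x, D x -> f x = 0}.

(** By Bessel's identity the partial sums form a Cauchy sequence. Their limit has the same
    coefficients as [f], so it equals [f] a.e. by completeness of the family, and the Bessel defect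
    tends to 0. *)
Lemma parseval f : sqint D f ->
  series (fun m => \sum_k ipL2 D f (phi m k) ^+ 2) @ \oo --> ipL2 D f f.
Proof.
move=> Sf; have si := semi_inner_ipL2 mD.
set s := series _; have cs : cvgn s by exact: (bessel_cvg si).
pose P := partial_sum phi (coef (ipL2 D) phi f).
have SP N : sqint D (P N) by exact: (S_partial_sum si).
have [g Sg gP] : exists2 g, sqint D g & forall e, 0 < e ->
    exists N, forall n, (N <= n)%N ->
    ipL2 D (fun x => g x - P n x) (fun x => g x - P n x) <= e.
  apply: sqint_cvg_complete => // e e0.
  have /cauchy_cvgP/cauchy_seriesP/(_ _ e0)[[A B] /= [[N1 _ HA] [N2 _ HB]] H] := cs.
  pose N := maxn N1 N2; exists N.
  have key n m : (N <= n)%N -> (n <= m)%N ->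
      ipL2 D (fun x => P m x - P n x) (fun x => P m x - P n x) <= e.
    move=> Nn nm; rewrite (bessel_diff si)// -/s.
    apply: ltW; apply: le_lt_trans (ler_norm _) _.
    rewrite /s sub_series_geq//; apply: (H (n, m)); split => /=.
      by apply: HA; rewrite /= (leq_trans _ Nn)// leq_maxl.
    by apply: HB; rewrite /= (leq_trans _ nm)// (leq_trans _ Nn)// leq_maxr.
  move=> n m Nn Nm; case/orP: (leq_total n m) => nm; last exact: key.
  apply: le_trans (key _ _ Nn nm).
  rewrite le_eqVlt; apply/orP; left; apply/eqP.
  by apply: eq_Rintegral => x _; rewrite -[LHS]mulrNN !opprB.
have gP0 : seminorm (ipL2 D) (fun x => g x - P n x) @[n --> \oo] --> 0.
  apply/cvgr0Pnorm_le => e e0; have [N HN] := gP _ (exprn_gt0 2 e0).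
  exists N => // n /= /HN; rewrite ger0_norm ?seminorm_ge0// => H.
  by apply: (seminorm_le si) => //; exact: ltW.
have gf : {ae lambda, forall x, D x -> f x - g x = 0}.
  apply: complete; first exact: (si_sub si).
  move=> m k; rewrite (ip_subl si)//; apply/eqP; rewrite subr_eq0; apply/eqP.
  have c1 := cvg_ip si SP Sg (Sphi m k) gP0.
  apply/esym/(cvg_unique _ c1) => //.
  apply/cvgrPdist_le => e e0; exists m.+1 => // n /= mn.
  rewrite (_ : ipL2 D (P n) (phi m k) = ipL2 D f (phi m k)) ?subrr ?normr0 ?ltW//.
  have := coef_partial_sum si Sphi orth unit_or_null n m k Sf.
  by rewrite mn.
have ipE n : ipL2 D f f - s n = ipL2 D (fun x => g x - P n x) (fun x => g x - P n x).
  rewrite -(bessel si Sphi orth unit_or_null n Sf).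
  have gf' : {ae lambda, forall x, D x -> f x - P n x = g x - P n x}.
    by apply: ae_lebesgueS gf => x H Dx; move/eqP: (H Dx); rewrite subr_eq0 => /eqP ->.
  by apply: ipL2_ae => //; exact: (si_sub si).
apply/cvgrPdist_le => e e0; have [N HN] := gP _ e0.
exists N => // n /= /HN; rewrite -ipE => H.
by rewrite ger0_norm// ipE; exact: (si_ge0 si).
Qed.

End parseval.

(** * Lebesgue integrals over segments *)

Section interval_integrals.
Context {R : realType}.
Local Notation lambda := (@lebesgue_measure R).
Implicit Types (a b : R) (f g u v : R -> R).

Lemma integrable_measurable (D : set R) f :
  lambda.-integrable D (EFin \o f) -> measurable_fun D f.
Proof. by move=> /measurable_int /measurable_EFinP. Qed.

Lemma integrable_patch (D : set R) f : measurable (D : set (measurableTypeR R)) ->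
  lambda.-integrable D (EFin \o f) -> lambda.-integrable setT (EFin \o (f \_ D)).
Proof. by move=> mD; rewrite integrable_mkcond//= (restrict_EFin f). Qed.

Lemma Rintegral_dominated_cvg (D : set R) (f_ : nat -> R -> R) f g :
  measurable (D : set (measurableTypeR R)) ->
  (forall n, measurable_fun D (f_ n)) -> measurable_fun D f ->
  {ae lambda, forall x, D x -> f_ ^~ x @ \oo --> f x} ->
  lambda.-integrable D (EFin \o g) ->
  (forall n x, D x -> `|f_ n x| <= g x) ->
  \int[lambda]_(x in D) f_ n x @[n --> \oo] --> \int[lambda]_(x in D) f x.
Proof.
move=> mD mf_ mf ff ig fg.
have mf_' n : measurable_fun D (EFin \o f_ n) by exact/measurable_EFinP.
have mf' : measurable_fun D (EFin \o f) by exact/measurable_EFinP.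
have ff' : {ae lambda, forall x, D x -> (EFin \o f_ n) x @[n --> \oo] --> (EFin \o f) x}.
  apply: ae_lebesgueS ff => x H Dx; apply: cvg_EFin; first exact: nearW.
  exact: H.
have fg' : {ae lambda, forall x n, D x -> (`|(EFin \o f_ n) x| <= (EFin \o g) x)%E}.
  by apply: aeW => x n Dx; rewrite /= lee_fin fg.
have [i1 _ i2] := dominated_convergence mD mf_' mf' ff' ig fg'.
apply: fine_cvg; rewrite fineK//; exact: integrable_fin_num.
Qed.

Lemma segment_measurable a b : measurable (`[a, b]%classic : set (measurableTypeR R)).
Proof. exact: measurable_itv. Qed.

Lemma segment_finite a b : (lambda `[a, b]%classic < +oo)%E.
Proof. by rewrite /= lebesgue_measure_itv/=; case: ifP => // _; rewrite -EFinD ltry. Qed.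

Lemma integrable_subsegment a b c d f : a <= c -> d <= b ->
  lambda.-integrable `[a, b] (EFin \o f) -> lambda.-integrable `[c, d] (EFin \o f).
Proof.
move=> ac db; apply: integrableS => //; apply: subset_itv => //; rewrite bnd_simp//.
Qed.

Lemma Rintegral_split a b c f : a <= b -> b <= c ->
  lambda.-integrable `[a, c] (EFin \o f) ->
  \int[lambda]_(x in `[a, c]) f x =
  \int[lambda]_(x in `[a, b]) f x + \int[lambda]_(x in `[b, c]) f x.
Proof.
move=> ab bc fi; have := @Rintegral_itvB R f (BLeft a) (BRight c) b fi.
rewrite !bnd_simp => /(_ ab bc) H.
rewrite -(Rintegral_itv_obnd_cbnd (r := b) (b := BRight c)); last first.
  by apply: integrableS fi => //; apply: subset_itv; rewrite bnd_simp.
by rewrite -H addrC subrK.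
Qed.

Lemma Rintegral_point a f : \int[lambda]_(x in `[a, a]) f x = 0.
Proof. by rewrite set_itv1 Rintegral_set1. Qed.

(** Lebesgue's differentiation theorem, applied to the extension of [f] by 0: its primitive from -oo
    is identically 0. *)
Lemma ae_zero_of_primitive a b f : lambda.-integrable `[a, b] (EFin \o f) ->
  (forall s, a <= s <= b -> \int[lambda]_(x in `[a, s]) f x = 0) ->
  {ae lambda, forall x, `[a, b]%classic x -> f x = 0}.
Proof.
move=> fi f0; pose h := f \_ `[a, b].
have hi : lambda.-integrable setT (EFin \o h).
  by exact: integrable_patch.
have hloc := integrable_locally (segment_measurable a b) fi.
have H0 y : \int[lambda]_(x in `]-oo, y]) h x = 0.
  rewrite /h -Rintegral_mkcondr.
  have [ya|ay] := ltP y a.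
    rewrite (_ : _ `&` _ = set0) ?Rintegral_set0//.
    apply/seteqP; split => // x /= [] ; rewrite !in_itv/= => xy /andP[ax _].
    by have := le_lt_trans (le_trans ax xy) ya; rewrite ltxx.
  have [yb|byy] := leP y b.
    rewrite (_ : _ `&` _ = `[a, y]%classic) ?f0 ?ay//.
    apply/seteqP; split => x /=; rewrite !in_itv/=.
      by move=> [-> /andP[->]].
    by move=> /andP[-> xy]; rewrite xy (le_trans xy yb).
  rewrite setIidr; last first.
    by move=> x /=; rewrite !in_itv/= => /andP[_ /le_trans]; apply; exact: ltW.
  have [ab|ba] := leP a b; first by rewrite f0// ab lexx.
  by rewrite set_itv_ge ?Rintegral_set0// bnd_simp -ltNge.
have hy y : lambda.-integrable `]-oo, y] (EFin \o h) by exact: integrableS hi.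
have := FTC1Ny hy hloc; apply: ae_lebesgueS => x [_ +] xab; rewrite derive1E.
under eq_fun do rewrite H0.
rewrite derive_cst /h patchE mem_set//.
Qed.

Lemma set_le_pair_measurable :
  measurable [set z : measurableTypeR R * measurableTypeR R | z.2 <= z.1].
Proof.
rewrite -[X in measurable X]setTI.
exact: (measurable_fun_le measurableT (@measurable_snd _ _ _ _) (@measurable_fst _ _ _ _)).
Qed.

(* Fubini on a triangle, the source of integration by parts. *)
Lemma Rintegral_triangle a b f g :
  lambda.-integrable `[a, b] (EFin \o f) -> lambda.-integrable `[a, b] (EFin \o g) ->
  \int[lambda]_(x in `[a, b]) (f x * \int[lambda]_(y in `[a, x]) g y) =
  \int[lambda]_(y in `[a, b]) (g y * \int[lambda]_(x in `[y, b]) f x).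
Proof.
move=> fi gi; pose F := f \_ `[a, b]; pose G := g \_ `[a, b].
pose E := [set z : measurableTypeR R * measurableTypeR R | z.2 <= z.1].
pose h (z : measurableTypeR R * measurableTypeR R) : \bar R :=
  (F z.1 * G z.2 * \1_E z)%:E.
have E1 x : `[a, b]%classic x ->
    (\int[lambda]_y h (x, y) = (f x * \int[lambda]_(y in `[a, x]) g y)%:E)%E.
  move=> xab; have gx : lambda.-integrable `[a, x] (EFin \o g).
    by apply: integrable_subsegment gi => //; move: xab; rewrite /= in_itv/= => /andP[].
  transitivity (\int[lambda]_(y in `[a, x]) ((f x)%:E * (g y)%:E))%E; last first.
    by rewrite integralZl// EFinM fineK//; exact: integrable_fin_num.
  rewrite [RHS]integral_mkcond; apply: eq_integral => y _.
  rewrite /h /= patchE indicE /F patchE mem_set// /G patchE.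
  move: xab; rewrite /= in_itv/= => /andP[ax xb].
  have -> : (y \in `[a, x]%classic) = (y \in `[a, b]%classic) && ((x, y) \in E).
    apply/idP/andP; rewrite !inE /E /= !in_itv/=.
      by move=> /andP[-> yx]; rewrite (le_trans yx xb).
    by move=> [/andP[-> _] ->].
  by case: (y \in _) => /=; case: (_ \in E); rewrite /= ?mulr0 ?mulr1 ?mul0r// EFinM.
have E2 y : `[a, b]%classic y ->
    (\int[lambda]_x h (x, y) = (g y * \int[lambda]_(x in `[y, b]) f x)%:E)%E.
  move=> yab; have fy : lambda.-integrable `[y, b] (EFin \o f).
    by apply: integrable_subsegment fi => //; move: yab; rewrite /= in_itv/= => /andP[].
  transitivity (\int[lambda]_(x in `[y, b]) ((g y)%:E * (f x)%:E))%E; last first.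
    by rewrite integralZl// EFinM fineK//; exact: integrable_fin_num.
  rewrite [RHS]integral_mkcond; apply: eq_integral => x _.
  rewrite /h /= patchE indicE /G patchE mem_set// /F patchE.
  move: yab; rewrite /= in_itv/= => /andP[ay yb].
  have -> : (x \in `[y, b]%classic) = (x \in `[a, b]%classic) && ((x, y) \in E).
    apply/idP/andP; rewrite !inE /E /= !in_itv/=.
      by move=> /andP[yx ->]; rewrite yx (le_trans ay yx).
    by move=> [/andP[_ ->] ->].
  by case: (x \in _) => /=; case: (_ \in E); rewrite /= ?mulr0 ?mulr1 ?mul0r// -EFinM mulrC.
have iF : lambda.-integrable setT (EFin \o F).
  by exact: integrable_patch.
have iG : lambda.-integrable setT (EFin \o G).
  by exact: integrable_patch.
have mh : measurable_fun setT h.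
  apply/measurable_EFinP; apply: measurable_funM; last first.
    by apply: measurable_indic; exact: set_le_pair_measurable.
  apply: measurable_funM.
    apply: (@measurableT_comp _ _ _ _ _ _ F) => //.
    exact: integrable_measurable iF.
  apply: (@measurableT_comp _ _ _ _ _ _ G) => //.
  exact: integrable_measurable iG.
have ih : (lambda \x lambda)%E.-integrable setT h.
  (* Tonelli: dropping the indicator, the iterated integral of |h| is at most the product of the
     integrals of |F| and |G|. *)
  apply/integrable12ltyP => //.
  have /integrableP[_ iF'] := iF; have /integrableP[mG iG'] := iG.
  apply: (@le_lt_trans _ _ (\int[lambda]_x (`|F x|%:E * \int[lambda]_y `|G y|%:E))%E).
    apply: ge0_le_integral => //.
    - by move=> x _; exact: integral_ge0.
    - apply: (measurable_fun_fubini_tonelli_F (abse \o h)) => //=.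
      exact: measurableT_comp.
    - apply: emeasurable_funM => //; apply/measurable_EFinP/measurableT_comp => //.
      exact: integrable_measurable iF.
    - move=> x _; rewrite -ge0_integralZl//.
      + apply: ge0_le_integral => //.
        * apply: measurableT_comp => //; exact: measurableT_comp.
        * apply: emeasurable_funM => //; apply/measurable_EFinP/measurableT_comp => //.
          exact: integrable_measurable iG.
        * move=> y _; rewrite /h abse_EFin -EFinM lee_fin !normrM.
          rewrite ler_piMr// indicE; case: (_ \in _); rewrite ?normr1 ?normr0//.
      + apply/measurable_EFinP/measurableT_comp => //.
        exact: integrable_measurable iG.
  rewrite ge0_integralZr//; first by rewrite lte_mul_pinfty// ?integral_ge0// ge0_fin_numE// integral_ge0.
  - apply/measurable_EFinP/measurableT_comp => //.
    exact: integrable_measurable iF.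
  - by apply: integral_ge0.
have fub := Fubini ih.
clear mh ih iF iG.
rewrite /Rintegral; congr fine.
transitivity (\int[lambda]_x \int[lambda]_y h (x, y))%E.
  rewrite integral_mkcond; apply: eq_integral => x _; rewrite patchE.
  case: ifPn => [/set_mem xab|xab]; first by rewrite E1.
  by rewrite integral0_eq// => y _; rewrite /h /F /= patchE (negbTE xab) !mul0r.
rewrite fub [RHS]integral_mkcond; apply: eq_integral => y _; rewrite patchE.
case: ifPn => [/set_mem yab|yab]; first by rewrite E2.
by rewrite integral0_eq// => x _; rewrite /h /G /= patchE (negbTE yab) mulr0 mul0r.
Qed.

End interval_integrals.

(** * Polynomial approximation of an indicator function *)

Section power_indicator.
Context {R : realType}.
Implicit Types (x y : R).

Lemma bernoulli_ineq x n : -1 <= x -> 1 + n%:R * x <= (1 + x) ^+ n.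
Proof.
move=> x1; elim: n => [|n IH]; first by rewrite mul0r addr0 expr0.
rewrite exprS; apply: le_trans (_ : (1 + x) * (1 + n%:R * x) <= _); last first.
  by rewrite ler_wpM2l// -lerBlDl sub0r.
have n0 : 0 <= n%:R :> R by [].
rewrite -natr1; have := sqr_ge0 x; nra.
Qed.

(* Brosowski and Deutsch: these polynomials converge on [0, 1], off the point
   1/2, to the indicator function of [0, 1/2[. *)
Definition half_indicator n x : R := (1 - x ^+ n) ^+ (2 ^ n).

Lemma half_indicator_bound n x : 0 <= x <= 1 -> 0 <= half_indicator n x <= 1.
Proof.
move=> /andP[x0 x1]; have xn1 : x ^+ n <= 1 by rewrite exprn_ile1.
by rewrite exprn_ge0 ?subr_ge0// exprn_ile1 ?subr_ge0// lerBlDr lerDl exprn_ge0.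
Qed.

(** Bernoulli's inequality bounds the power from below by 1 - (2x)^n. *)
Lemma half_indicator_cvg1 x : 0 <= x < 2^-1 -> half_indicator n x @[n --> \oo] --> (1 : R).
Proof.
move=> /andP[x0 x2]; have x1 : x <= 1 by rewrite (le_trans (ltW x2))// invf_le1// ler1n.
have x21 : `|2 * x| < 1.
  by rewrite ger0_norm ?mulr_ge0// -(@ltr_pM2l _ 2^-1) ?invr_gt0// mulKf// mulr1.
have c0 := cvg_geometric 1 x21.
have c1 : 1 - geometric 1 (2 * x) n @[n --> \oo] --> (1 - 0 : R).
  by apply: cvgB => //; exact: cvg_cst.
rewrite subr0 in c1.
apply: (@squeeze_cvgr _ _ _ _ (fun n => 1 - geometric 1 (2 * x) n) (cst 1)) => //;
  last exact: cvg_cst.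
apply: nearW => n; have /andP[_ ->] := half_indicator_bound n (introT andP (conj x0 x1)).
rewrite andbT; apply: le_trans (@bernoulli_ineq (- x ^+ n) (2 ^ n) _).
  by rewrite /= mul1r exprMn mulrN natrX.
by rewrite lerN2 exprn_ile1.
Qed.

(** Multiplied by (1 + x^n)^(2^n), the polynomial becomes (1 - x^(2n))^(2^n) <= 1, while the
    multiplier is at least (2x)^n by Bernoulli. Hence the bound (2x)^(-n). *)
Lemma half_indicator_cvg0 x : 2^-1 < x <= 1 -> half_indicator n x @[n --> \oo] --> (0 : R).
Proof.
move=> /andP[x2 x1]; have x0 : 0 < x by rewrite (lt_trans _ x2)// invr_gt0.
have x21 : 1 < 2 * x by rewrite -(@ltr_pM2l _ 2^-1) ?invr_gt0// mulKf// mulr1.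
have x21' : `|(2 * x)^-1| < 1.
  by rewrite ger0_norm ?invr_ge0 ?mulr_ge0 ?ltW// invf_lt1// (lt_trans _ x21).
have c0 := cvg_geometric 1 x21'.
apply: (@squeeze_cvgr _ _ _ _ (cst 0) (geometric 1 (2 * x)^-1)) => //;
  last exact: cvg_cst.
apply: nearW => n; have /andP[-> _] := @half_indicator_bound n x (introT andP (conj (ltW x0) x1)).
rewrite /= mul1r exprVn exprMn -natrX.
have z0 : 0 < x ^+ n by rewrite exprn_gt0.
have N0 : 0 < (2 ^ n)%:R :> R by rewrite ltr0n expn_gt0.
rewrite -[X in X <= _]mul1r -[X in _ <= X]div1r ler_pdivlMr ?mulr_gt0// mul1r.
apply: (@le_trans _ _ (half_indicator n x * (1 + x ^+ n) ^+ (2 ^ n))).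
  rewrite ler_wpM2l//.
    by have /andP[] := @half_indicator_bound n x (introT andP (conj (ltW x0) x1)).
  apply: le_trans (@bernoulli_ineq (x ^+ n) (2 ^ n) _); first by rewrite lerDr.
  by rewrite (le_trans _ (ltW z0))// lerN10.
rewrite /half_indicator -exprMn -subr_sqr expr1n exprn_ile1//.
  by rewrite subr_ge0 -exprM exprn_ile1// ltW.
by rewrite lerBlDr lerDl sqr_ge0.
Qed.

End power_indicator.

(** * Functions orthogonal to all powers of a bounded function *)

Section moments.
Context {R : realType}.
Local Notation lambda := (@lebesgue_measure R).
Variables (D : set R) (f c : R -> R).
Hypothesis mD : measurable (D : set (measurableTypeR R)).
Hypothesis fi : lambda.-integrable D (EFin \o f).
Hypothesis mc : measurable_fun D c.
Hypothesis c1 : forall x, `|c x| <= 1.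
Hypothesis fc : forall n, \int[lambda]_(x in D) (f x * c x ^+ n) = 0.

Lemma integrable_mul_bounded (u : R -> R) (M : R) : measurable_fun D u ->
  (forall x, D x -> `|u x| <= M) -> lambda.-integrable D (EFin \o (fun x => f x * u x)).
Proof.
move=> mu uM; have := integrableZl mD M (integrable_norm fi).
apply: le_integrable => //.
  apply/measurable_EFinP; apply: measurable_funM => //.
  exact: integrable_measurable fi.
move=> x Dx /=; rewrite lee_fin normrM mulrC.
have M0 : 0 <= M by exact: le_trans (normr_ge0 _) (uM _ Dx).
rewrite [leRHS]ger0_norm ?mulr_ge0//.
by rewrite ler_wpM2r// uM.
Qed.

Lemma integral_horner (p : {poly R}) : \int[lambda]_(x in D) (f x * p.[c x]) = 0.
Proof.
pose g (i : 'I_(size p)) x : R := p`_i * (f x * c x ^+ i).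
have ig i : lambda.-integrable D (EFin \o g i).
  have := integrableZl mD p`_i (@integrable_mul_bounded (fun x => c x ^+ i) 1 _ _).
  apply; first exact: measurable_funX.
  by move=> x _; rewrite normrX exprn_ile1.
have -> : \int[lambda]_(x in D) (f x * p.[c x]) =
    \int[lambda]_(x in D) (\sum_(i <- index_enum 'I_(size p)) g i x).
  apply: eq_Rintegral => x _; rewrite horner_coef big_distrr; apply: eq_bigr => i _.
  by rewrite /g /= mulrCA.
have : lambda.-integrable D (EFin \o (fun x => \sum_(i <- index_enum 'I_(size p)) g i x)) /\
  \int[lambda]_(x in D) (\sum_(i <- index_enum 'I_(size p)) g i x) = 0.
  elim: (index_enum _) => [|i s [IH1 IH2]].
    split; last by under eq_Rintegral do rewrite big_nil; rewrite Rintegral_cst// mul0r.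
    rewrite (_ : _ \o _ = cst 0%E); first exact: integrable0.
    by apply/funext => x /=; rewrite big_nil.
  split.
    rewrite (_ : _ \o _ = ((EFin \o g i) \+ (EFin \o (fun x => (\sum_(j <- s) g j x)%R)))%E).
      exact: integrableD.
    by apply/funext => x /=; rewrite big_cons.
  under eq_Rintegral do rewrite big_cons.
  rewrite RintegralD// IH2 addr0 /g RintegralZl// ?fc ?mulr0//.
  apply: (@integrable_mul_bounded (fun x => c x ^+ i) 1).
    exact: measurable_funX.
  by move=> x _; rewrite normrX exprn_ile1.
by case.
Qed.

(* [tau < c x] is the limit of polynomials in [c x]. *)
Lemma integral_superlevel tau : `|tau| <= 1 ->
  {ae lambda, forall x, D x -> c x != tau} ->
  \int[lambda]_(x in D) (f x * (tau < c x)%R%:R) = 0.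
Proof.
(* As |c - tau| <= 2, this affine rescaling takes values in [0, 1]; it sends the level [tau] to the
   threshold 1/2 and reverses the order. *)
move=> tau1 ctau; pose y x : R := 2^-1 - (c x - tau) / 4.
have y01 x : 0 <= y x <= 1.
  rewrite /y; have := c1 x; move: tau1; rewrite !ler_norml => /andP[? ?] /andP[? ?].
  by apply/andP; split; lra.
have my : measurable_fun D y.
  apply: measurable_funB => //; apply: measurable_funM => //.
  exact: measurable_funB.
have mlt : measurable_fun D (fun x => (tau < c x)%R%:R : R).
  apply: (@measurableT_comp _ _ _ _ _ _ (fun b : bool => b%:R : R)) => //.
  exact: measurable_fun_ltr.
have lim := @Rintegral_dominated_cvg R D (fun n x => f x * half_indicator n (y x))
  (fun x => f x * (tau < c x)%R%:R) (fun x => `|f x|) mD.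
apply: (@cvg_unique _ _ (\int[lambda]_(x in D) (f x * half_indicator n (y x)) @[n --> \oo])) => //.
  apply: lim.
  - move=> n; apply: measurable_funM; first exact: integrable_measurable fi.
    by apply: measurable_funX; apply: measurable_funB => //; exact: measurable_funX.
  - by apply: measurable_funM => //; exact: integrable_measurable fi.
  - apply: ae_lebesgueS ctau => x H Dx; apply: cvgM; first exact: cvg_cst.
    have := H Dx; rewrite neq_lt => /orP[cx|cx].
      rewrite ltNge (ltW cx)/=; apply: half_indicator_cvg0.
      by have /andP[_ ->] := y01 x; rewrite andbT /y; lra.
    by rewrite cx; apply: half_indicator_cvg1; have /andP[-> _] := y01 x; rewrite /y/=; lra.
  - exact: integrable_norm fi.
  - move=> n x Dx; rewrite normrM ler_piMr//.
    by have /andP[? ?] := half_indicator_bound n (y01 x); rewrite ger0_norm.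
rewrite (_ : (fun n => _) = cst 0); first exact: cvg_cst.
apply/funext => n /=.
pose p0 : {poly R} := (2^-1 + tau / 4)%:P - (4^-1)%:P * 'X.
rewrite -(integral_horner ((1 - p0 ^+ n) ^+ (2 ^ n))).
apply: eq_Rintegral => x _; congr (_ * _).
rewrite /half_indicator /p0 /y !(hornerE, horner_exp); congr ((1 - _ ^+ _) ^+ _).
by field.
Qed.

End moments.

(** * Absolutely continuous functions on a segment *)

Section segments.
Context {R : realType}.
Local Notation lambda := (@lebesgue_measure R).
Implicit Types (a b c L : R) (f g u v : R -> R).

Lemma segment_glue a b c : a <= b -> b <= c ->
  `[a, c]%classic = `[a, b]%classic `|` `]b, c]%classic :> set R.
Proof. by move=> ab bc; rewrite -itv_bndbnd_setU// bnd_simp. Qed.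

Lemma measurable_segment_glue a b c f : a <= b -> b <= c ->
  measurable_fun `[a, b] f -> measurable_fun `[b, c] f -> measurable_fun `[a, c] f.
Proof.
move=> ab bc m1 m2; rewrite (segment_glue ab bc); apply/measurable_funU => //.
by split => //; apply/measurable_fun_itv_obnd_cbndP.
Qed.

Lemma integrable_segment_glue a b c f : a <= b -> b <= c ->
  lambda.-integrable `[a, b] (EFin \o f) -> lambda.-integrable `[b, c] (EFin \o f) ->
  lambda.-integrable `[a, c] (EFin \o f).
Proof.
move=> ab bc i1 i2; have m1 := integrable_measurable i1.
have m2 := integrable_measurable i2.
have m := measurable_segment_glue ab bc m1 m2.
have i2' : lambda.-integrable `]b, c] (EFin \o f).
  by apply: integrableS i2 => //; apply: subset_itv; rewrite bnd_simp.
apply/integrableP; split; first exact/measurable_EFinP.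
rewrite (segment_glue ab bc) ge0_integral_setU//=.
- move/integrableP : i1 => [_ i1]; move/integrableP : i2' => [_ i2'].
  exact: lte_add_pinfty.
- by rewrite -(segment_glue ab bc); apply/measurable_EFinP; apply: measurableT_comp.
- apply/disj_setPS => x [/=]; rewrite !in_itv/= => /andP[_ xb] /andP[bx _].
  by have := lt_le_trans bx xb; rewrite ltxx.
Qed.

Lemma sqint_glue a b c f : a <= b -> b <= c ->
  sqint `[a, b] f -> sqint `[b, c] f -> sqint `[a, c] f.
Proof.
move=> ab bc [m1 i1] [m2 i2]; split; first exact: measurable_segment_glue m1 m2.
exact: (@integrable_segment_glue a b c (fun x => f x ^+ 2)).
Qed.

Lemma sqint_sub a b c d f : a <= c -> d <= b ->
  sqint `[a, b] f -> sqint `[c, d] f.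
Proof.
move=> ac db [mf fi]; split.
  by apply: measurable_funS mf => //; apply: subset_itv; rewrite bnd_simp.
exact: (@integrable_subsegment _ a b c d (fun x => f x ^+ 2)).
Qed.

Lemma sqint_segment_integrable a b f : sqint `[a, b] f ->
  lambda.-integrable `[a, b] (EFin \o f).
Proof. by apply: sqint_integrable => //; exact: segment_finite. Qed.

Lemma within_continuous_measurable a b f : {within `[a, b], continuous f} ->
  measurable_fun `[a, b] f.
Proof. by move=> cf; exact: subspace_continuous_measurable_fun. Qed.

Lemma within_continuous_bounded a b f : {within `[a, b], continuous f} ->
  exists M, forall x, a <= x <= b -> `|f x| <= M.
Proof.
move=> cf; have [ab|ba] := leP a b; last first.
  by exists 0 => x /andP[ax xb]; have := lt_le_trans ba (le_trans ax xb); rewrite ltxx.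
have cn : {within `[a, b], continuous (fun x => `|f x|)}.
  by move=> x; apply: continuous_comp; [exact: cf|exact: norm_continuous].
have [c _ H] := EVT_max ab cn.
by exists `|f c| => x xab; apply: H; rewrite in_itv.
Qed.

Lemma within_continuous_sqint a b f : {within `[a, b], continuous f} -> sqint `[a, b] f.
Proof.
move=> cf; have [M HM] := within_continuous_bounded cf.
apply: (@sqint_bounded _ _ _ _ M) => //.
- exact: segment_finite.
- exact: within_continuous_measurable.
Qed.

Lemma continuous_sqint a b f : continuous f -> sqint `[a, b] f.
Proof. by move=> cf; apply: within_continuous_sqint; exact: continuous_subspaceT. Qed.

Lemma shift_measurable c : measurable_fun setT (fun x => c + x : R).
Proof. by apply: measurable_funD. Qed.

(** By uniqueness of Lebesgue measure it is enough to compare the two measures on half-open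
    intervals. *)
Lemma lebesgue_measure_shift c (A : set (measurableTypeR R)) : measurable A ->
  lambda A = pushforward lambda (fun x : measurableTypeR R => c + x : measurableTypeR R) A.
Proof.
move=> mA.
apply: (@lebesgue_measure_unique R (pushforward lambda
  (fun x : measurableTypeR R => c + x : measurableTypeR R))) => //.
  exact: shift_measurable.
move=> mphi _ [[a b] _ <-].
change (lambda `]a, b]%classic =
  lambda ((fun x : R => c + x) @^-1` `]a, b]%classic)).
rewrite (_ : _ @^-1` _ = `]a - c, b - c]%classic); last first.
  by apply/seteqP; split => x /=; rewrite !in_itv/= ltrBlDl lerBrDl.
rewrite !lebesgue_measure_itv/= !lte_fin ltrD2r; case: ifP => // _.
by rewrite -!EFinD; congr EFin; ring.
Qed.

Lemma ge0_integral_shift a b c (f : R -> \bar R) : measurable_fun `[c + a, c + b] f ->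
  (forall x, (0 <= f x)%E) ->
  (\int[lambda]_(x in `[(c + a)%R, (c + b)%R]) f x = \int[lambda]_(x in `[a, b]) f (c + x)%R)%E.
Proof.
move=> mf f0.
have -> : `[a, b]%classic =
    (fun x : measurableTypeR R => c + x : measurableTypeR R) @^-1` `[c + a, c + b].
  by apply/seteqP; split => x /=; rewrite !in_itv/= !lerD2l.
rewrite -ge0_integral_pushforward//; last exact: shift_measurable.
apply: eq_measure_integral => //=; first exact: shift_measurable.
by move=> mphi A mA _; exact: lebesgue_measure_shift.
Qed.

Lemma measurable_shift a b c f : measurable_fun `[c + a, c + b] f ->
  measurable_fun `[a, b] (fun x => f (c + x)).
Proof.
move=> mf; apply: (measurable_comp (F := `[c + a, c + b]%classic)) => //.
  by move=> y [x xab <-]; move: xab; rewrite /= !in_itv/= !lerD2l.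
by apply: measurable_funTS; exact: shift_measurable.
Qed.

Lemma integrable_shift a b c f :
  lambda.-integrable `[c + a, c + b] (EFin \o f) ->
  lambda.-integrable `[a, b] (EFin \o (fun x => f (c + x))).
Proof.
move=> fi; have mf := integrable_measurable fi.
apply/integrableP; split; first by apply/measurable_EFinP; exact: measurable_shift.
move/integrableP : fi => [_]; rewrite ge0_integral_shift//.
by apply: measurableT_comp => //; exact/measurable_EFinP.
Qed.

Lemma Rintegral_shift a b c f :
  lambda.-integrable `[c + a, c + b] (EFin \o f) ->
  \int[lambda]_(x in `[c + a, c + b]) f x = \int[lambda]_(x in `[a, b]) f (c + x).
Proof.
move=> fi; have mf : measurable_fun `[c + a, c + b] (EFin \o f).
  by apply/measurable_EFinP; exact: integrable_measurable fi.
rewrite /Rintegral; congr fine; rewrite integralE [RHS]integralE.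
congr (_ - _)%E.
  rewrite (ge0_integral_shift (measurable_funepos mf)); last by move=> x; exact: funepos_ge0.
  by apply: eq_integral => x _; rewrite unlock.
rewrite (ge0_integral_shift (measurable_funeneg mf)); last by move=> x; exact: funeneg_ge0.
  by apply: eq_integral => x _; rewrite unlock.
Qed.

Lemma sqint_shift a b c f : sqint `[c + a, c + b] f -> sqint `[a, b] (fun x => f (c + x)).
Proof.
move=> [mf fi]; split; first exact: measurable_shift.
exact: (@integrable_shift a b c (fun x => f x ^+ 2)).
Qed.

Lemma sqint_unshift a b c f : sqint `[a, b] (fun x => f (c + x)) -> sqint `[c + a, c + b] f.
Proof.
move=> Sf; have H : sqint `[- c + (c + a), - c + (c + b)] (fun x => f (c + x)).
  by rewrite !addKr.
have := sqint_shift H.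
by congr sqint; apply/funext => x; rewrite addNKr.
Qed.

End segments.

Section absolutely_continuous.
Context {R : realType}.
Local Notation lambda := (@lebesgue_measure R).
Implicit Types (a b c L : R) (f g h u v : R -> R).

(** [acd 0 L] unfolds to [itv_deriv L]. A free left end point allows derivatives to be restricted,
    glued and shifted from cell to cell. *)
Definition acd a b u g : Prop :=
  sqint `[a, b] g /\
  forall s, a <= s <= b -> u s = u a + \int[lambda]_(r in `[a, s]) g r.

Lemma acd_within_continuous a b u g : a <= b -> acd a b u g ->
  {within `[a, b], continuous u}.
Proof.
move=> ab [Sg ug].
apply: (@subspace_eq_continuous _ _ _ (fun s => u a + \int[lambda]_(r in `[a, s]) g r)).
  by move=> s; rewrite inE /= in_itv/= => sab; rewrite -ug.
move=> x; apply: cvgD; first exact: cvg_cst.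
have := parameterized_integral_continuous ab (sqint_segment_integrable Sg).
by move=> /(_ x); apply.
Qed.

Lemma acd_sqint a b u g : a <= b -> acd a b u g -> sqint `[a, b] u.
Proof. by move=> ab ug; apply: within_continuous_sqint; exact: acd_within_continuous ug. Qed.

Lemma acd_integrable_upto a b u g s : acd a b u g -> a <= s <= b ->
  lambda.-integrable `[a, s] (EFin \o g).
Proof.
move=> [Sg _] /andP[as_ sb].
exact: integrable_subsegment (lexx a) sb (sqint_segment_integrable Sg).
Qed.

Lemma acd_lin a b c u g v h : acd a b u g -> acd a b v h ->
  acd a b (fun s => c * u s + v s) (fun s => c * g s + h s).
Proof.
move=> ug vh; have [Sg ugE] := ug; have [Sh vhE] := vh.
split; first exact: (si_lin (semi_inner_ipL2 (segment_measurable a b))).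
move=> s sab; have ig := acd_integrable_upto ug sab; have ih := acd_integrable_upto vh sab.
have icg : lambda.-integrable `[a, s] (EFin \o (fun x => c * g x)).
  by have := integrableZl (segment_measurable a s) c ig.
rewrite RintegralD//.
by rewrite RintegralZl//; rewrite ugE// vhE//; ring.
Qed.

Lemma acd_sub a b c d u g : a <= c -> c <= d -> d <= b -> acd a b u g -> acd c d u g.
Proof.
move=> ac cd db ug; split; first exact: sqint_sub ac db ug.1.
move=> s /andP[cs sd]; have sab : a <= s <= b.
  by rewrite (le_trans ac cs) (le_trans sd db).
rewrite (ug.2 s sab) (ug.2 c); last by rewrite ac (le_trans cd db).
rewrite -addrA; congr (_ + _); apply: Rintegral_split => //.
exact: (acd_integrable_upto ug).
Qed.

Lemma acd_ext a b u g v h : acd a b u g ->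
  (forall s, a <= s <= b -> u s = v s) -> (forall s, a <= s <= b -> g s = h s) ->
  a <= b -> acd a b v h.
Proof.
move=> [Sg ug] uv gh ab; split.
  case: Sg => mg ig; split.
    by apply: eq_measurable_fun mg => s; rewrite inE /= in_itv/=; exact: gh.
  apply: eq_integrable ig => // s; rewrite inE /= in_itv/= => sab.
  by rewrite gh.
move=> s sab; rewrite -!uv ?lexx// ug//; congr (_ + _).
apply: eq_Rintegral => r; rewrite inE /= in_itv/= => /andP[ar rs].
by rewrite gh// ar (le_trans rs)//; case/andP: sab.
Qed.

Lemma acd_glue a b c u g h : a <= b -> b <= c -> acd a b u g -> acd b c u h ->
  acd a c u (fun x => if x <= b then g x else h x).
Proof.
move=> ab bc ug uh; set k := fun x => _.
have kg s : a <= s <= b -> k s = g s by move=> /andP[_ sb]; rewrite /k sb.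
have ug' : acd a b u k by apply: acd_ext ug _ _ ab => // s /kg.
have hk s : `]b, c]%classic s -> h s = k s.
  by rewrite /= in_itv/= => /andP[bs _]; rewrite /k leNgt bs.
(* At [b] itself [k] takes the value of [g], not of [h]; the half-open interval is used to ignore
   this point. *)
have Sk : sqint `[b, c] k.
  have [mh ih] := uh.1; split.
    apply/measurable_fun_itv_obnd_cbndP.
    apply: (@eq_measurable_fun _ _ _ _ _ h); first by move=> x; rewrite inE; exact: hk.
    exact/measurable_fun_itv_obnd_cbndP.
  have ih' : lambda.-integrable `]b, c] (fun s => (h s ^+ 2)%:E).
    by apply: integrableS ih => //; apply: subset_itv; rewrite bnd_simp.
  have : lambda.-integrable `]b, c] (fun s => (k s ^+ 2)%:E).
    by apply: eq_integrable ih' => // x; rewrite inE => xbc; rewrite hk.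
  move=> /integrableP[mk ik]; apply/integrableP; split.
    exact/emeasurable_fun_itv_obnd_cbndP.
  rewrite -integral_itv_obnd_cbnd//.
  by apply: measurableT_comp.
split; first exact: sqint_glue ab bc ug'.1 Sk.
move=> s /andP[as_ sc]; have [sb|bs] := leP s b.
  by rewrite ug'.2// as_.
have sbc : b <= s <= c by rewrite ltW.
have Sks : sqint `[a, s] k.
  by apply: sqint_glue (ltW bs) _ _ => //; [exact: ug'.1|exact: sqint_sub Sk].
rewrite (Rintegral_split ab (ltW bs) (sqint_segment_integrable Sks)).
rewrite (uh.2 s sbc) (ug'.2 b) ?ab ?lexx// -addrA; congr (_ + (_ + _)).
have ih := acd_integrable_upto uh sbc.
have ik := sqint_segment_integrable (sqint_sub (lexx b) sc Sk).
rewrite -(Rintegral_itv_obnd_cbnd (r := b) (b := BRight s)); last first.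
  by apply: integrableS ih => //; apply: subset_itv; rewrite bnd_simp.
rewrite -[RHS](Rintegral_itv_obnd_cbnd (r := b) (b := BRight s)); last first.
  by apply: integrableS ik => //; apply: subset_itv; rewrite bnd_simp.
apply: eq_Rintegral => x; rewrite inE /= in_itv/= => /andP[bx xs].
by rewrite hk//= in_itv/= bx (le_trans xs).
Qed.

Lemma acd_shift a b c u g : a <= b -> acd (c + a) (c + b) u g ->
  acd a b (fun s => u (c + s)) (fun s => g (c + s)).
Proof.
move=> ab ug; split; first exact: sqint_shift ug.1.
move=> s /andP[as_ sb]; have sab : c + a <= c + s <= c + b by rewrite !lerD2l as_.
rewrite (ug.2 _ sab); congr (_ + _); apply: Rintegral_shift.
exact: (acd_integrable_upto ug).
Qed.

Lemma acd_unshift a b c u g : a <= b -> acd a b (fun s => u (c + s)) g ->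
  acd (c + a) (c + b) u (fun s => g (s - c)).
Proof.
move=> ab ug.
have H : acd (- c + (c + a)) (- c + (c + b)) (fun s => u (c + s)) g by rewrite !addKr.
have := @acd_shift (c + a) (c + b) (- c) _ _ _ H; rewrite lerD2l => /(_ ab) K.
by apply: acd_ext K _ _ _ => // [s _|s _|]; rewrite ?addNKr ?lerD2l// addrC.
Qed.

Lemma acd_ae_unique a b u g h : acd a b u g -> acd a b u h ->
  {ae lambda, forall x, `[a, b]%classic x -> g x = h x}.
Proof.
move=> ug uh; have igh := si_sub (semi_inner_ipL2 (segment_measurable a b)) ug.1 uh.1.
have := @ae_zero_of_primitive R a b (fun x => g x - h x) (sqint_segment_integrable igh).
move=> H; have {}H := H _.
apply: ae_lebesgueS (H _) => [x xx xab|s sab].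
  by apply/eqP; rewrite -subr_eq0 xx.
rewrite RintegralB//; [|exact: acd_integrable_upto ug sab
  |exact: acd_integrable_upto uh sab].
apply/eqP; rewrite subr_eq0; apply/eqP; apply: (@addrI _ (u a)).
by rewrite -(ug.2 s sab) (uh.2 s sab).
Qed.

(** After subtracting their values at [a], both functions are primitives, and the identity becomes
    Fubini on the triangle. *)
Lemma acd_by_parts a b u g v h : a <= b -> acd a b u g -> acd a b v h ->
  \int[lambda]_(s in `[a, b]) (u s * h s) =
  u b * v b - u a * v a - \int[lambda]_(s in `[a, b]) (g s * v s).
Proof.
move=> ab ug vh; have [Sg ugE] := ug; have [Sh vhE] := vh.
have mI := segment_measurable a b.
have ig := sqint_segment_integrable Sg; have ih := sqint_segment_integrable Sh.
have bb : a <= b <= b by rewrite ab lexx.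
pose U s := \int[lambda]_(r in `[a, s]) g r; pose V s := \int[lambda]_(r in `[a, s]) h r.
have iprod k w l : acd a b k l -> sqint `[a, b] w ->
    lambda.-integrable `[a, b] (EFin \o (fun s => k s * w s)).
  by move=> kl Sw; apply: sqint_mul => //; exact: acd_sqint kl.
have UE s : a <= s <= b -> U s = u s - u a by move=> sab; rewrite ugE// addrC addKr.
have VE s : a <= s <= b -> V s = v s - v a by move=> sab; rewrite vhE// addrC addKr.
have I1 : \int[lambda]_(s in `[a, b]) (u s * h s) =
    u a * V b + \int[lambda]_(s in `[a, b]) (h s * U s).
  rewrite -RintegralZl// -RintegralD//.
  - by apply: eq_Rintegral => s; rewrite inE /= in_itv/= => sab; rewrite UE//; ring.
  - by have := integrableZl mI (u a) ih.
  - have i2 := integrableB mI (iprod _ _ _ ug Sh) (integrableZl mI (u a) ih).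
    apply: eq_integrable i2 => // s; rewrite inE /= in_itv/= => sab.
    by rewrite UE//= -EFinD; congr EFin; ring.
have I2 : \int[lambda]_(s in `[a, b]) (g s * v s) =
    U b * v b - \int[lambda]_(s in `[a, b]) (g s * \int[lambda]_(r in `[s, b]) h r).
  rewrite -[U b * _]mulrC -RintegralZl// -RintegralB//.
  - apply: eq_Rintegral => s; rewrite inE /= in_itv/= => sab.
    have /andP[as_ sb] := sab; have := Rintegral_split as_ sb ih.
    by rewrite -/(V b) -/(V s) (VE b bb) (VE s sab) => E; have {}E : \int[lambda]_(r in `[s, b]) h r = v b - v s; [lra|rewrite E; ring].
  - by have := integrableZl mI (v b) ig.
  - have i2 := integrableB mI (integrableZl mI (v b) ig) (iprod _ _ _ vh Sg).
    apply: eq_integrable i2 => // s; rewrite inE /= in_itv/= => sab.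
    have /andP[as_ sb] := sab; have := Rintegral_split as_ sb ih.
    rewrite -/(V b) -/(V s) (VE b bb) (VE s sab) => E.
    have {}E : \int[lambda]_(r in `[s, b]) h r = v b - v s by lra.
    by rewrite E /= -EFinD; congr EFin; ring.
rewrite I1 I2 (Rintegral_triangle ih ig) (UE b bb) (VE b bb); ring.
Qed.

Lemma is_derive_continuous u g : (forall x : R, is_derive x 1 u (g x)) -> continuous u.
Proof.
by move=> ug x; apply: differentiable_continuous; apply/derivable1_diffP; case: (ug x).
Qed.

Lemma acd_is_derive a b u g : (forall x : R, is_derive x 1 u (g x)) -> continuous g ->
  acd a b u g.
Proof.
move=> ug cg; split; first exact: continuous_sqint.
have cu := is_derive_continuous ug.
move=> s /andP[as_ _]; move: as_; rewrite le_eqVlt => /predU1P[<-|as_].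
  by rewrite Rintegral_point addr0.
have H := @continuous_FTC2 R g u a s as_ (continuous_subspaceT cg).
have D : derivable_oo_LRcontinuous u a s.
  split; first by move=> x _; case: (ug x).
  - by apply: cvg_at_right_filter; exact: cu.
  - by apply: cvg_at_left_filter; exact: cu.
have E : {in `]a, s[, u^`()%classic =1 g}.
  by move=> x _; rewrite derive1E; apply: derive_val.
by rewrite /Rintegral (H D E) -EFinB /=; ring.
Qed.

(** Solves - u'' = f with Dirichlet conditions at both ends. *)
Lemma acd_second_primitive a b f : a < b -> sqint `[a, b] f ->
  exists u g, [/\ acd a b u g, acd a b g (fun s => - f s), u a = 0 & u b = 0].
Proof.
move=> ab Sf; have mI := segment_measurable a b.
have fi := sqint_segment_integrable Sf.
pose F s := \int[lambda]_(r in `[a, s]) f r.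
have aF : acd a b F f.
  by split => // s sab; rewrite {2}/F Rintegral_point add0r.
have SF := acd_sqint (ltW ab) aF.
have iF := sqint_segment_integrable SF.
(* The mean of [F]: it makes the integral of [g] over the segment 0, which is the condition at
   [b]. *)
pose C := (b - a)^-1 * \int[lambda]_(r in `[a, b]) F r.
pose g s := C - F s.
have ag : acd a b g (fun s => - f s).
  have aC : acd a b (fun=> C) (fun=> 0).
    by apply: acd_is_derive => // x; exact: cst_continuous.
  apply: (acd_ext (acd_lin (-1) aF aC) _ _ (ltW ab)) => s _.
    by rewrite mulN1r addrC.
  by rewrite mulN1r addr0.
have Sg := acd_sqint (ltW ab) ag.
exists (fun s => \int[lambda]_(r in `[a, s]) g r), g; split => //.
- by split => // s sab; rewrite Rintegral_point add0r.
- by rewrite Rintegral_point.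
- rewrite RintegralB//; last first.
    by apply: sqint_segment_integrable; apply: continuous_sqint => x; exact: cst_continuous.
  rewrite Rintegral_cst// /= lebesgue_measure_itv/= lte_fin ab -EFinD /C /=.
  by rewrite mulrAC mulVf ?mul1r ?subrr// subr_eq0 gt_eqF.
Qed.

End absolutely_continuous.

(** * Trigonometric systems *)

Section trigonometric_systems.
Context {R : realType}.
Local Notation lambda := (@lebesgue_measure R).
Implicit Types (a b k w x y : R).

Lemma sin_mul_eq0 (n : nat) y : sin y = 0 -> sin (n%:R * y) = 0.
Proof.
move=> y0; elim: n => [|n IH]; first by rewrite mul0r sin0.
by rewrite -natr1 mulrDl mul1r sinD IH y0 mulr0 mul0r addr0.
Qed.

Lemma sin_natpi (n : nat) : sin (n%:R * pi) = 0 :> R.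
Proof. by apply: sin_mul_eq0; rewrite sinpi. Qed.

Lemma sqr_cos_natpi (n : nat) : cos (n%:R * pi) ^+ 2 = 1 :> R.
Proof. by rewrite cos2sin2 sin_natpi expr0n subr0. Qed.

Lemma cos_mul2pi (n : nat) y : cos (n%:R * (2 * pi) + y) = cos y.
Proof.
elim: n => [|n IH]; first by rewrite mul0r add0r.
rewrite -natr1 mulrDl mul1r addrAC {2}(mulr_natl pi 2) cosD2pi.
exact: IH.
Qed.

Lemma is_derive_sinM k x : is_derive x 1 (fun y => sin (k * y)) (k * cos (k * x)).
Proof.
have H : is_derive x 1 (fun y => k * y) k.
  have := @is_deriveZ R R R id k x 1 1 (is_derive_id x 1).
  by rewrite /GRing.scale /= mulr1.
have := @is_derive1_comp R sin (fun y => k * y) x _ _ (is_derive_sin _) H.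
by rewrite mulrC.
Qed.

Lemma is_derive_cosM k x : is_derive x 1 (fun y => cos (k * y)) (- (k * sin (k * x))).
Proof.
have H : is_derive x 1 (fun y => k * y) k.
  have := @is_deriveZ R R R id k x 1 1 (is_derive_id x 1).
  by rewrite /GRing.scale /= mulr1.
have := @is_derive1_comp R cos (fun y => k * y) x _ _ (is_derive_cos _) H.
by rewrite mulNr mulrC.
Qed.

Lemma continuous_sinM k : continuous (fun y => sin (k * y)).
Proof. exact: is_derive_continuous (is_derive_sinM k). Qed.

Lemma continuous_cosM k : continuous (fun y => cos (k * y)).
Proof. exact: is_derive_continuous (is_derive_cosM k). Qed.

Lemma Rintegral_is_derive (u g : R -> R) a b : a <= b ->
  (forall x, is_derive x 1 u (g x)) -> continuous g ->
  \int[lambda]_(x in `[a, b]) g x = u b - u a.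
Proof.
move=> ab ug cg; have [_ H] := acd_is_derive a b ug cg.
by rewrite (H b) ?ab ?lexx//; ring.
Qed.

Lemma is_deriveMl c (u : R -> R) (g x : R) : is_derive x 1 u g ->
  is_derive x 1 (fun y => c * u y) (c * g).
Proof. by move=> ug; exact: (@is_deriveZ R R R u c x 1 g ug). Qed.

Lemma Rintegral_cosM k a b : a <= b -> k != 0 ->
  \int[lambda]_(x in `[a, b]) cos (k * x) = k^-1 * (sin (k * b) - sin (k * a)).
Proof.
move=> ab k0; rewrite mulrBr.
apply: (@Rintegral_is_derive (fun x => k^-1 * sin (k * x))) => // [x|].
  by have := is_deriveMl k^-1 (is_derive_sinM k x); rewrite mulKf.
exact: continuous_cosM.
Qed.

Lemma Rintegral_sinM k a b : a <= b -> k != 0 ->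
  \int[lambda]_(x in `[a, b]) sin (k * x) = k^-1 * (cos (k * a) - cos (k * b)).
Proof.
move=> ab k0.
have -> : k^-1 * (cos (k * a) - cos (k * b)) =
   (- k^-1) * cos (k * b) - (- k^-1) * cos (k * a) by ring.
apply: (@Rintegral_is_derive (fun x => - k^-1 * cos (k * x))) => // [x|].
  by have := is_deriveMl (- k^-1) (is_derive_cosM k x); rewrite mulrNN mulKf.
exact: continuous_sinM.
Qed.

Lemma integrable_continuous (u : R -> R) a b : continuous u ->
  lambda.-integrable `[a, b] (EFin \o u).
Proof. by move=> cu; apply: sqint_segment_integrable; exact: continuous_sqint. Qed.

Lemma Rintegral_half_add (u v : R -> R) a b : continuous u -> continuous v ->
  \int[lambda]_(x in `[a, b]) (2^-1 * (u x + v x)) =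
  2^-1 * (\int[lambda]_(x in `[a, b]) u x + \int[lambda]_(x in `[a, b]) v x).
Proof.
move=> cu cv; rewrite RintegralZl//; last first.
  by apply: integrable_continuous => x; apply: cvgD; [exact: cu|exact: cv].
by rewrite RintegralD//; exact: integrable_continuous.
Qed.

Lemma Rintegral_half_sub (u v : R -> R) a b : continuous u -> continuous v ->
  \int[lambda]_(x in `[a, b]) (2^-1 * (u x - v x)) =
  2^-1 * (\int[lambda]_(x in `[a, b]) u x - \int[lambda]_(x in `[a, b]) v x).
Proof.
move=> cu cv; rewrite RintegralZl//; last first.
  by apply: integrable_continuous => x; apply: cvgB; [exact: cu|exact: cv].
by rewrite RintegralB//; exact: integrable_continuous.
Qed.

Lemma Rintegral_cst_segment a b c : a <= b ->
  \int[lambda]_(x in `[a, b]) c = c * (b - a).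
Proof.
move=> ab; rewrite Rintegral_cst// /= lebesgue_measure_itv/= lte_fin.
case: ltP => [_|ba]; first by rewrite -EFinD.
by rewrite mulr0; have -> : a = b by [apply/eqP; rewrite eq_le ab]; rewrite subrr mulr0.
Qed.

Section commensurable.
Variables (a b w : R).
Hypotheses (ab : a < b) (w0 : 0 < w) (wa : sin (w * a) = 0) (wb : sin (w * b) = 0).

Lemma Rintegral_cos_eq0 (n : nat) : (0 < n)%N ->
  \int[lambda]_(x in `[a, b]) cos (n%:R * w * x) = 0.
Proof.
move=> n0; rewrite Rintegral_cosM ?ltW// ?mulf_neq0 ?pnatr_eq0 -?lt0n// ?gt_eqF//.
by rewrite -!mulrA !sin_mul_eq0// subr0 !mulr0.
Qed.

(** In truncated subtraction (m - n) + (n - m) is the distance from m to n, so frequencies remain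
    natural numbers. *)
Lemma cosB_nat (m n : nat) y :
  cos (m%:R * y - n%:R * y) = cos (((m - n) + (n - m))%N%:R * y).
Proof.
case: (leqP n m) => nm.
  by rewrite (eqP nm) addn0 natrB// mulrBl.
by rewrite (eqP (ltnW nm)) add0n (natrB _ (ltnW nm)) -cosN opprB mulrBl.
Qed.

Lemma sin_sin_half (m n : nat) x : sin (m%:R * w * x) * sin (n%:R * w * x) =
  2^-1 * (cos (((m - n) + (n - m))%N%:R * w * x) - cos ((m + n)%N%:R * w * x)).
Proof. by rewrite -!mulrA -cosB_nat natrD mulrDl cosB cosD; field. Qed.

Lemma cos_cos_half (m n : nat) x : cos (m%:R * w * x) * cos (n%:R * w * x) =
  2^-1 * (cos (((m - n) + (n - m))%N%:R * w * x) + cos ((m + n)%N%:R * w * x)).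
Proof. by rewrite -!mulrA -cosB_nat natrD mulrDl cosB cosD; field. Qed.

Lemma absdiff_gt0 (m n : nat) : m != n -> (0 < (m - n) + (n - m))%N.
Proof. by rewrite addn_gt0 !subn_gt0 orbC -neq_ltn. Qed.

Lemma sin_orthogonal (m n : nat) : m != n ->
  ipL2 `[a, b] (fun x => sin (m%:R * w * x)) (fun x => sin (n%:R * w * x)) = 0.
Proof.
move=> mn; rewrite /ipL2; under eq_Rintegral do rewrite sin_sin_half.
rewrite Rintegral_half_sub; [|exact: continuous_cosM|exact: continuous_cosM].
rewrite !Rintegral_cos_eq0 ?subrr ?mulr0//; last exact: absdiff_gt0.
by rewrite addn_gt0; move: mn; case: m => [|m]; case: n.
Qed.

Lemma cos_orthogonal (m n : nat) : m != n ->
  ipL2 `[a, b] (fun x => cos (m%:R * w * x)) (fun x => cos (n%:R * w * x)) = 0.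
Proof.
move=> mn; rewrite /ipL2; under eq_Rintegral do rewrite cos_cos_half.
rewrite Rintegral_half_add; [|exact: continuous_cosM|exact: continuous_cosM].
rewrite !Rintegral_cos_eq0 ?addr0 ?mulr0//; last exact: absdiff_gt0.
by rewrite addn_gt0; move: mn; case: m => [|m]; case: n.
Qed.

Lemma sin_sqr_integral (m : nat) : (0 < m)%N ->
  ipL2 `[a, b] (fun x => sin (m%:R * w * x)) (fun x => sin (m%:R * w * x)) = (b - a) / 2.
Proof.
move=> m0; rewrite /ipL2; under eq_Rintegral do rewrite sin_sin_half.
rewrite Rintegral_half_sub; [|exact: continuous_cosM|exact: continuous_cosM].
rewrite [X in _ - X]Rintegral_cos_eq0 ?addn_gt0 ?m0// subnn addn0.
under eq_Rintegral do rewrite !mul0r cos0.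
by rewrite Rintegral_cst_segment ?ltW// mul1r subr0 mulrC.
Qed.

Lemma cos_sqr_integral (m : nat) : (0 < m)%N ->
  ipL2 `[a, b] (fun x => cos (m%:R * w * x)) (fun x => cos (m%:R * w * x)) = (b - a) / 2.
Proof.
move=> m0; rewrite /ipL2; under eq_Rintegral do rewrite cos_cos_half.
rewrite Rintegral_half_add; [|exact: continuous_cosM|exact: continuous_cosM].
rewrite [X in _ + X]Rintegral_cos_eq0 ?addn_gt0 ?m0// subnn addn0.
under eq_Rintegral do rewrite !mul0r cos0.
by rewrite Rintegral_cst_segment ?ltW// mul1r addr0 mulrC.
Qed.

End commensurable.

(** The induction runs on the exponent of the mixed products cos(y)^k cos(m y), for all [m] at once:
    one factor cos y moves the frequency [m] to m + 1 and m - 1. *)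
Lemma cos_powers_eq0 (D : set R) (f y : R -> R) :
  measurable (D : set (measurableTypeR R)) ->
  lambda.-integrable D (EFin \o f) -> measurable_fun D y ->
  (forall m : nat, \int[lambda]_(x in D) (f x * cos (m%:R * y x)) = 0) ->
  forall n, \int[lambda]_(x in D) (f x * cos (y x) ^+ n) = 0.
Proof.
move=> mD fi my H n.
have mc : measurable_fun D (fun x => cos (y x)).
  by apply: measurableT_comp => //; apply: continuous_measurable_fun; exact: continuous_cos.
have mcm (m : nat) : measurable_fun D (fun x => cos (m%:R * y x)).
  apply: measurableT_comp => //; first by apply: continuous_measurable_fun; exact: continuous_cos.
  exact: measurable_funM.
have int (k m : nat) : lambda.-integrable D
    (EFin \o (fun x => f x * (cos (y x) ^+ k * cos (m%:R * y x)))).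
  apply: (integrable_mul_bounded mD fi (M := 1)).
    by apply: measurable_funM => //; exact: measurable_funX.
  by move=> x _; rewrite normrM normrX mulr_ile1 ?exprn_ge0 ?cos_max ?exprn_ile1 ?cos_max.
suff K : forall k m : nat,
    \int[lambda]_(x in D) (f x * (cos (y x) ^+ k * cos (m%:R * y x))) = 0.
  rewrite -[RHS](K n 0%N); apply: eq_Rintegral => x _.
  by rewrite mul0r cos0 mulr1.
elim=> [|k IH] m.
  by rewrite -[RHS](H m); apply: eq_Rintegral => x _; rewrite expr0 mul1r.
(* From m = 0 the frequency cannot be lowered; there cos(0 y) = 1 and the extra factor is the mode
   of frequency 1. *)
case: m => [|m].
  rewrite -[RHS](IH 1%N); apply: eq_Rintegral => x _.
  by rewrite mul0r cos0 mulr1 exprSr mul1r.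
transitivity (\int[lambda]_(x in D) (2^-1 * (f x * (cos (y x) ^+ k * cos (m.+2%:R * y x))) +
    2^-1 * (f x * (cos (y x) ^+ k * cos (m%:R * y x))))).
  apply: eq_Rintegral => x _; rewrite exprSr.
  have -> : m.+2%:R = m%:R + 1 + 1 :> R by rewrite -addn2 natrD; ring.
  rewrite -(natr1 m) !mulrDl !mul1r.
  set z := m%:R * y x; set c := y x.
  rewrite (cosD (z + c) c) (cosD z c) (sinD z c); have := cos2Dsin2 c.
  set C := cos c; set S := sin c => E; apply/eqP; rewrite -subr_eq0; apply/eqP.
  transitivity (- (f x * C ^+ k * cos z / 2) * (1 - (C ^+ 2 + S ^+ 2))); first by field.
  by rewrite E subrr mulr0.
rewrite RintegralD//; last 2 first.
- by have := integrableZl mD 2^-1 (int k m.+2).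
- by have := integrableZl mD 2^-1 (int k m).
by rewrite !RintegralZl// !IH !mulr0 addr0.
Qed.

Lemma ae_neq a : {ae lambda, forall x, x != a}.
Proof.
exists [set a]; split; [exact: measurable_set1|exact: lebesgue_measure_set1|].
by move=> x /= /negP; rewrite negbK => /eqP.
Qed.

Lemma Rintegral_ae_eq (D : set R) (f g : R -> R) :
  measurable (D : set (measurableTypeR R)) ->
  measurable_fun D f -> measurable_fun D g ->
  {ae lambda, forall x, D x -> f x = g x} ->
  \int[lambda]_(x in D) f x = \int[lambda]_(x in D) g x.
Proof.
move=> mD mf mg fg; rewrite /Rintegral; congr fine; apply: ae_eq_integral => //.
- exact/measurable_EFinP.
- exact/measurable_EFinP.
- by apply: ae_lebesgueS fg => x H Dx; rewrite H.
Qed.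

(** For each [s] the function [c] and the level [tau] are chosen so that tau < c holds exactly to
    the left of [s], up to finitely many points. By [integral_superlevel] the primitive of [f] then
    vanishes at [s]. *)
Lemma ae_zero_of_moments a b (f : R -> R) : lambda.-integrable `[a, b] (EFin \o f) ->
  (forall s, a < s <= b -> exists (c : R -> R) (tau : R),
    [/\ continuous c, forall x, `|c x| <= 1, `|tau| <= 1,
        forall n, \int[lambda]_(x in `[a, b]) (f x * c x ^+ n) = 0 &
        forall x, a < x < b -> x != s -> c x != tau /\ (tau < c x) = (x < s)]) ->
  {ae lambda, forall x, `[a, b]%classic x -> f x = 0}.
Proof.
move=> fi H; apply: (ae_zero_of_primitive fi) => s /andP[].
rewrite le_eqVlt => /predU1P[<- _|as_ sb]; first exact: Rintegral_point.
have [|c [tau [cc c1 tau1 fc ct]]] := H s; first by rewrite as_.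
have mD := segment_measurable a b.
have mc : measurable_fun `[a, b] c.
  by apply: measurable_funTS; exact: continuous_measurable_fun.
have aeD : {ae lambda, forall x, x != a /\ x != b /\ x != s}.
  apply: ae_lebesgueS2 (ae_neq a) _; last first.
    by apply: ae_lebesgueS2 (ae_neq b) (ae_neq s) => x xb xs; exact: conj xb xs.
  by move=> x xa xbs; exact: conj xa xbs.
have inD x : `[a, b]%classic x -> x != a -> x != b -> a < x < b.
  by rewrite /= in_itv/= => /andP[ax xb] xa xb'; rewrite !lt_neqAle ax xb xb' eq_sym xa.
have K : {ae lambda, forall x, `[a, b]%classic x -> c x != tau}.
  by apply: ae_lebesgueS aeD => x [xa [xb xs]] xab; have [] := ct x (inD x xab xa xb) xs.
have := integral_superlevel mD fi mc c1 fc tau1 K.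
have mlt : measurable_fun `[a, b] (fun x => (tau < c x)%R%:R : R).
  apply: (@measurableT_comp _ _ _ _ _ _ (fun b : bool => b%:R : R)) => //.
  exact: measurable_fun_ltr.
have mf := integrable_measurable fi.
have fs : lambda.-integrable `[a, s] (EFin \o f) by exact: integrable_subsegment fi.
rewrite (@Rintegral_ae_eq _ _ (f \_ `[a, s])) //.
- rewrite -Rintegral_mkcondr setIidr// => x /=.
  by rewrite !in_itv/= => /andP[-> /le_trans]; apply.
- exact: measurable_funM.
- apply/(measurable_restrict _ (segment_measurable a s) mD).
  by apply: measurable_funS mf => // x [].
- apply: ae_lebesgueS aeD => x [xa [xb xs]] xab; rewrite patchE.
  have [_ ->] := ct x (inD x xab xa xb) xs.
  have -> : (x \in `[a, s]%classic) = (x < s).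
    by apply/idP/idP; rewrite inE/= in_itv/=; move: xab; rewrite /= in_itv/= => /andP[-> _]/=;
      [rewrite le_eqVlt (negbTE xs)|exact: ltW].
  by case: (x < s); rewrite ?mulr1 ?mulr0.
Qed.

Lemma ip_scale2 (D : set R) (u v : R -> R) c d :
  measurable (D : set (measurableTypeR R)) -> sqint D u -> sqint D v ->
  ipL2 D (fun x => c * u x) (fun x => d * v x) = c * d * ipL2 D u v.
Proof.
move=> mD Su Sv; have si := semi_inner_ipL2 mD.
rewrite (ip_scalel si)//; last exact: (si_scale si).
by rewrite (si_sym si) (ip_scalel si)// (si_sym si) mulrA.
Qed.

(** * The sine system of a segment *)

Section sine_system.
Variables (a b w : R) (p : nat).
Hypotheses (w0 : 0 < w) (wa : w * a = p%:R * pi) (wb : w * (b - a) = pi).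

Let ab : a < b.
Proof. by rewrite -subr_gt0 -(pmulr_rgt0 _ w0) wb pi_gt0. Qed.

Let swa : sin (w * a) = 0. Proof. by rewrite wa sin_natpi. Qed.

Let swb : sin (w * b) = 0.
Proof. by rewrite -(subrK a b) mulrDr wb wa sinD sinpi sin_natpi mulr0 mul0r addr0. Qed.

(** The product of sin y and cos(m y) is a combination of sines, so f sin(y) is orthogonal to every
    cos(m y). As cos is strictly decreasing on [0, pi], its superlevel sets are initial segments,
    whence f sin(y) = 0 a.e.; and sin y > 0 inside the segment. *)
Lemma sine_complete (f : R -> R) : sqint `[a, b] f ->
  (forall m : nat, ipL2 `[a, b] f (fun x => sin (m%:R * w * x)) = 0) ->
  {ae lambda, forall x, `[a, b]%classic x -> f x = 0}.
Proof.
move=> Sf H; have mD := segment_measurable a b.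
(* The shift by a multiple of pi maps the segment onto [0, pi] and changes each sine only by the
   sign cos(m p pi). *)
pose y x := w * x - p%:R * pi.
have yE x : y x = w * (x - a) by rewrite /y -wa mulrBr.
have cy : continuous y.
  by move=> x; apply: cvgB; [apply: cvgM; [exact: cvg_cst|exact: cvg_id]|exact: cvg_cst].
have Ssin u k : continuous u -> sqint `[a, b] (fun x => sin (k * u x)).
  move=> cu; apply: continuous_sqint => x; apply: (@continuous_comp _ _ _ (fun x => k * u x) sin).
    by apply: cvgM; [exact: cvg_cst|exact: cu].
  exact: continuous_sin.
have Scos u k : continuous u -> sqint `[a, b] (fun x => cos (k * u x)).
  move=> cu; apply: continuous_sqint => x; apply: (@continuous_comp _ _ _ (fun x => k * u x) cos).
    by apply: cvgM; [exact: cvg_cst|exact: cu].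
  exact: continuous_cos.
have Hy m : \int[lambda]_(x in `[a, b]) (f x * sin (m%:R * y x)) = 0.
  transitivity (cos (m%:R * p%:R * pi) * ipL2 `[a, b] f (fun x => sin (m%:R * w * x)));
    last by rewrite H mulr0.
  rewrite -RintegralZl//; last first.
    apply: sqint_mul => //; apply: continuous_sqint; exact: continuous_sinM.
  apply: eq_Rintegral => x _; rewrite /y mulrBr sinB !mulrA.
  rewrite -natrM sin_natpi mulr0 subr0; ring.
pose g x := f x * sin (y x).
have Ssy : sqint `[a, b] (fun x => sin (y x)).
  by have := Ssin y 1 cy; congr sqint; apply/funext => x; rewrite mul1r.
have gi : lambda.-integrable `[a, b] (EFin \o g) by exact: sqint_mul.
have gcos m : \int[lambda]_(x in `[a, b]) (g x * cos (m%:R * y x)) = 0.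
  have int n : lambda.-integrable `[a, b] (EFin \o (fun x => f x * sin (n%:R * y x))).
    by apply: sqint_mul => //; exact: Ssin.
  case: m => [|m].
    rewrite -[RHS](Hy 1%N); apply: eq_Rintegral => x _.
    by rewrite /g mul0r cos0 mulr1 mul1r.
  transitivity (\int[lambda]_(x in `[a, b]) (2^-1 * (f x * sin (m.+2%:R * y x)) +
     (- 2^-1) * (f x * sin (m%:R * y x)))).
    apply: eq_Rintegral => x _; rewrite /g.
    have -> : m.+2%:R = m%:R + 1 + 1 :> R by rewrite -addn2 natrD; ring.
    rewrite -(natr1 m) !mulrDl !mul1r.
    set z := m%:R * y x; set c := y x.
    rewrite (sinD (z + c) c) (sinD z c) (cosD z c); have := cos2Dsin2 c.
    set C := cos c; set S := sin c => E; apply/eqP; rewrite -subr_eq0; apply/eqP.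
    transitivity (f x * sin z / 2 * (1 - (C ^+ 2 + S ^+ 2))); first by field.
    by rewrite E subrr mulr0.
  rewrite RintegralD//; last 2 first.
  - by have := integrableZl mD 2^-1 (int m.+2).
  - by have := integrableZl mD (- 2^-1) (int m).
  by rewrite !RintegralZl// !Hy !mulr0 addr0.
have y_itv x : a <= x <= b -> y x \in `[0, pi].
  move=> /andP[ax xb]; rewrite in_itv/= yE mulr_ge0 ?subr_ge0 ?(ltW w0)//=.
  by rewrite -wb ler_wpM2l ?lerD2r ?(ltW w0).
have gae : {ae lambda, forall x, `[a, b]%classic x -> g x = 0}.
  apply: ae_zero_of_moments => // s /andP[as_ sb].
  have ys : y s \in `[0, pi] by apply: y_itv; rewrite ltW.
  exists (fun x => cos (y x)), (cos (y s)); split => //.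
  - move=> x; apply: (@continuous_comp _ _ _ y cos); first exact: cy.
    exact: continuous_cos.
  - by move=> x; exact: cos_max.
  - exact: cos_max.
  - apply: (cos_powers_eq0 mD gi) => //.
    by apply: measurable_funTS; exact: continuous_measurable_fun.
  - move=> x /andP[ax xb] xs.
    have yx : y x \in `[0, pi] by apply: y_itv; rewrite !ltW.
    have yxs : (y x < y s) = (x < s) by rewrite !yE ltr_pM2l// ltrD2r.
    split; last by rewrite ltr_cos.
    apply: contra xs => /eqP /(cos_inj yx ys); rewrite !yE => /(mulfI (lt0r_neq0 w0)).
    by move=> /addIr ->.
apply: ae_lebesgueS2 (ae_neq a) _; last first.
  by apply: ae_lebesgueS2 (ae_neq b) gae => x xb H'; exact: conj xb H'.
move=> x xa [xb gx] xab; move/eqP: (gx xab); rewrite /g mulf_eq0 => /orP[/eqP//|].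
move: xab; rewrite /= in_itv/= => /andP[ax xb'].
have ax' : a < x by rewrite lt_neqAle eq_sym xa.
have xb'' : x < b by rewrite lt_neqAle xb.
by rewrite gt_eqF// sin_gt0_pi// yE mulr_gt0 ?subr_gt0//= -wb ltr_pM2l// ltrD2r.
Qed.

Lemma sine_parseval (f : R -> R) : sqint `[a, b] f ->
  series (fun m => 2 / (b - a) * ipL2 `[a, b] f (fun x => sin (m%:R * w * x)) ^+ 2)
    @ \oo --> ipL2 `[a, b] f f.
Proof.
move=> Sf; have mD := segment_measurable a b.
have si := semi_inner_ipL2 mD.
have ba0 : 0 < 2 / (b - a) by rewrite divr_gt0// subr_gt0.
pose phi (m : nat) (k : unit) x := Num.sqrt (2 / (b - a)) * sin (m%:R * w * x).
have Ss (m : nat) : sqint `[a, b] (fun x => sin (m%:R * w * x)).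
  by apply: continuous_sqint; exact: continuous_sinM.
have ipE g m : sqint `[a, b] g -> ipL2 `[a, b] g (phi m tt) =
    Num.sqrt (2 / (b - a)) * ipL2 `[a, b] g (fun x => sin (m%:R * w * x)).
  by move=> Sg; rewrite (si_sym si) (ip_scalel si)// (si_sym si).
have := @parseval R _ mD unit phi _ _ _ _ f Sf.
set s1 := series _; set s2 := series _.
have -> : s1 = s2.
  rewrite /s1 /s2; congr series; apply/funext => m.
  rewrite (bigD1 tt)//= big1 ?addr0; last by case.
  by rewrite ipE// exprMn sqr_sqrtr// ltW.
apply.
- by move=> m k; exact: (si_scale si).
- move=> m [] m' []; rewrite xpair_eqE andbT => mm'.
  by rewrite ip_scale2// sin_orthogonal// mulr0.
- move=> g m [] Sg; rewrite ip_scale2// -expr2 sqr_sqrtr ?ltW//.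
  case: m => [|m].
    rewrite ipE// (_ : (fun x => _) = (fun=> 0)); last first.
      by apply/funext => x; rewrite !mul0r sin0.
    by rewrite (si_sym si g) !(ip_zerol si)//; [rewrite !mulr0|exact: (si_zero si)].
  rewrite sin_sqr_integral//.
  have ba : b - a != 0 by rewrite subr_eq0 gt_eqF.
  by rewrite (_ : 2 / (b - a) * ((b - a) / 2) = 1) ?mulr1//; field.
- move=> g Sg H; apply: sine_complete => // m; have := H m tt.
  by rewrite ipE// => /eqP; rewrite mulf_eq0 sqrtr_eq0 leNgt ba0/= => /eqP.
Qed.

End sine_system.

(** * The trigonometric system of the circle *)

Section circle_system.

Definition circle_coef (m : nat) : R :=
  Num.sqrt (if m is 0 then (2 * pi)^-1 else pi^-1).

Definition circle_fun (m : nat) (k : bool) (x : R) : R :=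
  circle_coef m * (if k then cos (m%:R * x) else sin (m%:R * x)).

Lemma circle_coef_gt0 m : 0 < circle_coef m.
Proof. by rewrite sqrtr_gt0; case: m => [|m]; rewrite invr_gt0 ?mulr_gt0 ?pi_gt0. Qed.

Lemma sqr_circle_coef m : circle_coef m ^+ 2 = if m is 0 then (2 * pi)^-1 else pi^-1.
Proof.
by rewrite sqr_sqrtr//; case: m => [|m]; rewrite invr_ge0 ?mulr_ge0 ?pi_ge0.
Qed.

Local Notation D := (`[0, (2 * pi)]%classic : set R).

Let pi20 : 0 < 2 * pi :> R. Proof. by rewrite mulr_gt0// pi_gt0. Qed.

Let sin20 : sin (1 * (2 * pi) : R) = 0.
Proof. by rewrite mul1r mulr_natl sin2pi. Qed.

Let sin00 : sin (1 * 0 : R) = 0. Proof. by rewrite mulr0 sin0. Qed.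

Let Scos (m : nat) : sqint D (fun x => cos (m%:R * x)).
Proof. by apply: continuous_sqint; exact: continuous_cosM. Qed.

Let Ssin (m : nat) : sqint D (fun x => sin (m%:R * x)).
Proof. by apply: continuous_sqint; exact: continuous_sinM. Qed.

Let cos1 (m : nat) : (fun x : R => cos (m%:R * x)) = (fun x => cos (m%:R * 1 * x)).
Proof. by apply/funext => x; rewrite mulr1. Qed.

Let sin1 (m : nat) : (fun x : R => sin (m%:R * x)) = (fun x => sin (m%:R * 1 * x)).
Proof. by apply/funext => x; rewrite mulr1. Qed.

Lemma Rintegral_sin_circle (m : nat) : \int[lambda]_(x in D) sin (m%:R * x) = 0.
Proof.
case: m => [|m].
  under eq_Rintegral do rewrite mul0r sin0.
  by rewrite Rintegral_cst_segment ?ltW// mul0r.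
rewrite Rintegral_sinM ?ltW// ?pnatr_eq0//.
by rewrite mulr0 cos0 -[m.+1%:R * _]addr0 cos_mul2pi cos0 subrr mulr0.
Qed.

Lemma cos_sin_orthogonal (m n : nat) :
  ipL2 D (fun x => cos (m%:R * x)) (fun x => sin (n%:R * x)) = 0.
Proof.
have I (k : nat) := Rintegral_sin_circle k.
rewrite /ipL2; have [mn|nm] := leqP m n.
  transitivity (\int[lambda]_(x in D)
      (2^-1 * (sin ((m + n)%:R * x) + sin ((n - m)%:R * x)))).
    apply: eq_Rintegral => x _; rewrite natrD natrB// mulrDl mulrBl sinD sinB; by field.
  by rewrite Rintegral_half_add ?I ?addr0 ?mulr0//; exact: continuous_sinM.
transitivity (\int[lambda]_(x in D)
      (2^-1 * (sin ((m + n)%:R * x) - sin ((m - n)%:R * x)))).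
  apply: eq_Rintegral => x _; rewrite natrD (natrB _ (ltnW nm)) mulrDl mulrBl sinD sinB; by field.
by rewrite Rintegral_half_sub ?I ?subrr ?mulr0//; exact: continuous_sinM.
Qed.

(** On a full period cos is not monotone, so the test function depends on [s]: inside the period,
    cos(x - s/2) exceeds cos(s/2) exactly for x < s. Expanding cos(m (x - s/2)) is where both the
    cosine and the sine coefficients enter. *)
Lemma circle_complete (f : R -> R) : sqint D f ->
  (forall m : nat, \int[lambda]_(x in D) (f x * cos (m%:R * x)) = 0) ->
  (forall m : nat, \int[lambda]_(x in D) (f x * sin (m%:R * x)) = 0) ->
  {ae lambda, forall x, D x -> f x = 0}.
Proof.
move=> Sf Hc Hs; have mD := segment_measurable 0 (2 * pi : R).
have fi := sqint_segment_integrable Sf.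
apply: ae_zero_of_moments => // s /andP[s0 s2].
pose y x := x - s / 2.
have cy : continuous y by move=> x; apply: cvgB; [exact: cvg_id|exact: cvg_cst].
have s2_itv : s / 2 \in `[0, pi].
  by rewrite in_itv/=; apply/andP; split; lra.
exists (fun x => cos (y x)), (cos (s / 2)); split.
- by move=> x; apply: (@continuous_comp _ _ _ y cos); [exact: cy|exact: continuous_cos].
- by move=> x; exact: cos_max.
- exact: cos_max.
- apply: (cos_powers_eq0 mD fi) => [|m].
    by apply: measurable_funTS; exact: continuous_measurable_fun.
  transitivity (\int[lambda]_(x in D) (cos (m%:R * (s / 2)) * (f x * cos (m%:R * x)) +
      sin (m%:R * (s / 2)) * (f x * sin (m%:R * x)))).
    by apply: eq_Rintegral => x _; rewrite /y mulrBr cosB; ring.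
  have i1 : lambda.-integrable D (EFin \o (fun x => f x * cos (m%:R * x))) by exact: sqint_mul.
  have i2 : lambda.-integrable D (EFin \o (fun x => f x * sin (m%:R * x))) by exact: sqint_mul.
  rewrite RintegralD//; last 2 first.
  - by have := integrableZl mD (cos (m%:R * (s / 2))) i1.
  - by have := integrableZl mD (sin (m%:R * (s / 2))) i2.
  by rewrite !RintegralZl// Hc Hs !mulr0 addr0.
- move=> x /andP[x0 x2] xs; rewrite /y.
  have [xle|xgt] := leP (x - s / 2) pi.
    have nx : `|x - s / 2| \in `[0, pi].
      rewrite in_itv/= normr_ge0 /= ler_norml xle andbT.
      move: s2_itv; rewrite in_itv/= => /andP[_]; lra.
    rewrite -(cos_norm (x - s / 2)).
    have E : (`|x - s / 2| < s / 2) = (x < s).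
      by rewrite ltr_norml; apply/andP/idP => [[]|?]; [|split]; lra.
    split; last by rewrite ltr_cos.
    apply/eqP => /(cos_inj nx s2_itv) => H.
    have [xx|xx] := ltP x s; first by move: E; rewrite H xx ltxx.
    move: H; rewrite ger0_norm; last by lra.
    by move/eqP: xs => xs H; apply: xs; lra.
  (* Past pi the angle is reflected to 2 pi - (x - s/2), which is again in [0, pi] and at least s/2
     because x < 2 pi. *)
  have cE : cos (x - s / 2) = cos (2 * pi - (x - s / 2)).
    by have := cos_mul2pi 1 (- (x - s / 2)); rewrite mul1r cosN => <-.
  have nx : 2 * pi - (x - s / 2) \in `[0, pi].
    by rewrite in_itv/=; apply/andP; split; lra.
  have E : (2 * pi - (x - s / 2) < s / 2) = false by apply/negbTE; rewrite -leNgt; lra.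
  rewrite cE ltr_cos// E; split.
    apply/eqP => /(cos_inj nx s2_itv) => H.
    by move: x2; rewrite ltNge => /negP; apply; lra.
  by symmetry; apply/negbTE; rewrite -leNgt; lra.
Qed.

Lemma circle_parseval (f : R -> R) : sqint D f ->
  series (fun m => \sum_k ipL2 D f (circle_fun m k) ^+ 2) @ \oo --> ipL2 D f f.
Proof.
move=> Sf; have mD := segment_measurable 0 (2 * pi : R).
have si := semi_inner_ipL2 mD.
pose base (m : nat) (k : bool) x : R := if k then cos (m%:R * x) else sin (m%:R * x).
have Sb m (k : bool) : sqint D (base m k) by case: k; [exact: Scos|exact: Ssin].
have ipE g m (k : bool) : sqint D g -> ipL2 D g (circle_fun m k) =
    circle_coef m * ipL2 D g (base m k).
  move=> Sg; rewrite (si_sym si).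
  by rewrite (si_sym si g (base m k)) -(ip_scalel si).
apply: parseval => //.
- by move=> m k; apply: (si_scale si); exact: Sb.
- move=> m k m' k' neq; rewrite (ip_scale2 _ _ mD (Sb m k) (Sb m' k')).
  suff -> : ipL2 D (base m k) (base m' k') = 0 by rewrite mulr0.
  move: neq; case: k; case: k'; rewrite xpair_eqE ?andbT ?andbF => neq.
  + by rewrite /base cos1 cos1 cos_orthogonal.
  + exact: cos_sin_orthogonal.
  + by rewrite (si_sym si); exact: cos_sin_orthogonal.
  + by rewrite /base sin1 sin1 sin_orthogonal.
- move=> g m k Sg; rewrite (ip_scale2 _ _ mD (Sb m k) (Sb m k)) -expr2 sqr_circle_coef ipE//.
  have pi0 : pi != 0 :> R by rewrite gt_eqF// pi_gt0.
  case: m => [|m].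
    case: k.
      have -> : ipL2 D (base 0%N true) (base 0%N true) = 2 * pi.
        rewrite /ipL2 /base; under eq_Rintegral do rewrite mul0r cos0 mul1r.
        by rewrite Rintegral_cst_segment ?ltW// mul1r subr0.
      by rewrite mulVf ?mulr1// gt_eqF.
    have -> : base 0%N false = (fun=> 0).
      by apply/funext => x; rewrite /base mul0r sin0.
    by rewrite (si_sym si g) !(ip_zerol si)//; [rewrite !mulr0|exact: (si_zero si)].
  have -> : ipL2 D (base m.+1 k) (base m.+1 k) = pi.
    case: k; rewrite /base.
      by rewrite cos1 cos_sqr_integral// subr0 mulrC mulKf.
    by rewrite sin1 sin_sqr_integral// subr0 mulrC mulKf.
  by rewrite mulVf ?mulr1.
- move=> g Sg H; apply: circle_complete => // m.
    have := H m true; rewrite ipE// => /eqP; rewrite mulf_eq0 gt_eqF ?circle_coef_gt0//=.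
    by move/eqP.
  have := H m false; rewrite ipE// => /eqP; rewrite mulf_eq0 gt_eqF ?circle_coef_gt0//=.
  by move/eqP.
Qed.

End circle_system.

End trigonometric_systems.

(** * Topology of the spaces *)

Local Open Scope quotient_scope.

Section circle_topology.
Context {R : realType}.
Implicit Types (x y eta : R).

Lemma pi2_gt0 : 0 < 2 * pi :> R.
Proof. by rewrite mulr_gt0// pi_gt0. Qed.

Lemma to_circle_eq x y : (to_circle x = to_circle y) <-> circle_rel x y.
Proof. by split => [/eqmodP|H]; [|exact/eqmodP]. Qed.

Lemma circle_relP x y : reflect (exists z : int, x = y + z%:~R * (2 * pi)) (circle_rel x y).
Proof.
have p0 : 2 * pi != 0 :> R by rewrite gt_eqF// pi2_gt0.
apply: (iffP intrP) => -[z E]; exists z.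
  by rewrite -E divfK// addrC subrK.
by rewrite E addrAC subrr add0r mulfK.
Qed.

Definition angle_mod x : R := x - (Num.floor (x / (2 * pi)))%:~R * (2 * pi).

Lemma angle_mod_itv x : 0 <= angle_mod x < 2 * pi.
Proof.
have /andP[l u] := floor_itv (x / (2 * pi)).
rewrite /angle_mod subr_ge0 ltrBlDl -ler_pdivlMr ?pi2_gt0// l /=.
by move: u; rewrite ltr_pdivrMr ?pi2_gt0// intrD mulrDl mul1r.
Qed.

Lemma angle_mod_rel x : circle_rel (angle_mod x) x.
Proof.
apply/circle_relP; exists (- Num.floor (x / (2 * pi))).
by rewrite /angle_mod rmorphN mulNr.
Qed.

Lemma circle_rel_eq x y : 0 <= x < 2 * pi -> 0 <= y < 2 * pi -> circle_rel x y -> x = y.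
Proof.
move=> /andP[x0 x2] /andP[y0 y2] /circle_relP[z E].
have z0 : z = 0.
  apply/eqP; rewrite eq_le -!ltzD1 add0r -(ltr_int R) -[_ < z + 1](ltr_int R).
  rewrite intrD; apply/andP; split.
    by rewrite -(ltr_pM2r pi2_gt0) mul1r; lra.
  by rewrite -(ltr_pM2r pi2_gt0) mul0r mulrDl mul1r; lra.
by rewrite E z0 mul0r addr0.
Qed.

Lemma to_circle_continuous : continuous (@to_circle R).
Proof. exact: pi_continuous. Qed.

Lemma periodic_int (T : Type) (f : R -> T) : (forall x, f (x + 2 * pi) = f x) ->
  forall (z : int) x, f (x + z%:~R * (2 * pi)) = f x.
Proof.
move=> fp z x; case: z => n.
  elim: n => [|n IH]; first by rewrite mul0r addr0.
  by rewrite -addn1 PoszD intrD mulrDl mul1r addrA fp.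
rewrite NegzE; elim: n => [|n IH]; first by rewrite mulN1r -fp subrK.
by rewrite -IH -fp; congr f; rewrite !rmorphN/= -[n.+2]addn1 PoszD intrD; ring.
Qed.

Lemma periodic_rel (T : Type) (f : R -> T) : (forall x, f (x + 2 * pi) = f x) ->
  forall x y, circle_rel x y -> f x = f y.
Proof. by move=> fp x y /circle_relP[z ->]; exact: periodic_int. Qed.

Lemma circle_continuous (Z : topologicalType) (f : circle R -> Z) :
  continuous (fun eta => f (to_circle eta)) -> continuous f.
Proof. by move=> cf; apply/quotient_continuous. Qed.

Lemma periodic_within_continuous (f : R -> R) : (forall x, f (x + 2 * pi) = f x) ->
  {within `[0, 2 * pi], continuous f} -> continuous f.
Proof.
move=> fp /(continuous_within_itvP _ pi2_gt0) [ci cl cr].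
have shift (z : int) (x : R) : f @ (x - z%:~R * (2 * pi)) --> f (x - z%:~R * (2 * pi)) ->
    f @ x --> f x.
  have E y : f (y - z%:~R * (2 * pi)) = f y.
    by have := periodic_int fp (- z) y; rewrite rmorphN mulNr.
  rewrite E => H.
  have H2 : (fun y : R => y - z%:~R * (2 * pi)) @ x --> x - z%:~R * (2 * pi).
    by apply: cvgB; [exact: cvg_id|exact: cvg_cst].
  have := cvg_comp _ _ H2 H; rewrite (_ : f \o _ = f)//.
  by apply/funext => y; exact: E.
move=> x; apply: (shift (Num.floor (x / (2 * pi)))); rewrite -/(angle_mod x).
have /andP[] := angle_mod_itv x; rewrite le_eqVlt => /predU1P[<- _|x0 x2].
  apply/left_right_continuousP; split => //.
  (* Left continuity at 0 is left continuity at 2 pi, one period further. *)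
  apply/cvgrPdist_le => e e0.
  have /cvgrPdist_le/(_ e e0) := cr; rewrite -(fp 0) add0r => H.
  case: H => d /= d0 Hd; exists d => //= y; rewrite /ball/= sub0r normrN => yd y0.
  rewrite -(fp y); apply: Hd; last by rewrite -subr_gt0 opprD addrA addrAC subrr sub0r oppr_gt0.
  by rewrite /ball/= opprD addrA addrAC subrr sub0r normrN.
by apply: ci; rewrite in_itv/= x0.
Qed.

End circle_topology.

Section glue_topology.
Variables (X : topologicalType) (B : set X) (m : nat).

Lemma to_glue_eq x w x' w' : to_glue B (m := m) x w = to_glue B x' w' <->
  x = x' /\ (w = w' \/ B x).
Proof.
split.
  move=> /eqmodP; rewrite /= /glue_rel /= => /andP[/eqP-> /orP[/eqP ->|/asboolP H]].
    by split => //; left.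
  by split => //; right.
move=> [-> ww]; apply/eqmodP; rewrite /= /glue_rel /= eqxx /=.
by case: ww => [->|H]; rewrite ?eqxx//; apply/orP; right; apply/asboolP.
Qed.

Lemma to_glue_surj (z : glue B m) : exists x w, z = to_glue B x w.
Proof.
exists (repr (z : {eq_quot glue_equiv B m})).1, (repr (z : {eq_quot glue_equiv B m})).2.
by rewrite /to_glue -surjective_pairing reprK.
Qed.

Lemma to_glue_continuous w : continuous (fun x => to_glue B (m := m) x w).
Proof.
move=> x; apply: (@continuous_comp _ _ _ (fun x => (x, w) : X * discrete_topology 'I_m)
  (\pi_{eq_quot glue_equiv B m} : _ -> glue B m)).
  have H1 : (fun x : X => x) @ x --> x by exact: cvg_id.
  have H2 : (fun=> w : discrete_topology 'I_m) @ x --> (w : discrete_topology 'I_m).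
    exact: cvg_cst.
  exact: (cvg_pair H1 H2).
exact: pi_continuous.
Qed.

Lemma glue_continuous (Z : topologicalType) (f : glue B m -> Z) :
  (forall w, continuous (fun x => f (to_glue B x w))) -> continuous f.
Proof.
move=> cf; apply/quotient_continuous => -[x w] U /= fU.
have := cf w x U fU; rewrite nbhs_simpl /= => H.
exists ([set y | U (f (to_glue B y w))], [set w]) => /=.
  by split => //; exact: (@discrete_set1 (discrete_topology 'I_m)).
by move=> [y v] /= [Uy ->].
Qed.

End glue_topology.

Section diamond_topology.
Context {R : realType} (P : diamond_params).
Local Notation F := (diamond R P).
Local Notation pt := (@diamond_point R P _).

Definition diamond_angle i : F i -> circle R := projT2 (space_angle R P i).

Lemma diamond_angleE i eta (w : word P i) : diamond_angle (pt eta w) = to_circle eta.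
Proof.
by elim: i w => [//|i IH] w; rewrite /diamond_angle /= glue_fstE -[RHS](IH w.1).
Qed.

Lemma diamond_point_rel i (w : word P i) eta eta' : circle_rel eta eta' -> pt eta w = pt eta' w.
Proof.
move=> H; elim: i w => [|i IH] w /=; first exact/to_circle_eq.
by rewrite IH.
Qed.

Lemma diamond_point_periodic i (w : word P i) eta : pt (eta + 2 * pi) w = pt eta w.
Proof.
apply: diamond_point_rel; apply/circle_relP; exists 1.
by rewrite mul1r.
Qed.

Lemma diamond_point_surj i (x : F i) :
  exists eta (w : word P i), 0 <= eta < 2 * pi /\ x = pt eta w.
Proof.
elim: i x => [|i IH] x.
  exists (angle_mod (repr (x : {eq_quot circle_equiv R}))), tt.
  split; first exact: angle_mod_itv.
  rewrite /= (iffRL (to_circle_eq _ _) (angle_mod_rel _)).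
  by rewrite /to_circle reprK.
have [y [a ->]] := to_glue_surj x.
have [eta [w [eta02 ->]]] := IH y.
by exists eta, (w, a).
Qed.

Definition grid_angle i (k : nat) : R := pi * k%:R / (Jprod P i)%:R.

Lemma JprodS i : Jprod P i.+1 = (Jprod P i * jpar P i.+1)%N.
Proof. by rewrite /Jprod big_nat_recr. Qed.

Lemma NprodS i : Nprod P i.+1 = (Nprod P i * npar P i.+1)%N.
Proof. by rewrite /Nprod big_nat_recr. Qed.

Lemma Nprod_gt0 i : (0 < Nprod P i)%N.
Proof. by elim: i => [|i IH]; [by rewrite /Nprod big_nil|rewrite NprodS muln_gt0 IH npar_gt0]. Qed.

Lemma Jprod_neq0 i : (Jprod P i)%:R != 0 :> R.
Proof. by rewrite pnatr_eq0 -lt0n Jprod_gt0. Qed.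

Lemma grid_angleS i k : grid_angle i k = grid_angle i.+1 (k * jpar P i.+1).
Proof.
rewrite /grid_angle JprodS !natrM; have J0 := Jprod_neq0 i.
have j0 : (jpar P i.+1)%:R != 0 :> R.
  by rewrite pnatr_eq0 -lt0n (leq_trans _ (jpar_ge2 P _)).
by field; rewrite J0 j0.
Qed.

Lemma vartheta_grid i eta : vartheta_upto P i eta -> exists k, eta = grid_angle i k.
Proof.
move=> [l li]; have {li} [d ->] : exists d, i = (l + d)%N.
  by exists (i - l)%N; rewrite subnKC.
elim: d => [|d IH] H.
  rewrite addn0; case: l H => [|l].
    move=> [->|->]; [exists 0%N|exists 1%N]; rewrite /grid_angle /Jprod big_nil.
      by rewrite mulr0 mul0r.
    by rewrite divr1 mulr1.
  by move=> [k [_ _ ->]]; exists k.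
by have [k ->] := IH H; rewrite addnS; eexists; exact: grid_angleS.
Qed.

(** If j_(i+1) divides [k], the angle already belongs to the coarser grid; otherwise it is in
    [vartheta] of the last level by definition. *)
Lemma grid_vartheta i k : (k < 2 * Jprod P i)%N -> vartheta_upto P i (grid_angle i k).
Proof.
elim: i k => [|i IH] k.
  rewrite /Jprod big_nil muln1; case: k => [|[|//]] _; exists 0%N => //=.
    by left; rewrite /grid_angle mulr0 mul0r.
  by right; rewrite /grid_angle /Jprod big_nil mulr1 divr1.
move=> k2; have [/dvdnP[k' kE]|nd] := boolP (jpar P i.+1 %| k)%N.
  have j0 : (0 < jpar P i.+1)%N by rewrite (leq_trans _ (jpar_ge2 P _)).
  rewrite kE -grid_angleS; have [|l li H] := IH k'.
    by move: k2; rewrite kE JprodS mulnA ltn_pmul2r.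
  by exists l => //; exact: leq_trans li _.
exists i.+1 => //=; exists k; split => //.
by rewrite k2 andbT lt0n; apply: contra nd => /eqP ->; rewrite dvdn0.
Qed.

Lemma grid_angle_rel i k : circle_rel (grid_angle i k) (grid_angle i (k %% (2 * Jprod P i))).
Proof.
apply/circle_relP; exists (k %/ (2 * Jprod P i))%N.
rewrite {1}(divn_eq k (2 * Jprod P i)) /grid_angle natrD !natrM.
by field; exact: Jprod_neq0.
Qed.

Lemma diamond_point_glued i (w : word P i) a b k :
  pt (grid_angle i.+1 k) ((w, a) : word P i.+1) = pt (grid_angle i.+1 k) ((w, b) : word P i.+1).
Proof.
apply/to_glue_eq; split => //; right; exists (grid_angle i.+1 (k %% (2 * Jprod P i.+1))).
  by apply: grid_vartheta; rewrite ltn_mod double_Jprod_gt0.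
rewrite -/(diamond_angle _) diamond_angleE; apply/to_circle_eq; exact: grid_angle_rel.
Qed.

Lemma diamond_point_inj i (w w' : word P i) eta eta' : pt eta w = pt eta' w' ->
  circle_rel eta eta' /\ (w = w' \/ exists k, circle_rel eta (grid_angle i k)).
Proof.
move=> E; split.
  by apply/to_circle_eq; rewrite -(diamond_angleE eta w) E diamond_angleE.
elim: i w w' E => [|i IH] w w'; first by case: w; case: w'; left.
move: w w' => [w a] [w' a'] /to_glue_eq /= [E ab].
have [->|[k H]] := IH _ _ E; last first.
  (* Points identified at a lower level lie at an angle of the coarser grid, which is contained in
     the finer one. *)
  by right; exists (k * jpar P i.+1)%N; rewrite -grid_angleS.
case: ab => [->|]; first by left.
move=> [eta0 /vartheta_grid[k ->]]; rewrite -/(diamond_angle _) diamond_angleE => H.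
by right; exists k; apply/to_circle_eq.
Qed.

(** With the angle restricted to one period it is determined by the point, so the only compatibility
    left is between different words at the same angle. *)
Lemma diamond_descend (V : Type) i (v : word P i -> R -> V) :
  (forall w w' eta, 0 <= eta < 2 * pi -> pt eta w = pt eta w' -> v w eta = v w' eta) ->
  exists f : F i -> V, forall w eta, 0 <= eta < 2 * pi -> f (pt eta w) = v w eta.
Proof.
move=> H; have ex (x : F i) : exists z : R * word P i, 0 <= z.1 < 2 * pi /\ x = pt z.1 z.2.
  by have [eta [w [? ?]]] := diamond_point_surj x; exists (eta, w).
exists (fun x => v (sval (cid (ex x))).2 (sval (cid (ex x))).1) => w eta eta02.
case: (cid _) => -[eta' w'] /= [eta02' E].
have [rel _] := diamond_point_inj E.
by move: E; rewrite -(circle_rel_eq eta02 eta02' rel) => E; apply: H.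
Qed.

Lemma diamond_point_continuous i (w : word P i) : continuous (fun eta => pt eta w).
Proof.
elim: i w => [|i IH] w; first exact: to_circle_continuous.
move=> eta; apply: (@continuous_comp _ _ _ (fun eta => pt eta w.1)
  (fun x : F i => to_glue _ x w.2)); first exact: IH.
exact: to_glue_continuous.
Qed.

Lemma diamond_continuousP (Z : topologicalType) i (f : F i -> Z) :
  continuous f <-> forall w : word P i, continuous (fun eta => f (pt eta w)).
Proof.
split.
  move=> cf w eta; apply: (@continuous_comp _ _ _ (fun eta => pt eta w) f).
    exact: diamond_point_continuous.
  exact: cf.
elim: i f => [|i IH] f H; first exact: circle_continuous (H tt).
by apply: glue_continuous => a; apply: IH => w; exact: (H (w, a)).
Qed.

(** A finite union of continuous images of a segment. Compactness provides the uniformity in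
    [kernel_inner_continuous]. *)
Lemma diamond_compact i : compact [set: F i].
Proof.
have -> : [set: F i] = \bigcup_(w in [set` index_enum (word P i)]) ((fun eta => pt eta w) @` `[0, 2 * pi]).
  apply/seteqP; split => // x _.
  have [eta [w [/andP[e0 e2] ->]]] := diamond_point_surj x.
  exists w; first by rewrite /= mem_index_enum.
  by exists eta => //=; rewrite in_itv/= e0 ltW.
rewrite bigcup_seq; apply: bigsetU_compact => w _; apply: continuous_compact; last exact: segment_compact.
by apply: continuous_subspaceT => eta; apply: diamond_point_continuous.
Qed.

End diamond_topology.

(** * Functions on the spaces and their lifts to the line *)

Section lifts.
Context {R : realType} (P : diamond_params) (i : nat).
Local Notation lambda := (@lebesgue_measure R).
Local Notation F := (diamond R P i).
Local Notation L := (cell_length R P i).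
Local Notation pt := (@diamond_point R P i).
Local Notation grid := (@grid_angle R P i).
Local Notation N := (Nprod P i).
Implicit Types (f g h : F -> R) (w : word P i) (a : cell_index P i).

(** The function read along the closed curve obtained by keeping the word and turning the angle.
    Working on whole periods instead of cells removes the matching conditions at the ends of
    cells. *)
Definition lift f w : R -> R := fun eta => f (pt eta w).

Definition cell f a : R -> R := fun s => f (cell_map a s).

Lemma cellE f a s : cell f a s = lift f a.2 (grid a.1 + s).
Proof. by []. Qed.

Lemma cell_length_gt0 : 0 < L.
Proof. by rewrite /cell_length divr_gt0 ?pi_gt0// ltr0n Jprod_gt0. Qed.

Lemma grid_angle0 : grid 0 = 0.
Proof. by rewrite /grid_angle mulr0 mul0r. Qed.

Lemma grid_angle_succ k : grid k.+1 = grid k + L.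
Proof. by rewrite /grid_angle /cell_length -natr1 mulrDr mulr1 mulrDl. Qed.

Lemma grid_angle_last : grid (2 * Jprod P i) = 2 * pi.
Proof. by rewrite /grid_angle natrM mulrA mulfK ?Jprod_neq0// mulrC. Qed.

Lemma grid_angle_le k l : (k <= l)%N -> grid k <= grid l.
Proof.
move=> kl; rewrite /grid_angle ler_wpM2r ?invr_ge0// ler_wpM2l ?pi_ge0// ler_nat//.
Qed.

Lemma grid_angle_ge0 k : 0 <= grid k.
Proof. by rewrite -grid_angle0 grid_angle_le. Qed.

Lemma grid_angle_le2pi (k : 'I_(2 * Jprod P i)) : grid k + L <= 2 * pi.
Proof. by rewrite -grid_angle_succ -grid_angle_last grid_angle_le. Qed.

Lemma Rintegral_grid (u : R -> R) : lambda.-integrable `[0, 2 * pi] (EFin \o u) ->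
  \int[lambda]_(s in `[0, 2 * pi]) u s =
  \sum_(k < 2 * Jprod P i) \int[lambda]_(s in `[0, L]) u (grid k + s).
Proof.
move=> ui; suff H K : (K <= 2 * Jprod P i)%N ->
    \int[lambda]_(s in `[0, grid K]) u s =
    \sum_(k < K) \int[lambda]_(s in `[0, L]) u (grid k + s).
  by rewrite -grid_angle_last H.
elim: K => [|K IH] K2; first by rewrite grid_angle0 Rintegral_point big_ord0.
have K2' := leq_trans (leqnSn K) K2.
have gK : grid K.+1 <= 2 * pi by rewrite -grid_angle_last grid_angle_le.
have i1 : lambda.-integrable `[0, grid K.+1] (EFin \o u) by exact: integrable_subsegment ui.
rewrite (@Rintegral_split R 0 (grid K)) ?grid_angle_ge0 ?grid_angle_le// IH//.
rewrite big_ord_recr/=; congr (_ + _).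
have := @Rintegral_shift R 0 L (grid K) u; rewrite addr0 -grid_angle_succ; apply.
exact: integrable_subsegment (grid_angle_ge0 K) gK ui.
Qed.

Lemma sqint_grid (u : R -> R) :
  (forall k : 'I_(2 * Jprod P i), sqint `[0, L] (fun s => u (grid k + s))) <->
  sqint `[0, 2 * pi] u.
Proof.
split=> [H|H k]; last first.
  apply: sqint_shift; rewrite addr0.
  by apply: sqint_sub H; [exact: grid_angle_ge0|exact: grid_angle_le2pi].
rewrite -grid_angle_last.
have : (2 * Jprod P i <= 2 * Jprod P i)%N by [].
move: {1 3}(2 * Jprod P i)%N => K; elim: K => [|K IH] K2.
  rewrite grid_angle0; split; first by rewrite set_itv1; exact: measurable_fun_set1.
  by rewrite set_itv1; apply/integrableP; split; [exact: measurable_fun_set1|rewrite integral_set1 ltry].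
apply: (@sqint_glue _ _ (grid K)); rewrite ?grid_angle_ge0 ?grid_angle_le//.
  by apply: IH; exact: leq_trans K2.
have := sqint_unshift (H (Ordinal K2)).
by rewrite /= addr0 -grid_angle_succ.
Qed.

Lemma mu_L2_lift f : mu_L2 f <-> forall w, sqint `[0, 2 * pi] (lift f w).
Proof.
split=> [H w|H a].
  by apply/sqint_grid => k; exact: (H (k, w)).
by have /sqint_grid/(_ a.1) := H a.2.
Qed.

Lemma semi_inner_mu : semi_inner (@mu_L2 R P i) (@mu_inner R P i).
Proof.
have mI := segment_measurable 0 L; have si := semi_inner_ipL2 mI.
split.
- by move=> c f g Sf Sg a; exact: (si_lin si c (Sf a) (Sg a)).
- by move=> a; exact: (si_zero si).
- by move=> f g; apply: eq_bigr => a _; congr (_ * _); exact: (si_sym si).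
- move=> c f g h Sf Sg Sh; rewrite /mu_inner /mu_integral big_distrr -big_split.
  apply: eq_bigr => a _ /=; rewrite mulrCA -mulrDr; congr (_ * _).
  exact: (si_linl si c (Sf a) (Sg a) (Sh a)).
- move=> f; apply: sumr_ge0 => a _; rewrite mulr_ge0 ?invr_ge0//.
  exact: (si_ge0 si (cell f a)).
Qed.

Lemma mu_inner_lift f g : mu_L2 f -> mu_L2 g ->
  mu_inner f g = N%:R^-1 * \sum_w ipL2 `[0, 2 * pi] (lift f w) (lift g w).
Proof.
move=> /mu_L2_lift Sf /mu_L2_lift Sg.
rewrite /mu_inner /mu_integral -big_distrr /=; congr (_ * _).
rewrite -(pair_bigA _ (fun k w => \int[lambda]_(s in `[0, L])
   (f (cell_map (k, w) s) * g (cell_map (k, w) s)))) /= exchange_big.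
apply: eq_bigr => w _; rewrite /ipL2 Rintegral_grid//.
by apply: sqint_mul; [exact: segment_measurable|exact: Sf|exact: Sg].
Qed.

Lemma mu_ae_eq_norm f g : mu_L2 f -> mu_L2 g ->
  mu_ae_eq f g <-> mu_norm2 (fun x => f x - g x) = 0.
Proof.
move=> Sf Sg; have mI := segment_measurable 0 L.
have Sfg a : sqint `[0, L] (cell (fun x => f x - g x) a).
  exact: (si_sub (semi_inner_ipL2 mI) (Sf a) (Sg a)).
have N0 : N%:R^-1 != 0 :> R by rewrite invr_eq0 pnatr_eq0 -lt0n Nprod_gt0.
split.
  move=> fg; apply: big1 => a _.
  rewrite (_ : Rintegral _ _ _ = 0) ?mulr0//.
  rewrite -[LHS]/(ipL2 `[0, L] (cell (fun x => f x - g x) a) (cell (fun x => f x - g x) a)).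
  have Z : {ae lambda, forall s, `[0, L]%classic s -> cell (fun x => f x - g x) a s = 0}.
    by apply: ae_lebesgueS (fg a) => s H; rewrite /= in_itv/= => /H; rewrite /cell => ->; rewrite subrr.
  rewrite (ipL2_ae mI (Sfg a) (Sfg a) (si_zero (semi_inner_ipL2 mI)) (si_zero (semi_inner_ipL2 mI)) Z Z).
  by rewrite (ip_zerol (semi_inner_ipL2 mI))//; exact: (si_zero (semi_inner_ipL2 mI)).
move=> H a; have ge0 b : 0 <= N%:R^-1 * ipL2 `[0, L] (cell (fun x => f x - g x) b)
    (cell (fun x => f x - g x) b).
  by rewrite mulr_ge0 ?invr_ge0//; exact: (si_ge0 (semi_inner_ipL2 mI)).
have /eqP := H; rewrite psumr_eq0; last by move=> b _; exact: ge0.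
move=> /allP/(_ a (mem_index_enum _)); rewrite /= mulf_eq0 (negbTE N0)/= => /eqP.
move=> /(ipL2_eq0 mI (Sfg a)); apply: ae_lebesgueS => s + s0L.
by rewrite /= in_itv/= => /(_ s0L)/eqP; rewrite subr_eq0 => /eqP.
Qed.

Lemma continuous_cell f a : continuous f -> continuous (cell f a).
Proof.
move=> /diamond_continuousP cf s.
apply: (@continuous_comp _ _ _ (fun s => grid a.1 + s) (lift f a.2)); last exact: cf.
by apply: cvgD; [exact: cvg_cst|exact: cvg_id].
Qed.

Lemma continuous_mu_L2 f : continuous f -> mu_L2 f.
Proof. by move=> cf a; exact: continuous_sqint (@continuous_cell f a cf). Qed.

Definition mu_mass : R := \sum_(a : cell_index P i) N%:R^-1 * L.

Lemma mu_mass_ge0 : 0 <= mu_mass.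
Proof. by apply: sumr_ge0 => a _; rewrite mulr_ge0 ?invr_ge0// ltW// cell_length_gt0. Qed.

Lemma mu_norm2_bounded f M : mu_L2 f -> (forall x, `|f x| <= M) ->
  mu_inner f f <= M ^+ 2 * mu_mass.
Proof.
move=> Sf fM; have M0 : 0 <= M by exact: le_trans (normr_ge0 _) (fM (pt 0 (word0 P i))).
rewrite /mu_mass big_distrr; apply: ler_sum => a _ /=.
rewrite mulrCA ler_wpM2l ?invr_ge0//.
have -> : M ^+ 2 * L = \int[lambda]_(s in `[0, L]) (M ^+ 2).
  by rewrite Rintegral_cst_segment ?subr0// ltW// cell_length_gt0.
apply: le_Rintegral => //.
- by apply: sqint_mul; [exact: segment_measurable|exact: Sf|exact: Sf].
- by apply: integrable_continuous => x; exact: cvg_cst.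
- by move=> s _; rewrite -expr2 -real_normK ?num_real// lerXn2r ?nnegrE.
Qed.

Lemma seminorm_uniform f M : mu_L2 f -> (forall x, `|f x| <= M) ->
  seminorm (@mu_inner R P i) f <= M * Num.sqrt mu_mass.
Proof.
move=> Sf fM; have M0 : 0 <= M by exact: le_trans (normr_ge0 _) (fM (pt 0 (word0 P i))).
apply: (seminorm_le semi_inner_mu); first by rewrite mulr_ge0 ?sqrtr_ge0.
by rewrite exprMn sqr_sqrtr ?mu_mass_ge0// mu_norm2_bounded.
Qed.

(** The derivatives on successive cells are glued into one over the whole period. Nothing has to be
    matched at the joints, since the lift is a single function that has a value there. *)
Lemma form_dom_lift f : form_dom f <->
  continuous f /\ exists df : word P i -> R -> R, forall w, acd 0 (2 * pi) (lift f w) (df w).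
Proof.
have L0 := ltW cell_length_gt0.
split=> [[cf H]|[cf [df H]]]; split => //; last first.
  move=> a; exists (fun s => df a.2 (grid a.1 + s)).
  apply: (@acd_shift R 0 L (grid a.1) (lift f a.2) (df a.2) L0); rewrite addr0.
  apply: acd_sub (H a.2); rewrite ?grid_angle_ge0 ?lerDl//.
  exact: grid_angle_le2pi.
suff K w : exists df, acd 0 (2 * pi) (lift f w) df.
  by exists (fun w => sval (cid (K w))) => w; exact: svalP (cid (K w)).
rewrite -grid_angle_last.
have : (2 * Jprod P i <= 2 * Jprod P i)%N by [].
move: {1 3}(2 * Jprod P i)%N => K; elim: K => [|K IH] K2.
  exists (fun=> 0); rewrite grid_angle0; split.
    by apply: continuous_sqint => x; exact: cvg_cst.
  by move=> s /le_anti <-; rewrite Rintegral_point addr0.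
have [g1 H1] := IH (leq_trans (leqnSn K) K2).
have [g2 H2] := H (Ordinal K2, w).
have := @acd_unshift R 0 L (grid K) (lift f w) g2 L0 H2; rewrite /= addr0 -grid_angle_succ => H3.
by eexists; apply: acd_glue H1 H3; rewrite ?grid_angle_ge0 ?grid_angle_le.
Qed.

(** The form may be computed from any derivatives: on each cell [itv_weak_deriv] is a derivative,
    because one exists, and two derivatives agree a.e. *)
Lemma formE f g (df dg : word P i -> R -> R) :
  (forall w, acd 0 (2 * pi) (lift f w) (df w)) ->
  (forall w, acd 0 (2 * pi) (lift g w) (dg w)) ->
  form f g = N%:R^-1 * \sum_w ipL2 `[0, 2 * pi] (df w) (dg w).
Proof.
move=> Hf Hg; have mI := segment_measurable 0 L; have L0 := ltW cell_length_gt0.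
rewrite /form -big_distrr /=; congr (_ * _).
rewrite -(pair_bigA _ (fun k w => \int[lambda]_(s in `[0, L])
  (itv_weak_deriv L (cell f (k, w)) s * itv_weak_deriv L (cell g (k, w)) s))) /= exchange_big.
apply: eq_bigr => w _; rewrite /ipL2 Rintegral_grid; last first.
  by apply: sqint_mul; [exact: segment_measurable|exact: (Hf w).1|exact: (Hg w).1].
apply: eq_bigr => k _.
have key u (du : word P i -> R -> R) : (forall w, acd 0 (2 * pi) (lift u w) (du w)) ->
    sqint `[0, L] (itv_weak_deriv L (cell u (k, w))) /\
    sqint `[0, L] (fun s => du w (grid k + s)) /\
    {ae lambda, forall s, `[0, L]%classic s ->
      itv_weak_deriv L (cell u (k, w)) s = du w (grid k + s)}.
  move=> H; have H1 : acd 0 L (cell u (k, w)) (fun s => du w (grid k + s)).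
    apply: (@acd_shift R 0 L (grid k) (lift u w) (du w) L0); rewrite addr0.
    apply: acd_sub (H w); rewrite ?grid_angle_ge0 ?lerDl//.
    exact: grid_angle_le2pi.
  have H2 : acd 0 L (cell u (k, w)) (itv_weak_deriv L (cell u (k, w))).
    rewrite /itv_weak_deriv; case: xgetP => [v _ //|H0].
    by case: (H0 _ H1).
  by split; [exact: H2.1|split; [exact: H1.1|exact: acd_ae_unique H2 H1]].
have [S1 [S2 E12]] := key f df Hf; have [S3 [S4 E34]] := key g dg Hg.
exact: (ipL2_ae mI S1 S3 S2 S4 E12 E34).
Qed.

Lemma cell_locate eta : 0 <= eta < 2 * pi ->
  exists k : 'I_(2 * Jprod P i), grid k <= eta < grid k + L.
Proof.
move=> /andP[eta0]; rewrite -grid_angle_last.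
have : (2 * Jprod P i <= 2 * Jprod P i)%N by [].
move: {1 3}(2 * Jprod P i)%N => K; elim: K => [|K IH] K2.
  by rewrite grid_angle0 ltNge eta0.
have [eK _|Ke] := ltP eta (grid K); first exact: IH (leq_trans (leqnSn K) K2) eK.
by rewrite grid_angle_succ => eK; exists (Ordinal K2); rewrite Ke.
Qed.

(** Every point has coordinates in a half-open cell, hence room to its right within the cell. If the
    difference were nonzero there, it would be nonzero on an interval of positive length. *)
Lemma mu_ae_eq_continuous f g : continuous f -> continuous g -> mu_ae_eq f g ->
  forall x, f x = g x.
Proof.
move=> cf cg fg x.
pose h y := f y - g y; have ch : continuous h by move=> y; apply: cvgB; [exact: cf|exact: cg].
apply/eqP; rewrite -subr_eq0 -[_ - _]/(h x); apply/negPn/negP => hx.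
have [eta [w [eta02 E]]] := diamond_point_surj x.
have [k /andP[kle klt]] := cell_locate eta02.
pose th := eta - grid k; have thE : eta = grid k + th by rewrite addrC subrK.
have th0 : 0 <= th by rewrite subr_ge0.
have thL : th < L by rewrite ltrBlDl.
have cth := @continuous_cell h (k, w) ch th.
have hth : cell h (k, w) th != 0 by rewrite cellE /= -thE /lift -E.
have n0 : 0 < `|cell h (k, w) th| by rewrite normr_gt0.
have /nbhs_ballP[d /= d0 Hd] : \forall s \near th, cell h (k, w) s != 0.
  have /cvgrPdist_lt/(_ _ n0) := cth; apply: filterS => s.
  by apply: contraTneq => ->; rewrite subr0 ltxx.
pose e := Num.min d (L - th); have e0 : 0 < e by rewrite lt_min d0 subr_gt0.
have [M [mM M0 HM]] := fg (k, w).
pose I := (`]th, th + e[%classic : set R).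
have sub : I `<=` M.
  move=> s; rewrite /I /= in_itv/= => /andP[s1 s2]; apply: HM => /= K.
  have sd : s < th + d by rewrite (lt_le_trans s2)// lerD2l ge_min lexx.
  have sL : s < L by rewrite (lt_le_trans s2)// -lerBrDl ge_min lexx orbT.
  have := Hd s; rewrite /ball/= ltr_distlC => H0.
  have {}H0 : cell h (k, w) s != 0.
    by apply: H0; rewrite (lt_trans _ s1) ?gtrBl.
  move: H0; rewrite /cell /h K ?subrr ?eqxx//.
  by rewrite (le_trans th0 (ltW s1)) ltW.
have I0 : lambda I = 0%E.
  apply: measure_negligible; first exact: (@measurable_itv R `]th, th + e[).
  by exists M.
have := lexx (lambda I); rewrite {2}I0 /I /= lebesgue_measure_itv/= lte_fin ltrDl e0 -EFinD addrAC subrr add0r.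
by rewrite lee_fin leNgt e0.
Qed.

End lifts.

(** * Parseval frames of eigenfunctions *)

Section heat_weights.
Context {R : realType}.
Implicit Types (t M : R) (c m : nat).

Definition heat_weight c m t : R := expR (- ((c * m)%:R ^+ 2 * t)).

(** As (c m)^2 >= m, one geometric series dominates all base frequencies at once. *)
Lemma heat_weight_le_geometric c m t : 0 <= t -> (0 < c)%N -> heat_weight c m t <= expR (- t) ^+ m.
Proof.
move=> t0 c0; rewrite -expRM_natl ler_expR mulrN lerN2 ler_wpM2r//.
rewrite -natrX ler_nat expnMn -[leqLHS]mul1n.
by apply: leq_mul; rewrite ?expn_gt0 ?c0//; case: m => // m; rewrite -mulnn leq_pmull.
Qed.

Lemma heat_series_cvg (u : nat -> R) M c t : (0 < c)%N -> 0 < t ->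
  (forall m, `|u m| <= M) -> cvgn (series (fun m => heat_weight c m t * u m)).
Proof.
move=> c0 t0 uM; apply: normed_cvg.
have q0 : 0 < expR (- t) by exact: expR_gt0.
apply: (@series_le_cvg _ _ (geometric M (expR (- t)))).
- by move=> n /=.
- by move=> n; rewrite /geometric /= mulr_ge0 ?exprn_ge0 ?(ltW q0)//; exact: le_trans (uM 0%N).
- move=> n; rewrite /geometric /= normrM mulrC [`|heat_weight _ _ _|]ger0_norm; last exact: expR_ge0.
  apply: ler_pM; rewrite ?expR_ge0//.
  by apply: heat_weight_le_geometric => //; exact: ltW.
- by apply: is_cvg_geometric_series; rewrite ger0_norm ?ltW// -expR0 ltr_expR oppr_lt0.
Qed.

Lemma series_recl (u : nat -> R) (l : R) : series (fun m => u m.+1) @ \oo --> l ->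
  series u @ \oo --> u 0%N + l.
Proof.
move=> H; rewrite -cvg_shiftS.
rewrite (_ : (fun n => series u n.+1) = (fun n => u 0%N + series (fun m => u m.+1) n)); last first.
  by apply/funext => n; rewrite /series /= big_nat_recl.
by apply: cvgD => //; exact: cvg_cst.
Qed.

Lemma circle_kernel_cvg t a b : 0 < t ->
  series (fun m => heat_weight 1 m t * (circle_coef m ^+ 2 * cos (m%:R * (b - a))))
    @ \oo --> circle_kernel t a b.
Proof.
move=> t0; have -> : circle_kernel t a b =
    heat_weight 1 0 t * (circle_coef 0 ^+ 2 * cos (0%:R * (b - a))) +
    pi^-1 * limn (series (fun k : nat => expR (- (k.+1%:R ^+ 2) * t) * cos (k.+1%:R * (b - a)))).
  rewrite /circle_kernel sqr_circle_coef !mul0r cos0 /heat_weight muln0 expr2 !mul0r oppr0 expR0.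
  by rewrite !mul1r mulr1.
apply: series_recl.
have -> : series (fun m => heat_weight 1 m.+1 t * (circle_coef m.+1 ^+ 2 * cos (m.+1%:R * (b - a)))) =
    (fun n => pi^-1 * series (fun k : nat => expR (- (k.+1%:R ^+ 2) * t) * cos (k.+1%:R * (b - a))) n).
  apply/funext => n; rewrite /series /= big_distrr; apply: eq_bigr => m _ /=.
  by rewrite sqr_circle_coef /heat_weight mul1n mulNr; ring.
apply: cvgMr => //.
(* Since (m + 1)^2 = m^2 + 2m + 1, the series that starts at 1 is of the previous kind, with the
   factor exp(- (2m + 1) t) put into the bounded sequence. *)
have := @heat_series_cvg (fun m => expR (- ((2 * m + 1)%:R * t)) * cos (m.+1%:R * (b - a))) 1 1 t isT t0 _.
rewrite (_ : series _ = series (fun k : nat => expR (- (k.+1%:R ^+ 2) * t) * cos (k.+1%:R * (b - a)))).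
  apply => m; rewrite normrM ger0_norm ?expR_ge0// -[leRHS]mulr1 ler_pM ?expR_ge0//.
    by rewrite -expR0 ler_expR oppr_le0 mulr_ge0// ltW.
  by rewrite ler_norml cos_geN1 cos_le1.
congr series; apply/funext => m; rewrite mulrA -expRD; congr (expR _ * _).
by rewrite mul1n natrD natrM -natr1; ring.
Qed.

(** cos(A - B) - cos(A + B) = 2 sin A sin B, and the constant terms cancel. The time J^2 t turns
    frequency m on the circle into frequency J m on the cell. *)
Lemma circle_kernel_diff_cvg t (J : nat) a b : 0 < t -> (0 < J)%N ->
  series (fun m => heat_weight J m t *
     (2 / pi * (sin (m%:R * (J%:R * a)) * sin (m%:R * (J%:R * b)))))
    @ \oo --> circle_kernel (J%:R ^+ 2 * t) (J%:R * a) (J%:R * b) -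
             circle_kernel (J%:R ^+ 2 * t) (J%:R * a) (- (J%:R * b)).
Proof.
move=> t0 J0; have Jt : 0 < J%:R ^+ 2 * t by rewrite mulr_gt0// exprn_gt0// ltr0n.
have -> : series (fun m => heat_weight J m t *
     (2 / pi * (sin (m%:R * (J%:R * a)) * sin (m%:R * (J%:R * b))))) =
  (fun n => series (fun m => heat_weight 1 m (J%:R ^+ 2 * t) *
      (circle_coef m ^+ 2 * cos (m%:R * (J%:R * b - J%:R * a)))) n -
    series (fun m => heat_weight 1 m (J%:R ^+ 2 * t) *
      (circle_coef m ^+ 2 * cos (m%:R * (- (J%:R * b) - J%:R * a)))) n); last first.
  by apply: cvgB; exact: circle_kernel_cvg.
apply/funext => n; rewrite /series /= -sumrB; apply: eq_bigr => m _.
symmetry; rewrite /heat_weight mul1n (_ : (m%:R ^+ 2 * (J%:R ^+ 2 * t)) = (J * m)%:R ^+ 2 * t); last first.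
  by rewrite natrM; ring.
rewrite -mulrBr; congr (_ * _); rewrite sqr_circle_coef; case: m => [|m].
  by rewrite !mul0r sin0 mul0r mulr0 subrr.
rewrite (_ : m.+1%:R * (- (J%:R * b) - J%:R * a) =
  - (m.+1%:R * (J%:R * b) + m.+1%:R * (J%:R * a))); last by ring.
rewrite cosN mulrBr cosB cosD; ring.
Qed.

End heat_weights.

Section spectral_frames.
Context {R : realType} (P : diamond_params).

(* [phi m k] is an eigenfunction for (c k * m)^2; it may be null, and the family
   need not be free. *)
Record spectral_frame (i : nat) (K : finType) (c : K -> nat)
    (phi : nat -> K -> diamond R P i -> R) : Prop := {
  frame_freq_gt0 : forall k, (0 < c k)%N;
  frame_dom : forall m k, form_dom (phi m k);
  frame_bounded : exists M, forall m k x, `|phi m k x| <= M;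
  frame_eigen : forall m k g, form_dom g ->
    form (phi m k) g = (c k * m)%:R ^+ 2 * mu_inner (phi m k) g;
  frame_parseval : forall f, mu_L2 f ->
    series (fun m => \sum_k mu_inner f (phi m k) ^+ 2) @ \oo --> mu_norm2 f;
  frame_kernel : forall t x y, 0 < t ->
    series (fun m => \sum_k heat_weight (c k) m t * (phi m k x * phi m k y))
      @ \oo --> diamond_kernel t x y;
  frame_solve : forall h, mu_L2 h -> (forall k, mu_inner h (phi 0%N k) = 0) ->
    exists2 u, form_dom u & forall g, form_dom g -> form u g = mu_inner h g }.

End spectral_frames.

Section lift_domains.
Context {R : realType} (P : diamond_params) (i : nat).
Local Notation lambda := (@lebesgue_measure R).
Local Notation F := (diamond R P i).
Local Notation grid := (@grid_angle R P i).

Lemma lift_periodic (f : F -> R) w (x : R) : lift f w (x + 2 * pi) = lift f w x.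
Proof. by rewrite /lift diamond_point_periodic. Qed.

Lemma lift_last (f : F -> R) w : lift f w (2 * pi) = lift f w 0.
Proof. by rewrite -[2 * pi]add0r lift_periodic. Qed.

(** Continuity comes with absolute continuity: each lift is continuous on a closed period and
    periodic, and continuity on the quotient is tested on lifts. *)
Lemma acd_form_dom (f : F -> R) df : (forall w, acd 0 (2 * pi) (lift f w) (df w)) -> form_dom f.
Proof.
move=> H; apply/form_dom_lift; split; last by exists df.
apply/diamond_continuousP => w; apply: periodic_within_continuous.
  by move=> x; exact: lift_periodic.
exact: acd_within_continuous (ltW pi2_gt0) (H w).
Qed.

Lemma Rintegral_cells (u : R -> R) : lambda.-integrable `[0, 2 * pi] (EFin \o u) ->
  \int[lambda]_(s in `[0, 2 * pi]) u s =
  \sum_(k < 2 * Jprod P i) \int[lambda]_(s in `[grid k, grid k.+1]) u s.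
Proof.
move=> ui; rewrite (@Rintegral_grid R P i)//; apply: eq_bigr => k _.
have := @Rintegral_shift R 0 (cell_length R P i) (grid k) u; rewrite addr0 -grid_angle_succ => -> //.
apply: integrable_subsegment ui; first exact: grid_angle_ge0.
by rewrite grid_angle_succ; exact: grid_angle_le2pi.
Qed.

End lift_domains.

(** * The frame of the circle *)

Section circle_frame.
Context {R : realType} (P : diamond_params).
Local Notation lambda := (@lebesgue_measure R).
Local Notation F := (diamond R P 0).

Definition circle_mode (m : nat) (b : bool) (x : F) : R :=
  circle_fun m b (repr (x : {eq_quot circle_equiv R})).

Definition circle_fun' (m : nat) (b : bool) (x : R) : R :=
  circle_coef m * (if b then - (m%:R * sin (m%:R * x)) else m%:R * cos (m%:R * x)).

Lemma sin_mul2pi (n : nat) (y : R) : sin (n%:R * (2 * pi) + y) = sin y.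
Proof.
elim: n => [|n IH]; first by rewrite mul0r add0r.
rewrite -natr1 mulrDl mul1r addrAC {2}(mulr_natl pi 2) sinD2pi.
exact: IH.
Qed.

Lemma circle_fun_periodic m b (x : R) : circle_fun m b (x + 2 * pi) = circle_fun m b x.
Proof.
rewrite /circle_fun mulrDr addrC; congr (_ * _).
by case: b; [exact: cos_mul2pi|exact: sin_mul2pi].
Qed.

Lemma circle_fun'_periodic m b (x : R) : circle_fun' m b (x + 2 * pi) = circle_fun' m b x.
Proof.
rewrite /circle_fun' mulrDr addrC; congr (_ * _).
by case: b; rewrite ?cos_mul2pi ?sin_mul2pi.
Qed.

Lemma circle_mode_lift m b w : lift (circle_mode m b) w = circle_fun m b.
Proof.
apply/funext => eta; rewrite /lift /circle_mode; apply: (periodic_rel (circle_fun_periodic m b)).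
by apply/to_circle_eq; rewrite /to_circle reprK.
Qed.

Lemma is_derive_circle_fun m b (x : R) : is_derive x 1 (circle_fun m b) (circle_fun' m b x).
Proof.
by apply: is_deriveMl; case: b; [exact: is_derive_cosM|exact: is_derive_sinM].
Qed.

Lemma is_derive_circle_fun' m b (x : R) :
  is_derive x 1 (circle_fun' m b) (- (m%:R ^+ 2 * circle_fun m b x)).
Proof.
have -> : - (m%:R ^+ 2 * circle_fun m b x) =
    circle_coef m * (m%:R * (if b then - (m%:R * cos (m%:R * x)) else - (m%:R * sin (m%:R * x)))).
  by rewrite /circle_fun; case: b; ring.
apply: is_deriveMl; case: b; last by apply: is_deriveMl; exact: is_derive_cosM.
rewrite (_ : (fun x => _) = (fun x => - m%:R * sin (m%:R * x))); last first.
  by apply/funext => y; rewrite mulNr.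
by rewrite mulrN -mulNr; apply: is_deriveMl; exact: is_derive_sinM.
Qed.

Lemma continuous_circle_fun m b : continuous (@circle_fun R m b).
Proof. by apply: is_derive_continuous => x; exact: is_derive_circle_fun. Qed.

Lemma continuous_circle_fun' m b : continuous (circle_fun' m b).
Proof. by apply: is_derive_continuous => x; exact: is_derive_circle_fun'. Qed.

Lemma continuous_circle_mode m b : continuous (circle_mode m b).
Proof.
apply/diamond_continuousP => w; have := @continuous_circle_fun m b.
by rewrite -(circle_mode_lift m b w).
Qed.

Lemma sum_word0 (u : word P 0 -> R) : \sum_w u w = u tt.
Proof. by rewrite (bigD1 tt)//= big1 ?addr0//; case. Qed.

Lemma mu_inner_circle (f g : F -> R) : mu_L2 f -> mu_L2 g ->
  mu_inner f g = ipL2 `[0, 2 * pi] (lift f tt) (lift g tt).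
Proof.
by move=> Sf Sg; rewrite mu_inner_lift// sum_word0 /Nprod big_nil invr1 mul1r.
Qed.

Lemma form_circle (f g : F -> R) df dg : acd 0 (2 * pi) (lift f tt) df ->
  acd 0 (2 * pi) (lift g tt) dg -> form f g = ipL2 `[0, 2 * pi] df dg.
Proof.
move=> Hf Hg; rewrite (@formE R P 0 f g (fun=> df) (fun=> dg)); try by case.
by rewrite sum_word0 /Nprod big_nil invr1 mul1r.
Qed.

Lemma acd_circle_mode m b w : acd 0 (2 * pi) (lift (circle_mode m b) w) (circle_fun' m b).
Proof.
rewrite circle_mode_lift; apply: acd_is_derive; last exact: continuous_circle_fun'.
by move=> x; exact: is_derive_circle_fun.
Qed.

Lemma form_dom_circle_mode m b : form_dom (circle_mode m b).
Proof. by apply: acd_form_dom => w; exact: acd_circle_mode. Qed.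

(** The Dirichlet solution vanishes at 0 and 2 pi, so it descends to the circle. As [h] has mean
    zero, its derivative also takes equal values at both ends, and the boundary terms of the
    integration by parts cancel. *)
Lemma circle_solve (h : F -> R) : mu_L2 h -> \int[lambda]_(s in `[0, 2 * pi]) lift h (word0 P 0) s = 0 ->
  exists2 u : F -> R, form_dom u & forall g, form_dom g -> form u g = mu_inner h g.
Proof.
move=> Sh h0; have p0 := @pi2_gt0 R.
have [u [u' [uu' u'h ua ub]]] := acd_second_primitive p0 ((mu_L2_lift h).1 Sh tt).
have [|U HU] := @diamond_descend R P R 0 (fun=> u); first by move=> w w' eta _ _.
have HU2 s : 0 <= s <= 2 * pi -> u s = lift U tt s.
  move=> /andP[s0]; rewrite le_eqVlt => /predU1P[->|s2]; last by rewrite /lift HU// s0.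
  by rewrite ub -ua lift_last /lift HU// lexx.
have aU : acd 0 (2 * pi) (lift U tt) u'.
  by apply: (acd_ext uu' HU2 _ (ltW p0)).
have dU : form_dom U.
  by apply: (@acd_form_dom R P 0 U (fun=> u')); case.
exists U => // g dg; have [cg [df Hg]] := (form_dom_lift g).1 dg.
rewrite (form_circle aU (Hg tt)) mu_inner_circle//; last exact: continuous_mu_L2.
rewrite /ipL2 (acd_by_parts (ltW p0) u'h (Hg tt)).
have -> : lift g tt (2 * pi) = lift g tt 0 by exact: lift_last.
have -> : u' (2 * pi) = u' 0.
  rewrite (u'h.2 (2 * pi)); last by rewrite ltW/=.
  have -> : \int[lambda]_(r in `[0, 2 * pi]) - lift h tt r = - \int[lambda]_(r in `[0, 2 * pi]) lift h tt r.
    rewrite -[RHS]mulN1r -RintegralZl//; last first.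
      exact: (sqint_segment_integrable ((mu_L2_lift h).1 Sh tt)).
    by apply: eq_Rintegral => x _; rewrite mulN1r.
  by rewrite h0 oppr0 addr0.
rewrite subrr sub0r.
have mI := segment_measurable 0 (2 * pi : R).
rewrite -mulN1r -RintegralZl//.
  by apply: eq_Rintegral => x _; rewrite mulN1r mulNr opprK.
apply: sqint_mul => //; first exact: u'h.1.
exact: acd_sqint (ltW p0) (Hg tt).
Qed.

Lemma circle_frame : spectral_frame (fun=> 1%N) circle_mode.
Proof.
have p0 := @pi2_gt0 R; have mI := segment_measurable 0 (2 * pi : R).
have Sm m b := continuous_mu_L2 (@continuous_circle_mode m b).
split.
- by [].
- exact: form_dom_circle_mode.
- exists (Num.sqrt pi^-1) => m b x.
  have c1 : `|circle_coef m| <= Num.sqrt (pi^-1 : R).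
    rewrite ger0_norm; last exact: ltW (circle_coef_gt0 _).
    apply: ler_wsqrtr.
    case: m => // ; rewrite lef_pV2 ?posrE ?pi_gt0// ler_peMl ?pi_ge0//.
    by rewrite ler1n.
  rewrite /circle_mode /circle_fun normrM -[leRHS]mulr1; apply: ler_pM => //.
  by case: b; rewrite ler_norml ?cos_geN1 ?cos_le1 ?sin_geN1 ?sin_le1.
- move=> m b g dg; have [cg [df Hg]] := (form_dom_lift g).1 dg.
  rewrite mul1n (form_circle (acd_circle_mode m b tt) (Hg tt)) mu_inner_circle//; last exact: continuous_mu_L2.
  have H2 : acd 0 (2 * pi) (circle_fun' m b) (fun x => - (m%:R ^+ 2 * circle_fun m b x)).
    apply: acd_is_derive; first by move=> x; exact: is_derive_circle_fun'.
    move=> x; apply: cvgN; apply: cvgM; first exact: cvg_cst.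
    exact: continuous_circle_fun.
  rewrite /ipL2 (acd_by_parts (ltW p0) H2 (Hg tt)).
  have -> : lift g tt (2 * pi) = lift g tt 0 by exact: lift_last.
  have -> : circle_fun' m b (2 * pi) = circle_fun' m b 0.
    by rewrite -[2 * pi]add0r circle_fun'_periodic.
  rewrite subrr sub0r circle_mode_lift.
  have Sc := @continuous_sqint R 0 (2 * pi) _ (@continuous_circle_fun m b).
  have Sg : sqint `[0, 2 * pi] (lift g tt) by exact: acd_sqint (ltW p0) (Hg tt).
  rewrite -[X in _ = _ * X]/(ipL2 _ _ _) -(ip_scalel (semi_inner_ipL2 mI))//.
  rewrite -mulN1r -[X in _ * X]/(ipL2 _ _ _) -(ip_scalel (semi_inner_ipL2 mI))//; last first.
    exact: H2.1.
  by apply: eq_Rintegral => x _; ring.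
- move=> f Sf; rewrite /mu_norm2 mu_inner_circle//.
  have := circle_parseval ((mu_L2_lift f).1 Sf tt).
  rewrite (_ : series _ = series (fun m => \sum_b mu_inner f (circle_mode m b) ^+ 2))//.
  congr series; apply/funext => m; apply: eq_bigr => b _.
  by rewrite mu_inner_circle// circle_mode_lift.
- move=> t x y t0 /=.
  have := @circle_kernel_cvg R t (repr (x : {eq_quot circle_equiv R})) (repr (y : {eq_quot circle_equiv R})) t0.
  rewrite (_ : series _ = series (fun m => \sum_(b : bool) heat_weight 1 m t * (circle_mode m b x * circle_mode m b y)))//.
  congr series; apply/funext => m; rewrite big_bool/= -mulrDr; congr (_ * _).
  by rewrite /circle_mode /circle_fun mulrBr cosB; ring.
- move=> h Sh H; apply: circle_solve => //.
  (* The cosine mode of index 0 is a nonzero constant, so this orthogonality says that [h] has mean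
     zero. *)
  have := H true; rewrite mu_inner_circle// circle_mode_lift => E.
  have C0 : circle_coef 0 != 0 :> R by rewrite gt_eqF// circle_coef_gt0.
  apply: (mulfI C0); rewrite mulr0 -[RHS]E /ipL2 -RintegralZl//.
    by apply: eq_Rintegral => x _; rewrite /circle_fun mul0r cos0 mulr1 mulrC.
  exact: (sqint_segment_integrable ((mu_L2_lift h).1 Sh tt)).
Qed.

End circle_frame.

Section acd_sums.
Context {R : realType}.

Lemma acd_sum (I : Type) (r : seq I) (c : I -> R) (u g : I -> R -> R) a b :
  (forall j, acd a b (u j) (g j)) ->
  acd a b (fun s => \sum_(j <- r) c j * u j s) (fun s => \sum_(j <- r) c j * g j s).
Proof.
move=> H; elim: r => [|j r IH].
  rewrite (_ : (fun _ => _) = (fun=> 0)); last by apply/funext => s; rewrite big_nil.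
  rewrite (_ : (fun s => \sum_(j <- [::]) c j * g j s) = (fun=> 0)); last first.
    by apply/funext => s; rewrite big_nil.
  by apply: acd_is_derive => x; exact: cvg_cst.
rewrite (_ : (fun _ => _) = (fun s => c j * u j s + \sum_(j <- r) c j * u j s)); last first.
  by apply/funext => s; rewrite big_cons.
rewrite (_ : (fun s => \sum_(j <- j :: r) c j * g j s) =
    (fun s => c j * g j s + \sum_(j <- r) c j * g j s)); last first.
  by apply/funext => s; rewrite big_cons.
exact: acd_lin.
Qed.

End acd_sums.

(** * Means and deviations over the fibres of the projection *)

Section averaging.
Context {R : realType} (P : diamond_params) (i : nat).
Local Notation lambda := (@lebesgue_measure R).
Local Notation F := (diamond R P i).
Local Notation F' := (diamond R P i.+1).
Local Notation n := (npar P i.+1).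
Local Notation pt := (@diamond_point R P _).
Implicit Types (f : F -> R) (g h : F' -> R) (W : word P i.+1 -> R -> R).

Let n0 : n%:R != 0 :> R. Proof. by rewrite pnatr_eq0 -lt0n npar_gt0. Qed.

Lemma mean_const (c : R) : \sum_(b : 'I_n) n%:R^-1 * c = c.
Proof.
by rewrite -big_distrl /= sumr_const card_ord -[_^-1 *+ n]mulr_natr mulVf// mul1r.
Qed.

Definition fiber_mean g : F -> R :=
  fun x => \sum_(b : 'I_n) n%:R^-1 * g (to_glue _ x b).

(** Stated for families of functions of the angle, so that it also applies to derivatives, which
    need not descend to the space. *)
Definition word_mean W (w : word P i) : R -> R :=
  fun s => \sum_(b : 'I_n) n%:R^-1 * W (w, b) s.

Definition word_dev W (w : word P i.+1) : R -> R :=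
  fun s => W w s - word_mean W w.1 s.

Definition fiber_dev g : F' -> R := fun x => g x - fiber_mean g (diamond_proj x).

Lemma sum_wordS (u : word P i.+1 -> R) :
  \sum_w u w = \sum_(w : word P i) \sum_(b : 'I_n) u (w, b).
Proof. by rewrite (pair_bigA _ (fun w b => u (w, b))); apply: eq_bigr => -[]. Qed.

Lemma diamond_projE eta (w : word P i.+1) : diamond_proj (pt eta w) = pt eta w.1.
Proof. exact: glue_fstE. Qed.

Lemma lift_proj f (w : word P i.+1) : lift (fun x => f (diamond_proj x)) w = lift f w.1.
Proof. by apply/funext => s; rewrite /lift diamond_projE. Qed.

Lemma lift_fiber_mean g w : lift (fiber_mean g) w = word_mean (lift g) w.
Proof. by []. Qed.

Lemma lift_fiber_dev g w : lift (fiber_dev g) w = word_dev (lift g) w.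
Proof. by apply/funext => s; rewrite /lift /fiber_dev diamond_projE. Qed.

Lemma fiber_mean_proj f : fiber_mean (fun x => f (diamond_proj x)) = f.
Proof.
apply/funext => x; rewrite /fiber_mean (eq_bigr (fun=> n%:R^-1 * f x)); first exact: mean_const.
by move=> b _; rewrite /diamond_proj glue_fstE.
Qed.

Lemma sqint_word_mean W a b w : (forall w, sqint `[a, b] (W w)) -> sqint `[a, b] (word_mean W w).
Proof. by move=> SW; apply: (si_sum (semi_inner_ipL2 (segment_measurable a b))). Qed.

Lemma mu_L2_proj f : mu_L2 f -> mu_L2 (fun x => f (diamond_proj x) : R).
Proof. by move=> /mu_L2_lift Sf; apply/mu_L2_lift => w; rewrite lift_proj. Qed.

Lemma mu_L2_fiber_mean g : mu_L2 g -> mu_L2 (fiber_mean g).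
Proof.
move=> /mu_L2_lift Sg; apply/mu_L2_lift => w; rewrite lift_fiber_mean.
exact: sqint_word_mean.
Qed.

(** The measure of level i + 1 splits each weight into n equal parts, so the mean is adjoint to
    composition with the projection. Shared by the inner product and the form. *)
Lemma word_pairing (V : word P i -> R -> R) W :
  (forall w, sqint `[0, 2 * pi] (V w)) -> (forall w, sqint `[0, 2 * pi] (W w)) ->
  (Nprod P i.+1)%:R^-1 * \sum_w ipL2 `[0, 2 * pi] (V w.1) (W w) =
  (Nprod P i)%:R^-1 * \sum_w ipL2 `[0, 2 * pi] (V w) (word_mean W w).
Proof.
move=> SV SW; have si := semi_inner_ipL2 (segment_measurable 0 (2 * pi : R)).
rewrite NprodS natrM invfM -mulrA; congr (_ * _); rewrite sum_wordS big_distrr.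
apply: eq_bigr => w _ /=.
rewrite (si_sym si) (ip_suml si)// big_distrr; apply: eq_bigr => b _ /=.
by rewrite (si_sym si).
Qed.

Lemma mu_inner_proj f g : mu_L2 f -> mu_L2 g ->
  mu_inner (fun x => f (diamond_proj x)) g = mu_inner f (fiber_mean g).
Proof.
move=> Sf Sg; rewrite !mu_inner_lift//; [|exact: mu_L2_fiber_mean|exact: mu_L2_proj].
rewrite -(@word_pairing (lift f) (lift g)); [|exact/mu_L2_lift|exact/mu_L2_lift].
by congr (_ * _); apply: eq_bigr => w _; rewrite lift_proj.
Qed.

Lemma acd_fiber_mean g dg : (forall w, acd 0 (2 * pi) (lift g w) (dg w)) ->
  forall w, acd 0 (2 * pi) (lift (fiber_mean g) w) (word_mean dg w).
Proof. by move=> H w; rewrite lift_fiber_mean; apply: acd_sum. Qed.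

Lemma acd_fiber_dev g dg : (forall w, acd 0 (2 * pi) (lift g w) (dg w)) ->
  forall w, acd 0 (2 * pi) (lift (fiber_dev g) w) (word_dev dg w).
Proof.
move=> H w; rewrite lift_fiber_dev.
apply: (acd_ext (acd_lin (-1) (acd_fiber_mean H w.1) (H w)) _ _ (ltW pi2_gt0)) => s _.
  by rewrite mulN1r addrC lift_fiber_mean.
by rewrite mulN1r addrC.
Qed.

Lemma form_dom_proj f : form_dom f -> form_dom (fun x => f (diamond_proj x) : R).
Proof.
move=> /form_dom_lift[_ [df Hf]]; apply: (@acd_form_dom R P i.+1 _ (fun w : word P i.+1 => df w.1)) => w.
by rewrite lift_proj.
Qed.

Lemma form_dom_fiber_mean g : form_dom g -> form_dom (fiber_mean g).
Proof. by move=> /form_dom_lift[_ [dg Hg]]; apply: acd_form_dom (acd_fiber_mean Hg). Qed.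

Lemma form_proj f g : form_dom f -> form_dom g ->
  form (fun x => f (diamond_proj x)) g = form f (fiber_mean g).
Proof.
move=> /form_dom_lift[_ [df Hf]] /form_dom_lift[_ [dg Hg]].
rewrite (formE Hf (acd_fiber_mean Hg)) (@formE R P i.+1 _ _ (fun w : word P i.+1 => df w.1) dg)//; last first.
  by move=> w; rewrite lift_proj.
by apply: word_pairing => w; [exact: (Hf w).1|exact: (Hg w).1].
Qed.

Lemma mu_L2_fiber_dev g : mu_L2 g -> mu_L2 (fiber_dev g).
Proof.
by move=> Sg; apply: (si_sub (semi_inner_mu _ _)) => //; apply: mu_L2_proj; exact: mu_L2_fiber_mean.
Qed.

(** Pythagoras: deviations have mean zero and are therefore orthogonal to all functions lifted from
    the lower space. *)
Lemma mu_inner_fiber_dev g h : mu_L2 g -> mu_L2 h ->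
  mu_inner (fiber_dev g) (fiber_dev h) =
  mu_inner g h - mu_inner (fiber_mean g) (fiber_mean h).
Proof.
move=> Sg Sh; have si := @semi_inner_mu R P i.+1.
have Sgm := mu_L2_fiber_mean Sg; have Shm := mu_L2_fiber_mean Sh.
have Sgp := mu_L2_proj Sgm; have Shp := mu_L2_proj Shm.
rewrite (ip_subl si)//; last exact: mu_L2_fiber_dev.
rewrite mu_inner_proj//; last exact: mu_L2_fiber_dev.
rewrite (si_sym si g) (ip_subl si)// mu_inner_proj//.
rewrite (_ : fiber_mean (fiber_dev h) = fun=> 0).
  have si' := @semi_inner_mu R P i.
  by rewrite (si_sym si' _ (fun=> 0)) (ip_zerol si')// subr0 (si_sym si h) (si_sym si').
apply/funext => x; rewrite /fiber_mean /fiber_dev.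
under eq_bigr do rewrite mulrBr.
rewrite sumrB; have E := fiber_mean_proj (fiber_mean h).
by have := congr1 (fun k => k x) E; rewrite /fiber_mean => ->; rewrite subrr.
Qed.

(** At a grid angle the n points of the fibre are glued into one. This is the source of the
    Dirichlet conditions on the cells. *)
Lemma fiber_dev_grid g w k : lift (fiber_dev g) w (@grid_angle R P i.+1 k) = 0.
Proof.
rewrite lift_fiber_dev /word_dev /word_mean (eq_bigr (fun=> n%:R^-1 * lift g w (@grid_angle R P i.+1 k))).
  by rewrite mean_const subrr.
move=> b _; congr (_ * _); rewrite /lift; case: w => w a.
by rewrite (diamond_point_glued w b a k).
Qed.

End averaging.

(** * From one level to the next *)

Section half_open_extension.
Context {R : realType}.
Local Notation lambda := (@lebesgue_measure R).
Implicit Types (a b c d : R) (u v s : R -> R).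

(* Half-open, so that the formula also gives the derivative of the extension of
   [s] in the representation produced by [acd_glue]. *)
Definition extend0 b c s : R -> R := fun x => if b < x <= c then s x else 0.

Lemma acd_extend0 a b c d s s' : a <= b -> b <= c -> c <= d -> acd b c s s' ->
  s b = 0 -> s c = 0 -> acd a d (extend0 b c s) (extend0 b c s').
Proof.
move=> ab bc cd H sb sc; have ac := le_trans ab bc.
have H0 x y : acd x y (fun=> 0 : R) (fun=> 0) by apply: acd_is_derive => z; exact: cvg_cst.
have H1 : acd a b (extend0 b c s) (fun=> 0).
  apply: acd_ext (H0 a b) _ _ ab => // x /andP[_ xb].
  by rewrite /extend0 ltNge xb.
have H2 : acd b c (extend0 b c s) s'.
  apply: acd_ext H _ _ bc => // x /andP[]; rewrite /extend0 le_eqVlt => /predU1P[<-|-> ->//].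
  by rewrite ltxx.
have H3 : acd c d (extend0 b c s) (fun=> 0).
  apply: acd_ext (H0 c d) _ _ cd => // x /andP[]; rewrite /extend0 le_eqVlt => /predU1P[<-|cx _].
    by rewrite sc if_same.
  by rewrite [x <= c]leNgt cx andbF.
apply: acd_ext (acd_glue ac cd (acd_glue ab bc H1 H2) H3) _ _ (le_trans ac cd) => // x _.
by rewrite /extend0; case: (leP x c) => xc; rewrite ?andbF ?andbT//; case: (leP x b).
Qed.

Lemma sqint_extend0 a b c d s : a <= b -> b <= c -> c <= d -> sqint `[b, c] s ->
  sqint `[a, d] (extend0 b c s).
Proof.
move=> ab bc cd Ss; have ac := le_trans ab bc; have S0 x y : sqint `[x, y] (fun=> 0 : R).
  by apply: continuous_sqint => z; exact: cvg_cst.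
have mI x y := segment_measurable x y.
have -> : extend0 b c s = (fun x => (if x <= c then (if x <= b then 0 else s x) else 0)).
  by apply/funext => x; rewrite /extend0; case: (leP x c) => xc; rewrite ?andbF ?andbT//; case: (leP x b).
have G x y z u v : x <= y -> y <= z -> sqint `[x, y] u -> sqint `[y, z] v ->
    sqint `[x, z] (fun t => if t <= y then u t else v t).
  (* [acd_glue] is applied to the primitives of [u] and [v] only to read off that the glued
     derivative is square integrable. *)
  move=> xy yz Su Sv; have := @acd_glue R x y z _ u v xy yz.
  move=> /(_ (fun t => if t <= y then \int[lambda]_(r in `[x, t]) u r else
     \int[lambda]_(r in `[x, y]) u r + \int[lambda]_(r in `[y, t]) v r)).
  case=> //; split => // t /andP[t1 t2].
    by rewrite t2 xy Rintegral_point add0r.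
  rewrite lexx; case: (leP t y) => // ty.
  by rewrite (@le_anti _ _ t y) ?t1 ?ty// Rintegral_point addr0.
exact: G (G _ _ _ _ _ ab bc (S0 a b) Ss) (S0 c d).
Qed.

Lemma ipL2_extend0 a b c d s v : a <= b -> b <= c -> c <= d -> sqint `[b, c] s ->
  sqint `[a, d] v -> ipL2 `[a, d] (extend0 b c s) v = ipL2 `[b, c] s v.
Proof.
move=> ab bc cd Ss Sv; have ac := le_trans ab bc; have SE := sqint_extend0 ab bc cd Ss.
have iE : lambda.-integrable `[a, d] (EFin \o (fun x => extend0 b c s x * v x)).
  by apply: sqint_mul => //; exact: segment_measurable.
rewrite /ipL2 (@Rintegral_split R a c d)// (@Rintegral_split R a b c)//; last first.
  exact: integrable_subsegment (lexx a) cd iE.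
have piece x y u : a <= x -> y <= d -> sqint `[x, y] u ->
    (forall t, x <= t <= y -> t != b -> t != c -> extend0 b c s t = u t) ->
    \int[lambda]_(r in `[x, y]) (extend0 b c s r * v r) = ipL2 `[x, y] u v.
  move=> ax yd Su Eu; rewrite -[LHS]/(ipL2 `[x, y] (extend0 b c s) v).
  apply: (ipL2_ae (segment_measurable x y)); rewrite ?(sqint_sub ax yd)//.
  - apply: (sqint_sub ax yd SE).
  - exact: (sqint_sub ax yd Sv).
  - exact: (sqint_sub ax yd Sv).
  - apply: (ae_lebesgueS2 _ (ae_neq b) (ae_neq c)) => t tb tc.
    by rewrite /= in_itv/= => txy; exact: Eu.
  - by apply: aeW.
have z x y : a <= x -> y <= d -> ipL2 `[x, y] (fun=> 0) v = 0.
  move=> ax yd; apply: (ip_zerol (semi_inner_ipL2 (segment_measurable x y))).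
  exact: sqint_sub ax yd Sv.
have S0 x y : sqint `[x, y] (fun=> 0 : R).
  by apply: continuous_sqint => t; exact: cvg_cst.
rewrite (piece a b (fun=> 0))//; last 2 first.
- exact: le_trans bc cd.
- by move=> t /andP[_ tb] _ _; rewrite /extend0 ltNge tb.
rewrite (piece c d (fun=> 0))//; last first.
  move=> t /andP[ct _] _ tc; by rewrite /extend0 [t <= c]leNgt (lt_neqAle c) [c == t]eq_sym tc ct andbF.
rewrite (piece b c s)//; last first.
  by move=> t /andP[bt tc] tb _; rewrite /extend0 tc lt_neqAle eq_sym tb bt.
by rewrite !z// ?add0r ?addr0//; exact: le_trans bc cd.
Qed.

End half_open_extension.

(** * Functions spread over the bundle of one cell *)

Section bubbles.
Context {R : realType} (P : diamond_params) (i : nat).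
Local Notation lambda := (@lebesgue_measure R).
Local Notation F' := (diamond R P i.+1).
Local Notation n := (npar P i.+1).
Local Notation grid := (@grid_angle R P i.+1).
Local Notation I k := (`[grid k, grid k.+1]%classic : set R).
Local Notation idx := (cell_index P i.+1).
Implicit Types (g : F' -> R) (a : idx) (v w : word P i.+1) (s : R -> R) (W : word P i.+1 -> R -> R).

Definition bubble_weight v w : R := (w.1 == v.1)%:R * ((w.2 == v.2)%:R - n%:R^-1).

Definition bubble_lift a s w : R -> R :=
  fun x => bubble_weight a.2 w * extend0 (grid a.1) (grid a.1.+1) s x.

(** Chosen rather than given by a formula, because it has to descend to the quotient. By
    [lift_bubble] such a function exists as soon as [s] vanishes at the right end of the cell. *)
Definition bubble a s : F' -> R := 
  xget (fun=> 0) [set f : F' -> R | forall w x, 0 <= x <= 2 * pi -> lift f w x = bubble_lift a s w x].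

Lemma grid_in_cell a l : grid a.1 < grid l <= grid a.1.+1 -> grid l = grid a.1.+1.
Proof.
move=> /andP[al la]; apply/le_anti; rewrite la/=; apply: grid_angle_le.
by rewrite ltnNge; apply: contraL al => /(@grid_angle_le R P i.+1); rewrite leNgt.
Qed.

Lemma bubble_lift_grid a s w l : s (grid a.1.+1) = 0 -> bubble_lift a s w (grid l) = 0.
Proof.
move=> s1; rewrite /bubble_lift /extend0; case: ifPn => [/grid_in_cell->|_]; last exact: mulr0.
by rewrite s1 mulr0.
Qed.

(** Distinct words share a point only at a grid angle. The half-open support contains a single grid
    angle, its right end, where [s] is 0; so there the formula gives 0 for all words. *)
Lemma lift_bubble a s w x : s (grid a.1.+1) = 0 -> 0 <= x <= 2 * pi ->
  lift (bubble a s) w x = bubble_lift a s w x.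
Proof.
move=> s1; rewrite /bubble; case: xgetP => [B _ HB|H]; first exact: HB.
have [|B HB] := @diamond_descend R P R i.+1 (bubble_lift a s).
  move=> u v y y02 /diamond_point_inj[_ [->//|[k yk']]].
  have yk := circle_rel_trans yk' (@grid_angle_rel R P i.+1 k).
  have kJ : grid (k %% (2 * Jprod P i.+1)) < 2 * pi.
    rewrite -(@grid_angle_last R P i.+1) /grid_angle ltr_pM2r ?invr_gt0 ?ltr0n ?Jprod_gt0//.
    by rewrite ltr_pM2l ?pi_gt0// ltr_nat ltn_mod double_Jprod_gt0.
  by rewrite (circle_rel_eq y02 _ yk) ?grid_angle_ge0 ?kJ// !bubble_lift_grid.
exfalso; apply: (H B) => u y /andP[y0]; rewrite le_eqVlt => /predU1P[->|y2].
  (* [diamond_descend] stops before 2 pi; there the lift has its value at 0, and both sides are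
     0. *)
  rewrite lift_last -(@grid_angle_last R P i.+1) bubble_lift_grid//.
  rewrite /lift HB; first by have := bubble_lift_grid (a := a) u 0 s1; rewrite grid_angle0.
  by rewrite lexx pi2_gt0.
by rewrite /lift HB// y0.
Qed.

Lemma grid_le_succ k : grid k <= grid k.+1. Proof. exact: grid_angle_le. Qed.

Lemma grid_le_2pi (k : 'I_(2 * Jprod P i.+1)) : grid k.+1 <= 2 * pi.
Proof. by rewrite -(@grid_angle_last R P i.+1) grid_angle_le. Qed.

Lemma acd_bubble a s s' : acd (grid a.1) (grid a.1.+1) s s' ->
  s (grid a.1) = 0 -> s (grid a.1.+1) = 0 ->
  forall w, acd 0 (2 * pi) (lift (bubble a s) w) (bubble_lift a s' w).
Proof.
move=> H s0 s1 w; have p0 := ltW (@pi2_gt0 R).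
have HE := acd_extend0 (grid_angle_ge0 _ _ _) (grid_le_succ _) (grid_le_2pi a.1) H s0 s1.
have H0 : acd 0 (2 * pi) (fun=> 0 : R) (fun=> 0) by apply: acd_is_derive => z; exact: cvg_cst.
apply: acd_ext (acd_lin (bubble_weight a.2 w) HE H0) _ _ p0 => x x02; rewrite addr0//.
by rewrite lift_bubble.
Qed.

Lemma sqint_bubble_lift a s w : sqint (I a.1) s -> sqint `[0, 2 * pi] (bubble_lift a s w).
Proof.
move=> Ss; apply: (si_scale (semi_inner_ipL2 (segment_measurable _ _))).
by apply: sqint_extend0 => //; [exact: grid_angle_ge0|exact: grid_le_succ|exact: grid_le_2pi].
Qed.

(** The weights are the matrix of the deviation operator. Pairing one bubble with all words thus
    isolates the deviation on a single cell, which decouples the cells. *)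
Lemma bubble_pairing a s W : sqint (I a.1) s -> (forall w, sqint `[0, 2 * pi] (W w)) ->
  \sum_w ipL2 `[0, 2 * pi] (bubble_lift a s w) (W w) = ipL2 (I a.1) s (word_dev W a.2).
Proof.
move=> Ss SW; have si := semi_inner_ipL2 (segment_measurable 0 (2 * pi : R)).
have SE : sqint `[0, 2 * pi] (extend0 (grid a.1) (grid a.1.+1) s).
  by apply: sqint_extend0 => //; [exact: grid_angle_ge0|exact: grid_le_succ|exact: grid_le_2pi].
have SI U : sqint `[0, 2 * pi] U -> sqint (I a.1) U.
  by apply: sqint_sub; [exact: grid_angle_ge0|exact: grid_le_2pi].
have E w : ipL2 `[0, 2 * pi] (bubble_lift a s w) (W w) = bubble_weight a.2 w * ipL2 (I a.1) s (W w).
  rewrite (ip_scalel si)// ipL2_extend0//; [exact: grid_angle_ge0|exact: grid_le_succ|exact: grid_le_2pi].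
rewrite (eq_bigr _ (fun w _ => E w)) sum_wordS (bigD1 a.2.1)//= [X in _ + X]big1 ?addr0; last first.
  by move=> u /negbTE ua; apply: big1 => b _; rewrite /bubble_weight /= ua !mul0r.
have siI := semi_inner_ipL2 (segment_measurable (grid a.1) (grid a.1.+1)).
rewrite (si_sym siI) /word_dev (ip_subl siI)//; last 2 first.
- exact: SI.
- by apply: sqint_word_mean => w; exact: SI.
rewrite (ip_suml siI)//; last by move=> b; exact: SI.
transitivity (\sum_(b < n) ((b == a.2.2)%:R * ipL2 (I a.1) s (W (a.2.1, b)) -
   n%:R^-1 * ipL2 (I a.1) (W (a.2.1, b)) s)).
  apply: eq_bigr => b _; rewrite /bubble_weight /= eqxx mul1r mulrBl.
  by rewrite (si_sym siI _ s).
rewrite sumrB; congr (_ - _); rewrite (bigD1 a.2.2)//= eqxx mul1r big1 ?addr0; last first.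
  by move=> b /negbTE ->; rewrite mul0r.
rewrite (si_sym siI); case: a {Ss SE SI E siI} => k [w b] /=.
by [].
Qed.

Lemma mu_inner_bubble a s g : sqint (I a.1) s -> s (grid a.1.+1) = 0 -> mu_L2 g ->
  mu_L2 (bubble a s) /\
  mu_inner (bubble a s) g =
  (Nprod P i.+1)%:R^-1 * ipL2 (I a.1) s (lift (fiber_dev g) a.2).
Proof.
move=> Ss s1 Sg; have SW := (mu_L2_lift g).1 Sg.
have EE w x : `[0, 2 * pi]%classic x -> lift (bubble a s) w x = bubble_lift a s w x.
  by rewrite /= in_itv/= => x02; exact: lift_bubble.
have Sb : mu_L2 (bubble a s).
  apply/mu_L2_lift => w; have [m1 i1] := sqint_bubble_lift w Ss; split.
    by apply: eq_measurable_fun m1 => x; rewrite inE => /EE ->.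
  apply: eq_integrable i1; first exact: segment_measurable.
  by move=> x; rewrite inE => /EE ->.
split => //; rewrite mu_inner_lift// lift_fiber_dev -bubble_pairing//; congr (_ * _).
apply: eq_bigr => w _; apply: eq_Rintegral => x; rewrite inE => /EE ->//.
Qed.

(** Integration by parts on one cell. The boundary terms vanish because of the deviation of [g],
    which is 0 at grid angles, whatever the end values of [s']. *)
Lemma form_bubble a s s' s'' g : acd (grid a.1) (grid a.1.+1) s s' ->
  acd (grid a.1) (grid a.1.+1) s' s'' ->
  s (grid a.1) = 0 -> s (grid a.1.+1) = 0 -> form_dom g ->
  form (bubble a s) g =
  - ((Nprod P i.+1)%:R^-1 * ipL2 (I a.1) s'' (lift (fiber_dev g) a.2)).
Proof.
move=> H H' s0 s1 /form_dom_lift[_ [dg Hg]].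
rewrite (formE (acd_bubble H s0 s1) Hg) bubble_pairing//; last 2 first.
- exact: H.1.
- by move=> w; exact: (Hg w).1.
have Hd := acd_fiber_dev Hg a.2.
have HdI := acd_sub (@grid_angle_ge0 R P i.+1 a.1) (grid_le_succ a.1) (grid_le_2pi a.1) Hd.
rewrite {1}/ipL2 (acd_by_parts (grid_le_succ a.1) H' HdI) !fiber_dev_grid !mulr0 subrr sub0r.
by rewrite mulrN.
Qed.

End bubbles.

Section form_semi_inner.
Context {R : realType} (P : diamond_params) (i : nat).
Local Notation F := (diamond R P i).

Lemma semi_inner_form : semi_inner (@form_dom R P i) (@form R P i).
Proof.
split.
- move=> c f g /form_dom_lift[_ [df Hf]] /form_dom_lift[_ [dg Hg]].
  apply: (@acd_form_dom R P i _ (fun w s => c * df w s + dg w s)) => w.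
  exact: acd_lin (Hf w) (Hg w).
- apply: (@acd_form_dom R P i _ (fun w s => 0)) => w.
  have : acd 0 (2 * pi) (fun=> 0 : R) (fun=> 0) by apply: acd_is_derive => x; exact: cvg_cst.
  by [].
- move=> f g; apply: eq_bigr => a _; congr (_ * _).
  by apply: eq_Rintegral => s _; rewrite mulrC.
- move=> c f g h /form_dom_lift[_ [df Hf]] /form_dom_lift[_ [dg Hg]] /form_dom_lift[_ [dh Hh]].
  have si := semi_inner_ipL2 (segment_measurable 0 (2 * pi : R)).
  rewrite (formE Hf Hh) (formE Hg Hh) (@formE R P i _ h (fun w s => c * df w s + dg w s) dh)//; last first.
    by move=> w; exact: acd_lin (Hf w) (Hg w).
  rewrite mulrCA -mulrDr; congr (_ * _); rewrite big_distrr -big_split; apply: eq_bigr => w _ /=.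
  by apply: (si_linl si); [exact: (Hf w).1|exact: (Hg w).1|exact: (Hh w).1].
- move=> f; apply: sumr_ge0 => a _; rewrite mulr_ge0 ?invr_ge0//.
  exact: (si_ge0 (semi_inner_ipL2 (segment_measurable 0 (cell_length R P i)))).
Qed.

End form_semi_inner.

Lemma cvg_seq_sum {R : realType} (I : finType) (u : I -> nat -> R) (l : I -> R) :
  (forall a, u a @ \oo --> l a) -> (fun K => \sum_a u a K) @ \oo --> \sum_a l a.
Proof.
move=> ul; apply: cvg_big => //; exact: add_continuous.
Qed.

Section coordinates.
Context {R : realType} (P : diamond_params) (i : nat).
Local Notation F := (diamond R P i).

(** There are finitely many cells and the order is total, so a lexicographically least
    representative exists and [coord] never takes its default value. *)
Lemma coord_represents (x : F) : represents x (coord x).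
Proof.
pose Pb a := `[< exists th, represents x (th, a) >].
have [a0 Ha0] : exists a, Pb a.
  have [eta [w [eta02 E]]] := diamond_point_surj x.
  have [k /andP[kle klt]] := @cell_locate R P i _ eta02.
  exists (k, w); apply/asboolP; exists (eta - grid_angle P i k).
  split; first by rewrite /= subr_ge0 kle ltrBlDl.
  by rewrite /cell_map /= -/(grid_angle P i k) addrC subrK.
pose M (a : cell_index P i) := ((a.1 : nat) :: word_seq a.2 : seqlexi nat).
have [a /asboolP[th Ha] min] := @Order.TotalTheory.arg_minP _ (seqlexi nat) _ a0 Pb M Ha0.
rewrite /coord; case: xgetP => [z _ []//|H].
exfalso; apply: (H (th, a)); split => // -[th' b] Hb.
by apply: min; apply/asboolP; exists th'.
Qed.

End coordinates.

(** * Sine modes on the cells of the next level *)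

Section sine_bubbles.
Context {R : realType} (P : diamond_params) (i : nat).
Local Notation lambda := (@lebesgue_measure R).
Local Notation F' := (diamond R P i.+1).
Local Notation n := (npar P i.+1).
Local Notation J := (Jprod P i.+1).
Local Notation N' := (Nprod P i.+1).
Local Notation grid := (@grid_angle R P i.+1).
Local Notation I k := (`[grid k, grid k.+1]%classic : set R).
Local Notation idx := (cell_index P i.+1).
Implicit Types (g h : F' -> R) (a b : idx) (v w : word P i.+1) (s : R -> R).

Let J0 : J%:R != 0 :> R. Proof. exact: Jprod_neq0. Qed.
Let n0 : n%:R != 0 :> R. Proof. by rewrite pnatr_eq0 -lt0n npar_gt0. Qed.
Let N0 : N'%:R != 0 :> R. Proof. by rewrite pnatr_eq0 -lt0n Nprod_gt0. Qed.

(* As [s] vanishes at both ends of the cell, any coordinates of the point do. *)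
Lemma bubble_cell_map a b s th : s (grid a.1) = 0 -> s (grid a.1.+1) = 0 ->
  0 <= th < cell_length R P i.+1 ->
  bubble a s (cell_map b th) =
  (b.1 == a.1)%:R * bubble_weight a.2 b.2 * s (grid b.1 + th).
Proof.
move=> s0 s1 /andP[th0 thL]; rewrite -[LHS]/(lift (bubble a s) b.2 (grid b.1 + th)).
rewrite lift_bubble//; last first.
  rewrite addr_ge0 ?grid_angle_ge0//= (le_trans _ (grid_angle_le2pi b.1))//.
  by rewrite lerD2l ltW.
rewrite /bubble_lift /extend0; have lt_succ : grid b.1 + th < grid b.1.+1.
  by rewrite grid_angle_succ ltrD2l.
have ge_ : grid b.1 <= grid b.1 + th by rewrite lerDl.
rewrite -[b.1 == a.1]val_eqE /=; case: (ltngtP (b.1 : nat) (a.1 : nat)) => [ba|ab|ba].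
- rewrite !mul0r; case: ifPn => [/andP[]|_]; last by rewrite mulr0.
  rewrite ltNge => /negP[]; apply: ltW; apply: lt_le_trans lt_succ _.
  exact: grid_angle_le.
(* A later cell can meet the half-open support only at its right end, where [s] is 0. *)
- rewrite !mul0r; case: ifPn => [/andP[_ h]|_]; last by rewrite mulr0.
  have ge1 : grid a.1.+1 <= grid b.1 by exact: grid_angle_le.
  have E : grid b.1 + th = grid a.1.+1.
    by apply/le_anti; rewrite h (le_trans ge1 ge_).
  by rewrite E s1 mulr0.
- have {}ba : b.1 = a.1 by exact: val_inj.
  rewrite ba in lt_succ ge_ *; rewrite mul1r; congr (_ * _).
  case: ifPn => //; rewrite (ltW lt_succ) andbT -leNgt => le_.
  have -> : grid a.1 + th = grid a.1 by apply/le_anti; rewrite le_ ge_.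
  by rewrite s0.
Qed.

(** Within a bundle the weights form an orthogonal projection, which is symmetric and idempotent. *)
Lemma bubble_weight_gram v w : \sum_u bubble_weight u v * bubble_weight u w =
  (v.1 == w.1)%:R * ((v.2 == w.2)%:R - n%:R^-1) :> R.
Proof.
rewrite sum_wordS (bigD1 v.1)//= [X in _ + X]big1 ?addr0; last first.
  move=> u uv; apply: big1 => b _; rewrite /bubble_weight /= eq_sym (negbTE uv).
  by rewrite !mul0r.
transitivity ((v.1 == w.1)%:R *
    \sum_(b < n) ((v.2 == b)%:R - n%:R^-1) * ((w.2 == b)%:R - n%:R^-1) : R).
  rewrite big_distrr; apply: eq_bigr => b _; rewrite /bubble_weight /= eqxx mul1r.
  by rewrite mulrCA [w.1 == _]eq_sym.
congr (_ * _).
have S1 (u : 'I_n) (c : 'I_n -> R) : \sum_(b < n) (u == b)%:R * c b = c u.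
  rewrite (bigD1 u)//= eqxx mul1r big1 ?addr0// => b; rewrite eq_sym => /negbTE ->.
  by rewrite mul0r.
under eq_bigr do rewrite mulrBl.
rewrite sumrB S1 -big_distrr /= sumrB.
under [X in _ * (X - _)]eq_bigr do rewrite -[_%:R]mulr1.
rewrite S1 sumr_const card_ord -[_^-1 *+ n]mulr_natr mulVf// subrr mulr0 subr0.
by rewrite eq_sym.
Qed.

(* Makes [sine_mode] a Parseval, not an orthonormal, system: the weights
   delta - 1/n of a bundle are the Gram matrix of a projection. *)
Definition sine_coef : R := Num.sqrt (2 * J%:R * N'%:R / pi).

Definition sine_profile (m : nat) : R -> R := fun x => sine_coef * sin (m%:R * J%:R * x).

Definition sine_mode (m : nat) a : F' -> R := bubble a (sine_profile m).

(** The inverse of pi / (2 J N'), the squared norm of the sine over one cell of length pi / J and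
    weight 1 / N'. *)
Lemma sqr_sine_coef : sine_coef ^+ 2 = 2 * J%:R * N'%:R / pi.
Proof. by rewrite sqr_sqrtr// divr_ge0 ?pi_ge0// !mulr_ge0. Qed.

Lemma freq_grid (m k : nat) : m%:R * J%:R * grid k = (m * k)%:R * pi.
Proof. by rewrite /grid_angle natrM; field. Qed.

Lemma sine_profile_grid m k : sine_profile m (grid k) = 0.
Proof. by rewrite /sine_profile freq_grid sin_natpi mulr0. Qed.

Lemma sine_mode_cell_map m a b th : 0 <= th < cell_length R P i.+1 ->
  sine_mode m a (cell_map b th) = (b.1 == a.1)%:R * bubble_weight a.2 b.2 *
    (sine_coef * (cos ((m * b.1)%:R * pi) * sin (m%:R * (J%:R * th)))).
Proof.
move=> thL; rewrite /sine_mode bubble_cell_map ?sine_profile_grid//; congr (_ * (_ * _)).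
by rewrite mulrDr freq_grid sinD sin_natpi mul0r add0r mulrA.
Qed.

(* N_i J_{i+1} (n_{i+1} delta - 1) inside a bundle and 0 across bundles: the
   factor of the circle kernels in [diamond_kernel]. *)
Definition bundle_coef a b : R :=
  (same_bundle a b)%:R * ((Nprod P i)%:R * (n%:R * (a == b)%:R - 1) * J%:R).

Lemma sine_mode_gram m a b th th' : 0 <= th < cell_length R P i.+1 ->
  0 <= th' < cell_length R P i.+1 ->
  \sum_c sine_mode m c (cell_map a th) * sine_mode m c (cell_map b th') =
  bundle_coef a b * (2 / pi * (sin (m%:R * (J%:R * th)) * sin (m%:R * (J%:R * th')))).
Proof.
move=> thL thL'.
under eq_bigr do rewrite !sine_mode_cell_map//.
rewrite -(pair_bigA _ (fun k u => (a.1 == k)%:R * bubble_weight u a.2 *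
    (sine_coef * (cos ((m * a.1)%:R * pi) * sin (m%:R * (J%:R * th)))) *
  ((b.1 == k)%:R * bubble_weight u b.2 *
    (sine_coef * (cos ((m * b.1)%:R * pi) * sin (m%:R * (J%:R * th'))))))) /=.
rewrite (bigD1 a.1)//= [X in _ + X]big1 ?addr0; last first.
  by move=> k /negbTE ka; apply: big1 => u _; rewrite eq_sym ka !mul0r.
rewrite eqxx /bundle_coef /same_bundle [b.1 == a.1]eq_sym.
have [ab|ab] := eqVneq a.1 b.1; last first.
  by rewrite /= !mul0r; apply: big1 => u _; rewrite !mul0r mulr0.
rewrite -ab /=.
transitivity ((\sum_u bubble_weight u a.2 * bubble_weight u b.2) *
   (sine_coef ^+ 2 * cos ((m * a.1)%:R * pi) ^+ 2 *
     (sin (m%:R * (J%:R * th)) * sin (m%:R * (J%:R * th'))))).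
  by rewrite big_distrl; apply: eq_bigr => u _ /=; ring.
(* Two cells of one bundle start at the same angle, so their signs cos(m k pi) multiply to 1. The
   factor n in N_(i+1) = N_i n turns delta - 1/n into n delta - 1. *)
rewrite bubble_weight_gram sqr_cos_natpi sqr_sine_coef NprodS natrM.
have -> : (a == b) = (a.2.1 == b.2.1) && (a.2.2 == b.2.2).
  by clear thL thL'; case: a b ab => k [w c] [k' [w' c']] /= ->; rewrite !xpair_eqE eqxx.
have p0 : pi != 0 :> R by rewrite gt_eqF// pi_gt0.
have arith (N J' c p d S : R) : c != 0 -> p != 0 ->
    (d - c^-1) * (2 * J' * (N * c) / p * 1 * S) = N * (c * d - 1) * J' * (2 / p * S).
  by move=> c0 p0'; field; rewrite c0 p0'.
by case: eqP => _; [rewrite !mul1r andTb arith|rewrite !mul0r].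
Qed.

Lemma sine_mode_kernel t x y : 0 < t ->
  series (fun m => \sum_a heat_weight J m t * (sine_mode m a x * sine_mode m a y))
    @ \oo --> bundle_coef (alpha_ x) (alpha_ y) *
      (circle_kernel (J%:R ^+ 2 * t) (J%:R * theta_ x) (J%:R * theta_ y) -
       circle_kernel (J%:R ^+ 2 * t) (J%:R * theta_ x) (- (J%:R * theta_ y))).
Proof.
move=> t0; have [thx Ex] := coord_represents x; have [thy Ey] := coord_represents y.
have -> : series (fun m => \sum_a heat_weight J m t * (sine_mode m a x * sine_mode m a y)) =
    (fun K => bundle_coef (alpha_ x) (alpha_ y) * series (fun m => heat_weight J m t *
      (2 / pi * (sin (m%:R * (J%:R * theta_ x)) * sin (m%:R * (J%:R * theta_ y))))) K); last first.
  by apply: cvgMr; apply: circle_kernel_diff_cvg => //; exact: Jprod_gt0.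
apply/funext => K; rewrite /series /= big_distrr; apply: eq_bigr => m _ /=.
by rewrite -big_distrr /= -{1}Ex -{1}Ey sine_mode_gram// mulrCA.
Qed.

Lemma sqint_sine_profile m c d : sqint `[c, d] (sine_profile m).
Proof.
apply: (si_scale (semi_inner_ipL2 (segment_measurable c d))).
by apply: continuous_sqint; exact: continuous_sinM.
Qed.

Lemma mu_inner_sine_mode m a g : mu_L2 g -> mu_L2 (sine_mode m a) /\
  mu_inner (sine_mode m a) g =
  N'%:R^-1 * ipL2 (I a.1) (sine_profile m) (lift (fiber_dev g) a.2).
Proof. by move=> Sg; apply: mu_inner_bubble => //; [exact: sqint_sine_profile|exact: sine_profile_grid]. Qed.

Lemma sum_cells_ipL2 g h : mu_L2 g -> mu_L2 h ->
  \sum_(a : idx) N'%:R^-1 * ipL2 (I a.1) (lift g a.2) (lift h a.2) = mu_inner g h.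
Proof.
move=> Sg Sh; rewrite mu_inner_lift// -big_distrr; congr (_ * _).
rewrite -(pair_bigA _ (fun (k : 'I_(2 * J)) w => ipL2 (I k) (lift g w) (lift h w))) exchange_big /=.
apply: eq_bigr => w _; rewrite /ipL2 [RHS](@Rintegral_cells R P i.+1)//.
by apply: sqint_mul; [exact: segment_measurable|exact: (mu_L2_lift g).1|exact: (mu_L2_lift h).1].
Qed.

(** The sine system is complete on each cell, so Parseval there gives the norm of the deviation
    restricted to that cell. Summing over the cells and using Pythagoras yields the limit. *)
Lemma sine_mode_parseval g : mu_L2 g ->
  series (fun m => \sum_a mu_inner g (sine_mode m a) ^+ 2) @ \oo -->
  mu_norm2 g - mu_norm2 (fiber_mean g).
Proof.
move=> Sg; have Sd := mu_L2_fiber_dev Sg.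
rewrite /mu_norm2 -mu_inner_fiber_dev// -sum_cells_ipL2//.
have -> : series (fun m => \sum_a mu_inner g (sine_mode m a) ^+ 2) =
    (fun K => \sum_a series (fun m => mu_inner g (sine_mode m a) ^+ 2) K).
  by apply/funext => K; rewrite /series /= exchange_big.
apply: cvg_seq_sum => a.
have L0 := @cell_length_gt0 R P i.+1.
have ba : grid a.1.+1 - grid a.1 = pi / J%:R by rewrite grid_angle_succ addrAC subrr add0r.
have SI : sqint (I a.1) (lift (fiber_dev g) a.2).
  apply: (sqint_sub (@grid_angle_ge0 R P i.+1 a.1) (@grid_le_2pi R P i a.1)).
  exact: (mu_L2_lift _).1.
set u := fun m => mu_inner g (sine_mode m a) ^+ 2.
rewrite (_ : series u = (fun K => N'%:R^-1 * series (fun m => 2 / (grid a.1.+1 - grid a.1) *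
  ipL2 (I a.1) (lift (fiber_dev g) a.2) (fun x => sin (m%:R * J%:R * x)) ^+ 2) K)).
  (* Multiplication by J sends the ends of cell number k to k pi and (k + 1) pi. *)
  apply: cvgMr; apply: (@sine_parseval R _ _ J%:R a.1) => //.
  - by rewrite ltr0n Jprod_gt0.
  - by rewrite -[J%:R]mul1r (freq_grid 1) mul1n.
  - by rewrite ba; field.
apply/funext => K; rewrite /series /= big_distrr; apply: eq_bigr => m _ /=.
have [Sm Em] := mu_inner_sine_mode m a Sg.
rewrite /u (si_sym (semi_inner_mu _ _)) Em.
have siI := semi_inner_ipL2 (segment_measurable (grid a.1) (grid a.1.+1)).
rewrite (ip_scalel siI)//; last by apply: continuous_sqint; exact: continuous_sinM.
rewrite (si_sym siI) ba !exprMn sqr_sine_coef.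
have p0 : pi != 0 :> R by rewrite gt_eqF// pi_gt0.
have arith (N J' p X : R) : N != 0 -> J' != 0 -> p != 0 ->
    N^-1 ^+ 2 * (2 * J' * N / p * X) = N^-1 * (2 / (p / J') * X).
  by move=> N0' J0' p0'; field; rewrite N0' J0' p0'.
exact: arith.
Qed.

Lemma is_derive_sine_profile m (x : R) : is_derive x 1 (sine_profile m)
  (sine_coef * (m%:R * J%:R * cos (m%:R * J%:R * x))).
Proof. by apply: is_deriveMl; exact: is_derive_sinM. Qed.

Lemma acd_sine_profile m c d : acd c d (sine_profile m)
  (fun x => sine_coef * (m%:R * J%:R * cos (m%:R * J%:R * x))).
Proof.
apply: acd_is_derive; first exact: is_derive_sine_profile.
by move=> x; do 2 (apply: cvgM; first exact: cvg_cst); exact: continuous_cosM.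
Qed.

Lemma acd_sine_profile' m c d :
  acd c d (fun x => sine_coef * (m%:R * J%:R * cos (m%:R * J%:R * x)))
    (fun x => - ((J * m)%:R ^+ 2) * sine_profile m x).
Proof.
have -> : (fun x => - ((J * m)%:R ^+ 2) * sine_profile m x) =
    (fun x => sine_coef * (m%:R * J%:R * - (m%:R * J%:R * sin (m%:R * J%:R * x)))).
  by apply/funext => x; rewrite /sine_profile natrM; ring.
apply: acd_is_derive; first by move=> x; do 2 apply: is_deriveMl; exact: is_derive_cosM.
move=> x; do 2 (apply: cvgM; first exact: cvg_cst).
apply: cvgN; apply: cvgM; first exact: cvg_cst.
exact: continuous_sinM.
Qed.

Lemma form_dom_sine_mode m a : form_dom (sine_mode m a).
Proof.
by apply: acd_form_dom (acd_bubble (acd_sine_profile m _ _) _ _); exact: sine_profile_grid.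
Qed.

Lemma form_sine_mode m a g : form_dom g ->
  form (sine_mode m a) g = (J * m)%:R ^+ 2 * mu_inner (sine_mode m a) g.
Proof.
move=> dg; have Sg := continuous_mu_L2 dg.1.
have [_ ->] := mu_inner_sine_mode m a Sg.
rewrite (form_bubble (acd_sine_profile m _ _) (acd_sine_profile' m _ _))//; try exact: sine_profile_grid.
have siI := semi_inner_ipL2 (segment_measurable (grid a.1) (grid a.1.+1)).
rewrite (ip_scalel siI)//; first by ring.
  exact: sqint_sine_profile.
apply: (sqint_sub (@grid_angle_ge0 R P i.+1 a.1) (@grid_le_2pi R P i a.1)).
by apply: (mu_L2_lift _).1; exact: mu_L2_fiber_dev.
Qed.

Lemma sine_mode_bounded m a x : `|sine_mode m a x| <= 2 * sine_coef.
Proof.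
have [thx <-] := coord_represents x; rewrite sine_mode_cell_map// !normrM.
have c0 : 0 <= sine_coef by exact: sqrtr_ge0.
have b1 (b : bool) : `|b%:R| <= 1 :> R by case: b; rewrite ?normr1 ?normr0.
have cs (y z : R) : `|cos y| * `|sin z| <= 1.
  by apply: mulr_ile1 => //; rewrite ler_norml ?cos_geN1 ?cos_le1 ?sin_geN1 ?sin_le1.
rewrite ler_pM//.
  rewrite -[leRHS]mul1r ler_pM// -[leRHS]mul1r ler_pM//.
  rewrite (le_trans (ler_normB _ _))// -[leRHS]/(1 + 1) lerD//.
  by rewrite ger0_norm// invf_le1 ?ltr0n ?npar_gt0// ler1n npar_gt0.
by rewrite ger0_norm// ger_pMr// lt_neqAle c0 andbT eq_sym sqrtr_eq0 -ltNge divr_gt0 ?pi_gt0// !mulr_gt0// ltr0n ?Jprod_gt0 ?Nprod_gt0.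
Qed.

End sine_bubbles.

Section frame_step.
Context {R : realType} (P : diamond_params) (i : nat).
Local Notation F := (diamond R P i).
Local Notation F' := (diamond R P i.+1).
Local Notation J := (Jprod P i.+1).
Local Notation grid := (@grid_angle R P i.+1).
Local Notation I k := (`[grid k, grid k.+1]%classic : set R).
Local Notation idx := (cell_index P i.+1).
Variables (K : finType) (c : K -> nat) (phi : nat -> K -> F -> R).
Hypothesis fr : spectral_frame c phi.

Definition step_freq (k : K + idx) : nat := match k with inl k => c k | inr _ => J end.

Definition step_mode (m : nat) (k : K + idx) : F' -> R :=
  match k with inl k => fun x => phi m k (diamond_proj x) | inr a => sine_mode m a end.

Lemma sum_sumE (u : K + idx -> R) : \sum_k u k = \sum_k u (inl k) + \sum_a u (inr a).
Proof. by rewrite big_sumType. Qed.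

(** The mean of [h] is treated on the lower space. For the deviation, the Dirichlet problem is
    solved on every cell separately and the solutions are spread as bubbles; summed over all cells,
    their pairings with [g] restore the inner product of the deviations. *)
Lemma step_solve h : mu_L2 h -> (forall k, mu_inner h (step_mode 0%N k) = 0) ->
  exists2 u, form_dom u & forall g, form_dom g -> form u g = mu_inner h g.
Proof.
move=> Sh h0; have Sm := mu_L2_fiber_mean Sh; have Sd := mu_L2_fiber_dev Sh.
have Sphi m k := continuous_mu_L2 (frame_dom fr m k).1.
have [|u0 du0 Hu0] := frame_solve fr Sm.
  move=> k; rewrite (si_sym (semi_inner_mu _ _)) -mu_inner_proj//.
  by rewrite (si_sym (semi_inner_mu _ _)); exact: h0 (inl k).
pose q (a : idx) := lift (fiber_dev h) a.2.
have Sq (a : idx) : sqint (I a.1) (q a).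
  apply: (sqint_sub (@grid_angle_ge0 R P i.+1 a.1) (@grid_le_2pi R P i a.1)).
  exact: (mu_L2_lift _).1.
have glt (a : idx) : grid a.1 < grid a.1.+1 by rewrite grid_angle_succ ltrDl cell_length_gt0.
have sol (a : idx) : exists v : (R -> R) * (R -> R),
    [/\ acd (grid a.1) (grid a.1.+1) v.1 v.2, acd (grid a.1) (grid a.1.+1) v.2 (fun s => - q a s),
        v.1 (grid a.1) = 0 & v.1 (grid a.1.+1) = 0].
  by have [v [v' H]] := acd_second_primitive (glt a) (Sq a); exists (v, v').
pose V a := sval (cid (sol a)); have HV a := svalP (cid (sol a)).
have siF := @semi_inner_form R P i.+1.
have dB a : form_dom (bubble a (V a).1).
  by have [H1 H2 H3 H4] := HV a; exact: acd_form_dom (acd_bubble H1 H3 H4).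
have dB1 := si_sum siF (index_enum idx) (fun=> 1) dB.
have du1 := form_dom_proj du0.
exists (fun x => u0 (diamond_proj x) + \sum_a 1 * bubble a (V a).1 x); first exact: (si_add siF).
move=> g dg; have Sg := continuous_mu_L2 dg.1.
rewrite (ip_addl siF)// form_proj// Hu0; last exact: form_dom_fiber_mean.
rewrite (ip_suml siF)//.
have E a : 1 * form (bubble a (V a).1) g =
    (Nprod P i.+1)%:R^-1 * ipL2 (I a.1) (lift (fiber_dev h) a.2) (lift (fiber_dev g) a.2).
  have [H1 H2 H3 H4] := HV a; rewrite mul1r (form_bubble H1 H2)//.
  have siI := semi_inner_ipL2 (segment_measurable (grid a.1) (grid a.1.+1)).
  have -> : (fun s => - q a s) = (fun s => -1 * q a s) by apply/funext => s; rewrite mulN1r.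
  rewrite (ip_scalel siI)//; first by rewrite mulN1r mulrN opprK.
  apply: (sqint_sub (@grid_angle_ge0 R P i.+1 a.1) (@grid_le_2pi R P i a.1)).
  by apply: (mu_L2_lift _).1; exact: mu_L2_fiber_dev.
rewrite (eq_bigr _ (fun a _ => E a)) sum_cells_ipL2//; last exact: mu_L2_fiber_dev.
by rewrite mu_inner_fiber_dev// addrC subrK.
Qed.

Lemma step_frame : spectral_frame step_freq step_mode.
Proof.
have [c0 dphi [M HM] eig pars ker _] := fr.
have Sphi m k := continuous_mu_L2 (dphi m k).1.
split.
- by case=> [k|a] /=; [exact: c0|exact: Jprod_gt0].
- by move=> m [k|a]; [exact: form_dom_proj|exact: form_dom_sine_mode].
- exists (`|M| + 2 * @sine_coef R P i) => m [k|a] x /=.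
    rewrite (le_trans (HM _ _ _))// (le_trans (ler_norm _))// lerDl mulr_ge0//.
    exact: sqrtr_ge0.
  by rewrite (le_trans (sine_mode_bounded _ _ _))// lerDr.
- move=> m [k|a] g dg /=; last exact: form_sine_mode.
  have Sg := continuous_mu_L2 dg.1.
  by rewrite form_proj// eig ?mu_inner_proj//; exact: form_dom_fiber_mean.
- move=> f Sf; have Sfm := mu_L2_fiber_mean Sf.
  rewrite (_ : series _ = (fun n => series (fun m => \sum_k mu_inner (fiber_mean f) (phi m k) ^+ 2) n +
      series (fun m => \sum_a mu_inner f (sine_mode m a) ^+ 2) n)); last first.
    apply/funext => n; rewrite /series /= -big_split; apply: eq_bigr => m _ /=.
    rewrite sum_sumE /=; congr (_ + _); apply: eq_bigr => k _.
    by rewrite (si_sym (semi_inner_mu _ _)) mu_inner_proj// (si_sym (semi_inner_mu _ _)).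
  rewrite -(subrK (mu_norm2 (fiber_mean f)) (mu_norm2 f)) [X in _ --> X]addrC.
  by apply: cvgD; [exact: pars|exact: sine_mode_parseval].
- move=> t x y t0.
  rewrite (_ : series _ = (fun n => series (fun m => \sum_k heat_weight (c k) m t *
       (phi m k (diamond_proj x) * phi m k (diamond_proj y))) n +
      series (fun m => \sum_a heat_weight J m t * (sine_mode m a x * sine_mode m a y)) n)); last first.
    by apply/funext => n; rewrite /series /= -big_split; apply: eq_bigr => m _; rewrite sum_sumE.
  have -> : @diamond_kernel R P i.+1 t x y = diamond_kernel t (diamond_proj x) (diamond_proj y) +
      bundle_coef (alpha_ x) (alpha_ y) *
      (circle_kernel (J%:R ^+ 2 * t) (J%:R * theta_ x) (J%:R * theta_ y) -
       circle_kernel (J%:R ^+ 2 * t) (J%:R * theta_ x) (- (J%:R * theta_ y))).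
    rewrite -[LHS]/(if ~~ same_bundle (alpha_ x) (alpha_ y) then _ else if _ then _ else _).
    rewrite /bundle_coef; case: (same_bundle (alpha_ x) (alpha_ y)); last by rewrite !mul0r addr0.
    rewrite [~~ true]/= mul1r.
    have [E|E] := eqVneq (alpha_ x) (alpha_ y); rewrite /= ?mulr1n ?mulr0n ?mulr1 ?mulr0//; congr (_ + _).
    by rewrite sub0r mulrN1 !mulNr.
  by apply: cvgD; [exact: ker|exact: sine_mode_kernel].
- exact: step_solve.
Qed.

End frame_step.

Lemma diamond_frame {R : realType} (P : diamond_params) (i : nat) :
  exists (K : finType) (c : K -> nat) (phi : nat -> K -> diamond R P i -> R),
    spectral_frame c phi.
Proof.
elim: i => [|i [K [c [phi fr]]]]; first by do 3 eexists; exact: circle_frame.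
by do 3 eexists; exact: step_frame fr.
Qed.

(** * The semigroup of a frame *)

Section limits.
Context {R : realType}.
Implicit Types (u b : nat -> R) (l B : R).

Lemma series_tail_le u b l B N : (forall m, `|u m| <= b m) ->
  series u @ \oo --> l -> series b @ \oo --> B -> `|l - series u N| <= B - series b N.
Proof.
move=> ub ul bB.
have H1 : (fun n => `|series u n - series u N|) @ \oo --> `|l - series u N|.
  by apply: cvg_norm; apply: cvgB => //; exact: cvg_cst.
have H2 : (fun n => series b n - series b N) @ \oo --> B - series b N.
  by apply: cvgB => //; exact: cvg_cst.
apply: ler_cvg_to H1 H2 _; near=> n.
have Nn : (N <= n)%N by near: n; exists N.
rewrite !sub_series_geq//; apply: le_trans (ler_norm_sum _ _ _) _.
by apply: ler_sum.
Unshelve. all: by end_near. Qed.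

Lemma series_tail_cvg0 b B : series b @ \oo --> B -> (fun N => B - series b N) @ \oo --> (0 : R).
Proof. by move=> bB; rewrite -(subrr B); apply: cvgB => //; exact: cvg_cst. Qed.

Lemma right_cvg_sum0 (I : Type) (r : seq I) (u : I -> R -> R) :
  (forall k, u k t @[t --> 0^'+] --> (0 : R)) -> \sum_(k <- r) u k t @[t --> 0^'+] --> (0 : R).
Proof.
move=> u0; have := @cvg_big R I +%R 0 predT add_continuous R (0^'+) r u (fun=> 0).
by rewrite big1//; apply=> k _; exact: u0.
Qed.

Lemma tannery (u : R -> nat -> R) (l : R -> R) b B :
  (forall t m, 0 < t -> `|u t m| <= b m) -> series b @ \oo --> B ->
  (forall m, u t m @[t --> 0^'+] --> (0 : R)) ->
  (forall t, 0 < t -> series (u t) @ \oo --> l t) ->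
  l t @[t --> 0^'+] --> (0 : R).
Proof.
move=> ub bB u0 ul; apply/cvgrPdist_le => e e0; have e2 : 0 < e / 2 by rewrite divr_gt0.
have /cvgrPdist_le/(_ _ e2)[N _ HN] := series_tail_cvg0 bB.
have {}HN := HN N (leqnn N).
have s0 : series (u t) N @[t --> 0^'+] --> (0 : R) by exact: right_cvg_sum0.
have /cvgrPdist_le/(_ _ e2) := s0; apply: filterS2; last exact: nbhs_right_gt.
move=> t t0; rewrite !sub0r !normrN => Hs.
have := series_tail_le N (fun m => ub t m t0) (ul t t0) bB.
move: HN; rewrite sub0r normrN => HN Ht.
have -> : l t = (l t - series (u t) N) + series (u t) N by rewrite subrK.
rewrite (le_trans (ler_normD _ _))// [e]splitr lerD//.
by rewrite (le_trans Ht)// (le_trans (ler_norm _)).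
Qed.

Lemma uniform_limit_continuous (T : topologicalType) (f : T -> R) (fN : nat -> T -> R) (e : nat -> R) :
  e @ \oo --> (0 : R) -> (forall N x, `|f x - fN N x| <= e N) -> (forall N, continuous (fN N)) ->
  continuous f.
Proof.
move=> e_0 fe cN x; apply/cvgrPdist_le => d d0; have d3 : 0 < d / 3 by rewrite divr_gt0.
have /cvgrPdist_le/(_ _ d3)[N _ HN] := e_0.
have {}HN : e N <= d / 3.
  by have := HN N (leqnn N); rewrite sub0r normrN; exact: le_trans (ler_norm _).
have /cvgrPdist_le/(_ _ d3) := cN N x; apply: filterS => y Hy.
have -> : f x - f y = (f x - fN N x) + (fN N x - fN N y) - (f y - fN N y) by ring.
have H1 := le_trans (fe N x) HN; have H2 := le_trans (fe N y) HN.
rewrite (le_trans (ler_normB _ _))// (_ : d = d / 3 + d / 3 + d / 3); last by field.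
by rewrite lerD// (le_trans (ler_normD _ _))// lerD.
Qed.

End limits.

Lemma continuous_section (T U V : topologicalType) (q : T -> U -> V) x :
  continuous (fun z : T * U => q z.1 z.2) -> continuous (q x).
Proof.
move=> cq y; have := cq (x, y).
move=> /(@continuous_comp _ _ _ (fun y : U => (x, y)) (fun z : T * U => q z.1 z.2) y).
by apply; apply: cvg_pair; [exact: cvg_cst|exact: cvg_id].
Qed.

(** * Tight frames *)

Section tight_frames.
Context {R : realType} {T : Type}.
Variables (S : (T -> R) -> Prop) (ip : (T -> R) -> (T -> R) -> R).
Hypothesis si : semi_inner S ip.
Variables (K : finType) (phi : nat -> K -> T -> R).
Hypothesis Sphi : forall m k, S (phi m k).
Hypothesis tight : forall f, S f ->
  series (fun m => \sum_k coef ip phi f m k ^+ 2) @ \oo --> ip f f.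
Local Notation coef := (coef ip phi).

Lemma coef_lin a f g m k : S f -> S g ->
  coef (fun x => a * f x + g x) m k = a * coef f m k + coef g m k.
Proof. by move=> Sf Sg; exact: (si_linl si). Qed.

Lemma coef_sub f g m k : S f -> S g ->
  coef (fun x => f x - g x) m k = coef f m k - coef g m k.
Proof. by move=> Sf Sg; exact: (ip_subl si). Qed.

(** Polarisation takes the place of an expansion in an orthonormal basis, and needs no orthogonality
    of the modes. *)
Lemma parseval_polarized f g : S f -> S g ->
  series (fun m => \sum_k coef f m k * coef g m k) @ \oo --> ip f g.
Proof.
move=> Sf Sg; have Sfg := si_add si Sf Sg; have Sf_g := si_sub si Sf Sg.
have -> : ip f g = 4^-1 * (ip (fun x => f x + g x) (fun x => f x + g x) -
    ip (fun x => f x - g x) (fun x => f x - g x)).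
  by rewrite (ip_addadd si)// (ip_subsub si)//; field.
have -> : series (fun m => \sum_k coef f m k * coef g m k) = (fun n => 4^-1 *
   (series (fun m => \sum_k coef (fun x => f x + g x) m k ^+ 2) n -
    series (fun m => \sum_k coef (fun x => f x - g x) m k ^+ 2) n)).
  apply/funext => n; rewrite /series /= -sumrB big_distrr; apply: eq_bigr => m _ /=.
  rewrite -sumrB big_distrr; apply: eq_bigr => k _ /=.
  rewrite coef_sub//; have -> : coef (fun x => f x + g x) m k = coef f m k + coef g m k by exact: (ip_addl si).
  by field.
by apply: cvgMr; apply: cvgB; exact: tight.
Qed.

Lemma sqr_coef_le f m k : S f -> coef f m k ^+ 2 <= ip f f.
Proof.
move=> Sf; apply: cvgr_to_ge (tight Sf) _.
exists m.+1 => // n /= mn; rewrite /series /= big_mkord.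
rewrite (bigD1 (Ordinal mn))//= (bigD1 k)//= -addrA lerDl addr_ge0//.
  by apply: sumr_ge0 => k' _; exact: sqr_ge0.
by apply: sumr_ge0 => m' _; apply: sumr_ge0 => k' _; exact: sqr_ge0.
Qed.

Lemma ip_of_coef f (a : nat -> K -> R) : S f -> (forall m k, coef f m k = a m k) ->
  series (fun m => \sum_k a m k ^+ 2) @ \oo --> ip f f.
Proof.
move=> Sf fa; have := tight Sf; rewrite (_ : series _ = series (fun m => \sum_k a m k ^+ 2))//.
by congr series; apply/funext => m; apply: eq_bigr => k _; rewrite fa.
Qed.

Lemma ip_eq0_of_coef f : S f -> (forall m k, coef f m k = 0) -> ip f f = 0.
Proof.
move=> Sf f0; apply: cvg_unique (ip_of_coef Sf f0) _; first exact: norm_hausdorff.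
rewrite (_ : series _ = fun=> 0); first exact: cvg_cst.
by apply/funext => n; rewrite /series /= big1// => m _; rewrite big1// => k _; rewrite expr0n.
Qed.

End tight_frames.

(** * The heat flow of a frame and its generator *)

Section heat_flow.
Context {R : realType} (P : diamond_params) (i : nat).
Local Notation F := (diamond R P i).
Variables (K : finType) (c : K -> nat) (phi : nat -> K -> F -> R).
Hypothesis fr : spectral_frame c phi.
Implicit Types (f g h : F -> R) (t : R).

Local Notation cf := (coef (@mu_inner R P i) phi).
Local Notation ev m k := ((c k * m)%:R ^+ 2 : R).
Local Notation hw m k t := (heat_weight (c k) m t).
Local Notation kernel := (@diamond_kernel R P i).

Let si := @semi_inner_mu R P i.
Let siF := @semi_inner_form R P i.

Lemma frame_L2 m k : mu_L2 (phi m k).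
Proof. exact: continuous_mu_L2 (frame_dom fr m k).1. Qed.

Let tight : forall f, mu_L2 f ->
  series (fun m => \sum_k cf f m k ^+ 2) @ \oo --> mu_inner f f.
Proof. exact: frame_parseval fr. Qed.

Lemma frame_orthogonal m k m' k' : ev m k != ev m' k' -> mu_inner (phi m k) (phi m' k') = 0.
Proof.
move=> ne; have E1 := frame_eigen fr m k (frame_dom fr m' k').
have E2 := frame_eigen fr m' k' (frame_dom fr m k).
apply/eqP; have : (ev m k - ev m' k') * mu_inner (phi m k) (phi m' k') = 0.
  by rewrite mulrBl -E1 (si_sym si) -E2 (si_sym siF) subrr.
by move/eqP; rewrite mulf_eq0 subr_eq0 (negbTE ne).
Qed.

(** Modes with a nonzero inner product have the same eigenvalue and hence the same weight. This lets
    a weight be moved from one mode to another inside a double sum. *)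
Lemma frame_coef_weight t m k m' k' :
  hw m' k' t * mu_inner (phi m k) (phi m' k') = hw m k t * mu_inner (phi m k) (phi m' k').
Proof.
have [E|/frame_orthogonal ->] := eqVneq (ev m k) (ev m' k'); last by rewrite !mulr0.
by rewrite /heat_weight E.
Qed.

Definition kernel_sum t (x : F) N : F -> R := partial_sum phi (fun m k => hw m k t * phi m k x) N.

(** The bound is uniform in both points. Joint continuity of the kernel rests on it, as the partial
    sums are continuous while the definition distinguishes cases by the coordinates. *)
Lemma kernel_tail t : 0 < t -> exists e : nat -> R,
  e @ \oo --> (0 : R) /\ forall N x y, `|kernel t x y - kernel_sum t x N y| <= e N.
Proof.
move=> t0; have [M HM] := frame_bounded fr.
have M0 (k : K) : 0 <= M by exact: le_trans (normr_ge0 _) (HM 0%N k (diamond_point 0 (word0 P i))).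
pose b := geometric (#|K|%:R * M ^+ 2) (expR (- t)).
have bc : cvgn (series b).
  by apply: is_cvg_geometric_series; rewrite ger0_norm ?expR_ge0// -expR0 ltr_expR oppr_lt0.
exists (fun N => limn (series b) - series b N); split; first exact: series_tail_cvg0.
move=> N x y; have := @series_tail_le R _ b _ _ N _ (@frame_kernel _ _ _ _ _ _ fr t x y t0) bc.
rewrite /kernel_sum /partial_sum (sum_pairE N (fun m k => hw m k t * phi m k x * phi m k y)).
have -> : series (fun m => \sum_k hw m k t * phi m k x * phi m k y) N =
    series (fun m => \sum_k hw m k t * (phi m k x * phi m k y)) N.
  by congr (series _ N); apply/funext => m; apply: eq_bigr => k _; rewrite mulrA.
apply => m; rewrite (le_trans (ler_norm_sum _ _ _))// /b /geometric /=.
rewrite mulrAC -mulrA mulr_natl -sumr_const; apply: ler_sum => k _.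
rewrite normrM ger0_norm ?expR_ge0//; apply: ler_pM; rewrite ?expR_ge0//.
  by apply: heat_weight_le_geometric; [exact: ltW|exact: (frame_freq_gt0 fr)].
by rewrite normrM expr2 ler_pM.
Qed.

Lemma kernel_continuous t : 0 < t -> continuous (fun z : F * F => kernel t z.1 z.2).
Proof.
move=> t0; have [e [e_0 He]] := kernel_tail t0.
apply: (uniform_limit_continuous e_0 (fN := fun N z => kernel_sum t z.1 N z.2)) => //.
move=> N; apply: continuous_big => [|a _]; first exact: add_continuous.
have cphi := (frame_dom fr a.1 a.2).1.
move=> z; apply: cvgM; first apply: cvgM; first exact: cvg_cst.
  by apply: continuous_cvg; [exact: cphi|exact: cvg_fst].
by apply: continuous_cvg; [exact: cphi|exact: cvg_snd].
Qed.

Lemma kernel_section_continuous t x : 0 < t -> continuous (kernel t x).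
Proof. by move=> t0; apply: continuous_section; exact: kernel_continuous. Qed.

Lemma kernel_L2 t x : 0 < t -> mu_L2 (kernel t x).
Proof. by move=> t0; apply: continuous_mu_L2; exact: kernel_section_continuous. Qed.

Definition heat_flow t f : F -> R := fun x => mu_inner (kernel t x) f.

Definition flow_sum t f N : F -> R := partial_sum phi (fun m k => hw m k t * cf f m k) N.

Lemma kernel_sum_L2 t x N : mu_L2 (kernel_sum t x N).
Proof. exact: (S_partial_sum si frame_L2). Qed.

Lemma flow_sum_L2 t f N : mu_L2 (flow_sum t f N).
Proof. exact: (S_partial_sum si frame_L2). Qed.

Lemma flow_tail t f : 0 < t -> mu_L2 f -> exists e : nat -> R,
  e @ \oo --> (0 : R) /\ forall N x, `|heat_flow t f x - flow_sum t f N x| <= e N.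
Proof.
move=> t0 Sf; have [e [e_0 He]] := kernel_tail t0.
pose C := Num.sqrt (@mu_mass R P i) * seminorm (@mu_inner R P i) f.
exists (fun N => e N * C); split; first by rewrite -(mul0r C); apply: cvgMl.
move=> N x.
have -> : flow_sum t f N x = mu_inner (kernel_sum t x N) f.
  rewrite (ip_partial_sum si frame_L2)// /flow_sum /partial_sum.
  rewrite (sum_pairE N (fun m k => hw m k t * cf f m k * phi m k x)).
  by congr (series _ N); apply/funext => m; apply: eq_bigr => k _; ring.
have SK := kernel_sum_L2 t x N; have Sk := kernel_L2 x t0.
rewrite -(ip_subl si)//; apply: (le_trans (ip_le_seminorm si (si_sub si Sk SK) Sf)).
rewrite mulrA ler_wpM2r ?seminorm_ge0//.
by apply: seminorm_uniform; [exact: (si_sub si)|exact: He].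
Qed.

Lemma heat_flow_continuous t f : 0 < t -> mu_L2 f -> continuous (heat_flow t f).
Proof.
move=> t0 Sf; have [e [e_0 He]] := flow_tail t0 Sf.
apply: (uniform_limit_continuous e_0 He) => N.
apply: continuous_big => [|a _]; first exact: add_continuous.
by move=> x; apply: cvgM; [exact: cvg_cst|exact: (frame_dom fr a.1 a.2).1].
Qed.

Lemma heat_flow_L2 t f : 0 < t -> mu_L2 f -> mu_L2 (heat_flow t f).
Proof. by move=> t0 Sf; apply: continuous_mu_L2; exact: heat_flow_continuous. Qed.

(** The modes are not orthogonal, so a coefficient of a partial sum involves the whole Gram matrix.
    [frame_coef_weight] pulls the exponential out of it, and the rest is the polarised Parseval
    identity. *)
Lemma coef_heat_flow t f m k : 0 < t -> mu_L2 f -> cf (heat_flow t f) m k = hw m k t * cf f m k.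
Proof.
move=> t0 Sf; have [e [e_0 He]] := flow_tail t0 Sf.
have SH := heat_flow_L2 t0 Sf; have Sm := frame_L2 m k.
have SN := flow_sum_L2 t f.
have L1 : mu_inner (flow_sum t f N) (phi m k) @[N --> \oo] --> cf (heat_flow t f) m k.
  apply: (cvg_ip si) => //.
  pose C := Num.sqrt (@mu_mass R P i).
  have C0 : (fun N => e N * C) @ \oo --> (0 : R) by rewrite -(mul0r C); apply: cvgMl.
  apply: squeeze_cvgr (cvg_cst 0) C0; near=> N.
  by rewrite seminorm_ge0/=; apply: seminorm_uniform; [exact: (si_sub si)|exact: He].
apply: cvg_unique L1 _; first exact: norm_hausdorff.
have -> : (fun N => mu_inner (flow_sum t f N) (phi m k)) =
    (fun N => hw m k t * series (fun m' => \sum_k' cf f m' k' * cf (phi m k) m' k') N).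
  apply/funext => N; rewrite (ip_partial_sum si frame_L2)// /series /= big_distrr.
  apply: eq_bigr => m' _ /=; rewrite big_distrr; apply: eq_bigr => k' _ /=.
  have := frame_coef_weight t m k m' k'; rewrite -[mu_inner _ _]/(cf (phi m k) m' k') => E.
  by rewrite mulrAC E; ring.
by apply: cvgMr; exact: (parseval_polarized si frame_L2 tight).
Unshelve. all: by end_near. Qed.

Lemma mu_ae_eq_of_coef f g : mu_L2 f -> mu_L2 g -> (forall m k, cf f m k = cf g m k) -> mu_ae_eq f g.
Proof.
move=> Sf Sg fg; apply/mu_ae_eq_norm => //.
apply: (ip_eq0_of_coef tight); first exact: (si_sub si).
by move=> m k; rewrite (coef_sub si frame_L2)// fg subrr.
Qed.

Lemma coef_eigen f u h m k : mu_ae_eq u f -> mu_L2 f -> form_dom u -> mu_L2 h ->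
  (forall g, form_dom g -> form u g = mu_inner h g) -> cf h m k = ev m k * cf f m k.
Proof.
move=> uf Sf du Sh H; have Su := continuous_mu_L2 du.1; have Sm := frame_L2 m k.
rewrite /coef -H; last exact: frame_dom fr m k.
rewrite (si_sym siF) (frame_eigen fr m k du) (si_sym si); congr (_ * _).
apply/eqP; rewrite -subr_eq0 -(ip_subl si)//; apply/eqP; apply: (ip_null si) => //.
  exact: (si_sub si).
exact/mu_ae_eq_norm.
Qed.

(* The solution of A u = h given by [frame_solve] has the coefficients of [f]
   except for the eigenvalue 0, where it is corrected by [w]. *)
Lemma generator_solve f h : mu_L2 f -> mu_L2 h -> (forall m k, cf h m k = ev m k * cf f m k) ->
  operator_graph f h.
Proof.
move=> Sf Sh H; split => //.
have [|u du Hu] := frame_solve fr Sh.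
  by move=> k; have := H 0%N k; rewrite muln0 expr0n mul0r.
have Su := continuous_mu_L2 du.1.
pose g x := f x - u x; have Sg : mu_L2 g by exact: (si_sub si).
have ug m k : (0 < m)%N -> cf g m k = 0.
  move=> m0; rewrite /g (coef_sub si frame_L2)//; apply/eqP; rewrite subr_eq0; apply/eqP.
  have e0 : ev m k != 0.
    by rewrite sqrf_eq0 pnatr_eq0 muln_eq0 negb_or -!lt0n m0 (frame_freq_gt0 fr).
  apply: (mulfI e0); rewrite -H -(@coef_eigen u u h)//.
  by move=> a; exact: aeW.
pose w x := \sum_k cf g 0%N k * phi 0%N k x.
have dphi k := frame_dom fr 0%N k.
have dw : form_dom w by exact: (si_sum siF).
have Sw := continuous_mu_L2 dw.1.
have wg m k : cf w m k = cf g m k.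
  rewrite /coef /w (ip_suml si)//; [|by move=> k'; exact: frame_L2|exact: frame_L2].
  (* As [g] has no coefficients with m > 0, its Parseval expansion against a mode stops after index
     0 and is the coefficient of [w]. *)
  have := @parseval_polarized _ _ _ _ si _ _ frame_L2 tight _ _ Sg (frame_L2 m k).
  set l := \sum_k' _ => L; suff L' : series (fun m' => \sum_k' cf g m' k' * cf (phi m k) m' k') @ \oo --> l.
    by apply: cvg_unique L' L; exact: norm_hausdorff.
  rewrite -cvg_shiftS.
  rewrite (_ : (fun n => _) = fun=> l); first exact: cvg_cst.
  apply/funext => n; rewrite /series /= big_nat_recl// [X in _ + X]big1 ?addr0; last first.
    by move=> m' _; apply: big1 => k' _; rewrite ug// mul0r.
  by apply: eq_bigr => k' _; rewrite [cf (phi m k) _ _](si_sym si).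
exists (fun x => u x + w x); split.
- apply: mu_ae_eq_of_coef => //; first exact: (si_add si).
  move=> m k; rewrite /coef (ip_addl si)//; last exact: frame_L2.
  rewrite -![mu_inner _ (phi m k)]/(cf _ m k) wg /g (coef_sub si frame_L2)//.
  by rewrite addrC subrK.
- exact: (si_add siF).
- move=> v dv; rewrite (ip_addl siF)// Hu// (ip_suml siF)// big1 ?addr0// => k _.
  by rewrite (frame_eigen fr 0%N k dv) muln0 expr0n !mul0r mulr0.
Qed.

Lemma mu_norm2_coef f (a : nat -> K -> R) : mu_L2 f -> (forall m k, cf f m k = a m k) ->
  series (fun m => \sum_k a m k ^+ 2) @ \oo --> mu_norm2 f.
Proof. exact: (ip_of_coef tight). Qed.

Lemma expRN_bounds (s : R) : 0 <= s -> 1 - s <= expR (- s) <= 1 - s + s ^+ 2.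
Proof.
move=> s0; rewrite expR_ge1Dx/=; have s1 : 0 < 1 + s by rewrite ltr_pwDl.
(* exp(-s) <= 1 / (1 + s) <= 1 - s + s^2, the last since (1 - s + s^2)(1 + s) = 1 + s^3. *)
rewrite expRN; apply: (@le_trans _ _ (1 + s)^-1).
  by rewrite lef_pV2 ?posrE ?expR_gt0// expR_ge1Dx.
rewrite -[leLHS]mul1r ler_pdivrMr//.
have -> : (1 - s + s ^+ 2) * (1 + s) = 1 + s ^+ 3 by ring.
by rewrite lerDl exprn_ge0.
Qed.

(** The first bound does not depend on [t] and dominates the series in [tannery]; the second gives
    the limit at 0 and the rate used for uniqueness. *)
Lemma expRN_slope (l t : R) : 0 <= l -> 0 < t ->
  `|(1 - expR (- (l * t))) / t - l| <= l /\ `|(1 - expR (- (l * t))) / t - l| <= l ^+ 2 * t.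
Proof.
move=> l0 t0; have lt0 : 0 <= l * t by rewrite mulr_ge0// ltW.
have /andP[H1 H2] := expRN_bounds lt0.
have H3 : expR (- (l * t)) <= 1 by rewrite -expR0 ler_expR oppr_le0.
have -> : (1 - expR (- (l * t))) / t - l = - ((expR (- (l * t)) - (1 - l * t)) / t).
  by field; rewrite gt_eqF.
rewrite normrN ger0_norm; last by rewrite divr_ge0 ?subr_ge0// ltW.
by rewrite !ler_pdivrMr//; split; [lra|rewrite (_ : l ^+ 2 * t * t = (l * t) ^+ 2); [lra|ring]].
Qed.

Lemma linear_right_cvg0 (a : R) : a * t @[t --> 0^'+] --> (0 : R).
Proof.
rewrite -[X in _ --> X](mulr0 a); apply: cvgMr; apply: cvg_at_right_filter; exact: cvg_id.
Qed.

Lemma expRN_slope_cvg0 (l : R) : 0 <= l ->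
  (1 - expR (- (l * t))) / t - l @[t --> 0^'+] --> (0 : R).
Proof.
move=> l0; apply: norm_cvg0.
apply: squeeze_cvgr (cvg_cst 0) (linear_right_cvg0 (l ^+ 2)).
near=> t; rewrite normr_ge0/=; apply: (expRN_slope l0 _).2.
by near: t; exact: nbhs_right_gt.
Unshelve. all: by end_near. Qed.

Lemma heat_weight_gap (t : R) (a m : nat) : 0 <= t ->
  0 <= 1 - heat_weight a m t <= (a * m)%:R ^+ 2 * t.
Proof.
move=> t0; rewrite subr_ge0 -{1}expR0 ler_expR oppr_le0 mulr_ge0 ?sqr_ge0//=.
have := expR_ge1Dx (- ((a * m)%:R ^+ 2 * t)); rewrite /heat_weight; lra.
Qed.

Lemma heat_weight_gap_cvg0 (a m : nat) : 1 - heat_weight a m t @[t --> 0^'+] --> (0 : R).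
Proof.
apply: squeeze_cvgr (cvg_cst 0) (linear_right_cvg0 ((a * m)%:R ^+ 2)).
near=> t; apply: heat_weight_gap; apply: ltW.
by near: t; exact: nbhs_right_gt.
Unshelve. all: by end_near. Qed.

Lemma exp_semigroup_heat_flow : is_exp_semigroup heat_flow.
Proof.
have cfS := coef_sub si frame_L2.
split.
- exact: heat_flow_L2.
- move=> t a f g t0 Sf Sg; have Sfg := si_lin si a Sf Sg.
  have Hf := heat_flow_L2 t0 Sf; have Hg := heat_flow_L2 t0 Sg.
  apply: mu_ae_eq_of_coef; [exact: heat_flow_L2|exact: (si_lin si)|].
  move=> m k; rewrite coef_heat_flow// !(coef_lin si frame_L2)// !coef_heat_flow//.
  by ring.
- move=> t f t0 Sf; have Hf := heat_flow_L2 t0 Sf.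
  apply: ler_cvg_to (tight Hf) (tight Sf) _; near=> n.
  apply: ler_sum => m _; apply: ler_sum => k _.
  rewrite coef_heat_flow// exprMn ler_piMl ?sqr_ge0// expr_le1 ?expR_ge0//.
  by rewrite -subr_ge0; have /andP[] := heat_weight_gap (c k) m (ltW t0).
- move=> s t f s0 t0 Sf; have st0 := addr_gt0 s0 t0; have Hf := heat_flow_L2 t0 Sf.
  apply: mu_ae_eq_of_coef; [exact: heat_flow_L2|exact: heat_flow_L2|].
  move=> m k; rewrite !coef_heat_flow// mulrA; congr (_ * _).
  by rewrite /heat_weight -expRD; congr expR; ring.
- move=> f Sf.
  apply: (@tannery R (fun t m => \sum_k ((hw m k t - 1) * cf f m k) ^+ 2) _ _ _ _ (tight Sf)).
  + move=> t m t0; rewrite ger0_norm; last by apply: sumr_ge0 => k _; exact: sqr_ge0.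
    apply: ler_sum => k _; rewrite exprMn ler_piMl ?sqr_ge0// -sqrrN opprB.
    have /andP[h0 _] := heat_weight_gap (c k) m (ltW t0).
    by rewrite expr_le1// lerBlDr lerDl expR_ge0.
  + move=> m; apply: right_cvg_sum0 => k.
    have -> : (fun t => ((hw m k t - 1) * cf f m k) ^+ 2) =
        (fun t => (1 - hw m k t) * ((1 - hw m k t) * cf f m k ^+ 2)).
      by apply/funext => t; ring.
    rewrite -[X in _ --> X](mul0r (0 * cf f m k ^+ 2)); apply: cvgM; first exact: heat_weight_gap_cvg0.
    by apply: cvgMl; exact: heat_weight_gap_cvg0.
  + move=> t t0; have Hf := heat_flow_L2 t0 Sf.
    apply: mu_norm2_coef; first exact: (si_sub si).
    by move=> m k; rewrite cfS// coef_heat_flow//; ring.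
- move=> f h Sf Sh.
  have E t : (fun x => (f x - heat_flow t f x) / t - h x) =
      (fun x => t^-1 * (f x - heat_flow t f x) - h x).
    by apply/funext => x; rewrite mulrC.
  have Sd t : 0 < t -> mu_L2 (fun x => t^-1 * (f x - heat_flow t f x)).
    by move=> t0; apply: (si_scale si); apply: (si_sub si) => //; exact: heat_flow_L2.
  have dL2 t : 0 < t -> mu_L2 (fun x => (f x - heat_flow t f x) / t - h x).
    by move=> t0; rewrite E; apply: (si_sub si) => //; exact: Sd.
  have coefE t m k : 0 < t -> cf (fun x => (f x - heat_flow t f x) / t - h x) m k =
      (1 - hw m k t) / t * cf f m k - cf h m k.
    move=> t0; have Hf := heat_flow_L2 t0 Sf; have Sm := frame_L2 m k.
    rewrite E cfS//; last exact: Sd.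
    rewrite {1}/coef (ip_scalel si)//; last exact: (si_sub si).
    by rewrite -[mu_inner _ _]/(cf _ m k) cfS// coef_heat_flow//; ring.
  split.
    move=> [_ _ [u [uf du Hu]]].
    have ch m k : cf h m k = ev m k * cf f m k by exact: coef_eigen uf Sf du Sh Hu.
    (* The coefficients of [h] are the eigenvalue times those of [f], so the uniform slope bound
       dominates the terms by the summable squares of the coefficients of [h]. *)
    apply: (@tannery R (fun t m => \sum_k (((1 - hw m k t) / t - ev m k) * cf f m k) ^+ 2)
      _ _ _ _ (tight Sh)).
    + move=> t m t0; rewrite ger0_norm; last by apply: sumr_ge0 => k _; exact: sqr_ge0.
      apply: ler_sum => k _; rewrite ch !exprMn ler_wpM2r ?sqr_ge0//.
      have [H _] := expRN_slope (sqr_ge0 _ : 0 <= ev m k) t0.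
      rewrite -real_normK ?num_real//; apply: lerXn2r H; rewrite ?nnegrE ?sqr_ge0//.
    + move=> m; apply: right_cvg_sum0 => k.
      pose s t := (1 - hw m k t) / t - ev m k.
      have -> : (fun t => (((1 - hw m k t) / t - ev m k) * cf f m k) ^+ 2) =
          (fun t => s t * (s t * cf f m k ^+ 2)).
        by apply/funext => t; rewrite /s; ring.
      have s0 : s t @[t --> 0^'+] --> (0 : R) by apply: expRN_slope_cvg0; exact: sqr_ge0.
      by rewrite -[X in _ --> X](mul0r (0 * cf f m k ^+ 2)); apply: cvgM => //; apply: cvgMl.
    + move=> t t0; apply: mu_norm2_coef; first exact: dL2.
      by move=> m k; rewrite coefE// ch; ring.
  move=> L; apply: generator_solve => // m k.
  (* The squared norm bounds the square of each coefficient, so convergence in norm passes to every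
     coefficient. *)
  have Hc : ((1 - hw m k t) / t * cf f m k - cf h m k) ^+ 2 @[t --> 0^'+] --> (0 : R).
    apply: squeeze_cvgr (cvg_cst 0) L; near=> t; rewrite sqr_ge0/=.
    have t0 : 0 < t by near: t; exact: nbhs_right_gt.
    by rewrite -coefE//; apply: (sqr_coef_le tight); exact: dL2.
  have Hl : ((1 - hw m k t) / t * cf f m k - cf h m k) ^+ 2 @[t --> 0^'+] -->
      (ev m k * cf f m k - cf h m k) ^+ 2.
    have s0 : (1 - hw m k t) / t @[t --> 0^'+] --> ev m k.
      have := @expRN_slope_cvg0 (ev m k) (sqr_ge0 _).
      by move/subr_cvg0.
    rewrite expr2; apply: cvgM; apply: cvgB; try exact: cvg_cst.
      by apply: cvgMl.
    by apply: cvgMl.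
  have /eqP : (ev m k * cf f m k - cf h m k) ^+ 2 = 0.
    by apply: cvg_unique Hl Hc; exact: norm_hausdorff.
  by rewrite sqrf_eq0 subr_eq0 => /eqP <-.
Unshelve. all: by end_near. Qed.

End heat_flow.

(** * Uniqueness of the heat kernel *)

Section uniqueness.
Context {R : realType} (P : diamond_params) (i : nat).
Local Notation F := (diamond R P i).
Implicit Types (f g h : F -> R) (T : R -> (F -> R) -> F -> R) (l s t : R).

Local Notation nrm := (seminorm (@mu_inner R P i)).
Let si := @semi_inner_mu R P i.

Lemma seminorm_triangle f g h : mu_L2 f -> mu_L2 g -> mu_L2 h ->
  nrm (fun x => f x - h x) <= nrm (fun x => f x - g x) + nrm (fun x => g x - h x).
Proof.
move=> Sf Sg Sh; have := seminorm_add si (si_sub si Sf Sg) (si_sub si Sg Sh).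
rewrite (_ : (fun x => f x - g x + (g x - h x)) = (fun x => f x - h x))//.
by apply/funext => x; ring.
Qed.

Lemma mu_ae_eq_seminorm f g : mu_L2 f -> mu_L2 g ->
  mu_ae_eq f g <-> nrm (fun x => f x - g x) <= 0.
Proof.
move=> Sf Sg; split => [/(mu_ae_eq_norm Sf Sg) E|]; last first.
  by move/(seminorm_eq0 si) => E; apply/mu_ae_eq_norm.
by apply: (seminorm_le si) => //; rewrite expr0n /= -[leLHS]/(mu_norm2 _) E.
Qed.

Section eigenfunction.
Variables (T : R -> (F -> R) -> F -> R) (HT : is_exp_semigroup T).
Variables (psi : F -> R) (l : R).
Hypotheses (dpsi : form_dom psi) (l0 : 0 <= l).
Hypothesis eigen : forall g, form_dom g -> form psi g = l * mu_inner psi g.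

Let Spsi : mu_L2 psi. Proof. exact: continuous_mu_L2 dpsi.1. Qed.

Let drift t := nrm (fun x => T t psi x - expR (- (l * t)) * psi x).

(** T_(s+t) psi - e^(-l(s+t)) psi is e^(-lt) times the deviation at time s, plus T_s applied to the
    deviation [r] at time t. The scalar is at most 1 and T_s is a contraction. *)
Lemma drift_subadditive s t : 0 < s -> 0 < t -> drift (s + t) <= drift s + drift t.
Proof.
move=> s0 t0; have st0 := addr_gt0 s0 t0; have ST r := expA_L2 HT (t := r).
pose e := expR (- (l * t)); pose r x := T t psi x - e * psi x.
have Sps a : mu_L2 (fun x => a * psi x) by exact: (si_scale si).
have Tt := ST t psi t0 Spsi; have Ts := ST s psi s0 Spsi; have Tst := ST _ psi st0 Spsi.
have Sr : mu_L2 r by exact: (si_sub si).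
have Tsr := ST s r s0 Sr; have TsTt := ST s _ s0 Tt.
have Slin : mu_L2 (fun x => e * T s psi x + T s r x) by exact: (si_lin si).
(* The semigroup law and linearity hold only a.e.; each is read as a distance at most 0 and inserted
   by the triangle inequality. *)
have H1 := (mu_ae_eq_seminorm Tst TsTt).1 (expA_semigroup HT s0 t0 Spsi).
have H2 := expA_linear HT e s0 Spsi Sr.
rewrite (_ : (fun x => e * psi x + r x) = T t psi) in H2; last first.
  by apply/funext => x; rewrite /r addrC subrK.
have {}H2 := (mu_ae_eq_seminorm TsTt Slin).1 H2.
apply: (le_trans (seminorm_triangle Tst TsTt (Sps _))).
rewrite -[leRHS]add0r; apply: lerD; first exact: H1.
apply: (le_trans (seminorm_triangle TsTt Slin (Sps _))).
rewrite -[leRHS]add0r; apply: lerD; first exact: H2.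
have Sd : mu_L2 (fun x => T s psi x - expR (- (l * s)) * psi x) by exact: (si_sub si).
have -> : (fun x => e * T s psi x + T s r x - expR (- (l * (s + t))) * psi x) =
    (fun x => e * (T s psi x - expR (- (l * s)) * psi x) + T s r x).
  apply/funext => x; rewrite (_ : - (l * (s + t)) = - (l * t) + - (l * s)); last by ring.
  by rewrite expRD -/e; ring.
apply: (le_trans (seminorm_add si (si_scale si e Sd) Tsr)); apply: lerD.
  rewrite (seminorm_scale si)// ger0_norm ?expR_ge0// ler_piMl ?seminorm_ge0//.
  by rewrite -expR0 ler_expR oppr_le0 mulr_ge0// ltW.
by apply: ler_wsqrtr; exact: expA_contraction HT _ _ s0 Sr.
Qed.

Lemma drift_natmul n t : 0 < t -> drift (n.+1%:R * t) <= n.+1%:R * drift t.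
Proof.
move=> t0; elim: n => [|n IH]; first by rewrite !mul1r.
rewrite -[n.+2%:R]natr1 !mulrDl !mul1r (le_trans (drift_subadditive _ _))// ?lerD//.
by rewrite mulr_gt0.
Qed.

Lemma drift_small e : 0 < e -> \forall t \near 0^'+, drift t <= t * e.
Proof.
move=> e0; have e2 : 0 < e / 2 by rewrite divr_gt0.
have Sl : mu_L2 (fun x => l * psi x) by exact: (si_scale si).
have gr : operator_graph psi (fun x => l * psi x).
  split => //; exists psi; split => //; first by move=> a; exact: aeW.
  by move=> g dg; rewrite eigen// (ip_scalel si)//; exact: continuous_mu_L2 dg.1.
have /cvgrPdist_le/(_ ((e / 2) ^+ 2)) := (expA_generator HT Spsi Sl).1 gr.
move=> /(_ (exprn_gt0 2 e2)) N1.
have /cvgrPdist_le/(_ (e / 2) e2) := linear_right_cvg0 (l ^+ 2 * nrm psi).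
apply: filterS3 N1 (nbhs_right_gt 0); move=> t; rewrite !sub0r !normrN => H1 t0 H2.
have Tt := expA_L2 HT t0 Spsi.
pose v x := (psi x - T t psi x) / t - l * psi x.
have Sv : mu_L2 v.
  apply: (si_sub si) => //; rewrite (_ : (fun x => _) = (fun x => t^-1 * (psi x - T t psi x))).
    by apply: (si_scale si); exact: (si_sub si).
  by apply/funext => x; rewrite mulrC.
have nv : nrm v <= e / 2.
  by apply: (seminorm_le si); [exact: ltW|exact: le_trans (ler_norm _) H1].
pose a := (1 - expR (- (l * t))) / t - l.
(* [v] is the error of the difference quotient of the semigroup and [a] that of the scalar
   exponential; the eigenvalue terms cancel in their difference. *)
rewrite /drift (_ : (fun x => _) = (fun x => - t * (v x + - a * psi x))); last first.
  by apply/funext => x; rewrite /v /a; field; rewrite gt_eqF.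
have Sap : mu_L2 (fun x => - a * psi x) by exact: (si_scale si).
rewrite (seminorm_scale si); last exact: (si_add si).
rewrite normrN gtr0_norm// ler_pM2l// (le_trans (seminorm_add si Sv Sap))//.
rewrite [e]splitr lerD// (seminorm_scale si)// normrN.
apply: le_trans (le_trans (ler_norm _) H2).
by rewrite mulrAC ler_wpM2r ?seminorm_ge0//; exact: (expRN_slope l0 t0).2.
Qed.

Lemma semigroup_eigenfunction t : 0 < t -> mu_ae_eq (T t psi) (fun x => expR (- (l * t)) * psi x).
Proof.
move=> t0; have Tt := expA_L2 HT t0 Spsi.
apply/(mu_ae_eq_seminorm Tt); first exact: (si_scale si).
rewrite -/(drift t); apply/ler_addgt0Pr => e e0; rewrite add0r.
have et : 0 < e / t by rewrite divr_gt0.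
have [d /= d0 Hd] := drift_small et.
(* So many steps that each lasts less than [d]: every step then contributes at most its length times
   e / t, in total e. *)
have [n nd] : exists n : nat, t / d < n.+1%:R.
  by exists (Num.truncn (t / d)); exact: truncnS_gt.
have n0 : 0 < n.+1%:R :> R by rewrite ltr0n.
pose s := t / n.+1%:R; have s0 : 0 < s by rewrite divr_gt0.
have tE : t = n.+1%:R * s by rewrite /s mulrC divfK// gt_eqF.
rewrite tE (le_trans (drift_natmul n s0))//.
have -> : e = n.+1%:R * (s * (e / t)).
  by rewrite mulrA -tE mulrC divfK// gt_eqF.
rewrite ler_pM2l// Hd//= /ball/= sub0r normrN gtr0_norm// /s ltr_pdivrMr//.
by rewrite mulrC -ltr_pdivrMr.
Qed.

End eigenfunction.

(** By compactness, joint continuity of [q] makes the sections [q z] converge uniformly to [q x] as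
    z tends to x; Cauchy-Schwarz does the rest. *)
Lemma kernel_inner_continuous (q : F -> F -> R) f : mu_L2 f ->
  continuous (fun z : F * F => q z.1 z.2) -> continuous (fun x => mu_inner (q x) f).
Proof.
move=> Sf cq x; have cq1 z : continuous (q z) by exact: continuous_section.
have Sq z : mu_L2 (q z) by exact: continuous_mu_L2 (cq1 z).
pose C := Num.sqrt (@mu_mass R P i) * nrm f.
have C0 : 0 <= C by rewrite mulr_ge0 ?seminorm_ge0// sqrtr_ge0.
apply/cvgrPdist_le => e e0.
pose d := e / (C + 1); have d0 : 0 < d by rewrite divr_gt0// ltr_wpDl.
have : \forall z \near x, forall y, [set: F] y -> `|q x y - q z y| <= d.
  have /compact_near_coveringP/(_ F (nbhs x) (fun z y => `|q x y - q z y| <= d)) := @diamond_compact R P i.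
  apply => y _; have d2 : 0 < d / 2 by rewrite divr_gt0.
  have /cvgrPdist_le/(_ _ d2) N1 := cq1 x y.
  have /cvgrPdist_le/(_ _ d2)[[U V] /= [Ux Vy] HUV] := cq (x, y).
  exists ((fun y' => `|q x y - q x y'| <= d / 2) `&` V, U); first by split => //=; exact: filterI.
  move=> [y' z] /= [[H1 Vy'] Uz].
  have H2 := HUV (z, y') (conj Uz Vy'); rewrite /= in H2.
  rewrite (_ : q x y' - q z y' = (q x y - q z y') - (q x y - q x y')); last by ring.
  by rewrite (le_trans (ler_normB _ _))// [d]splitr lerD.
apply: filterS => z Hz.
have Sd : mu_L2 (fun y => q x y - q z y) by exact: (si_sub si).
rewrite -(ip_subl si)//; apply: (le_trans (ip_le_seminorm si Sd Sf)).
have H1 := seminorm_uniform Sd (fun y => Hz y I).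
apply: (@le_trans _ _ (d * C)); first by rewrite mulrA ler_wpM2r ?seminorm_ge0.
by rewrite /d mulrAC ler_pdivrMr ?ltr_wpDl// ler_pM2l// lerDl.
Qed.

Variables (K : finType) (c : K -> nat) (phi : nat -> K -> F -> R).
Hypothesis fr : spectral_frame c phi.

(** Applied to an eigenfunction, the semigroup is known a.e. in x. Both sides are continuous in x,
    so the identity holds at every point; this is how the frame coefficients of each single section
    are determined. *)
Lemma coef_kernel T (q : F -> F -> R) t m k : is_exp_semigroup T -> 0 < t ->
  continuous (fun z : F * F => q z.1 z.2) ->
  (forall f, mu_L2 f -> mu_ae_eq (T t f) (fun x => mu_inner (q x) f)) ->
  forall x, mu_inner (q x) (phi m k) = heat_weight (c k) m t * phi m k x.
Proof.
move=> HT t0 cq Tq; have dphi := frame_dom fr m k; have Sphi := continuous_mu_L2 dphi.1.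
have cI := kernel_inner_continuous Sphi cq.
have cw : continuous (fun x => heat_weight (c k) m t * phi m k x).
  by move=> x; apply: cvgMr; exact: dphi.1.
apply: mu_ae_eq_continuous => // a.
have E1 := Tq _ Sphi a.
have E2 := semigroup_eigenfunction HT dphi (sqr_ge0 (c k * m)%:R) (frame_eigen fr m k) t0 a.
by apply: ae_lebesgueS2 E1 E2 => s E1 E2 s0L; rewrite -E1// E2.
Qed.

Lemma heat_kernel_unique (p : R -> F -> F -> R) t x y : is_heat_kernel p -> 0 < t ->
  p t x y = diamond_kernel t x y.
Proof.
move=> [cp [T [HT Tp]]] t0.
have ck := kernel_continuous fr t0.
have cpx := continuous_section (x := x) (cp t t0); have ckx := continuous_section (x := x) ck.
apply: (mu_ae_eq_continuous cpx ckx).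
apply: (mu_ae_eq_of_coef fr); [exact: continuous_mu_L2|exact: continuous_mu_L2|].
move=> m k; rewrite /coef (coef_kernel m k HT t0 (cp t t0)); last by move=> f; exact: Tp.
rewrite (coef_kernel m k (exp_semigroup_heat_flow fr) t0 ck)//.
by move=> f _ a; exact: aeW.
Qed.

End uniqueness.

Theorem theorem3p2 (R : realType) (P : diamond_params) (i : nat)
    (hi : (1 <= i)%N) (p : R -> diamond R P i -> diamond R P i -> R) :
  is_heat_kernel p <->
  forall (t : R) (x y : diamond R P i), 0 < t ->
    p t x y = diamond_kernel t x y.
Proof.
have [K [c [phi fr]]] := @diamond_frame R P i.
split=> [hp t x y t0|pE]; first exact: heat_kernel_unique fr _ _ _ _ hp t0.
split=> [t t0|].
  rewrite (_ : (fun z => _) = (fun z => diamond_kernel t z.1 z.2)).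
    exact: kernel_continuous fr _ t0.
  by apply/funext => z; exact: pE.
exists (@heat_flow R P i); split; first exact: exp_semigroup_heat_flow fr.
move=> t f t0 Sf a; apply: aeW => s _; rewrite /heat_flow /mu_inner.
by congr mu_integral; apply/funext => y; rewrite pE.
Qed.
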